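(* For any $N\in\mathbb{N}$ there exists an explicit set $\diamond_{\mathbb P}(N)$ of $N$ points on $\mathbb{RP}^2$, depending on certain random parameters (for $N\ge121$, the set constructed in the context, whose random parameters are the phases $\theta_1,\dots,\theta_{M-1}$), whose expected (projective) logarithmic energy is, as $N\to\infty$, $$W_{\log}(\mathbb{RP}^2)N^2-\frac12N\log N+\left(c_\diamond-\frac12\log2\right)N+O\left(\sqrt N\log N\right),$$ where $W_{\log}(\mathbb{RP}^2)=1-\log2$ and $c_\diamond=-0.049222\ldots$ is the constant given in the context. (Here $c_\diamond-\frac12\log2=-0.395795\ldots$)
   Context: Points of $\mathbb{RP}^2$ are represented by unit vectors $x\in\mathbb{S}^2\subset\mathbb{R}^3$, with $x$ and $-x$ identified. For $\omega_N=\{x_1,\dots,x_N\}\subset\mathbb{RP}^2$, $$\mathscr{E}^{\mathbb P}_{\log}(\omega_N)=-\sum_{i\neq j}\log\sqrt{1-\langle x_i,x_j\rangle^2}$$ (sum over ordered pairs). The constant $c_\diamond$ is defined by $$14340\,c_\diamond=19120\log239-2270\log227-1460\log73-265\log53-1935\log43-930\log31-1710\log19-1938\log17+19825\log13+1750\log7-4250\log5-131307\log3+56586\log2-7170.$$ Construction of $\diamond_{\mathbb P}(N)$ for $N\ge121$. Put $N'=2N$ and $$m=\left\lfloor\sqrt{\tfrac{N'-2}{239}}\right\rfloor,\quad \gamma=\left\lfloor\tfrac{N'-239m^2-2}{2m-1}\right\rfloor,\quad \eta=(N'-239m^2-2)\bmod(2m-1),\quad M=7m.$$ Define integers $d$ and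 $\varepsilon$ by: if $\eta=0$ (in particular if $N'=239m^2+2$), $d=7m-1$ and $\varepsilon=-1$; if $\eta\neq0$ is odd, $d=7m-1-\frac{\eta-1}{2}$ and $\varepsilon=0$; if $\eta\ne0$ is even, $d=7m-1-\frac{\eta-2}{2}$ and $\varepsilon=1$. Let $$r(x)=\begin{cases}6x&0<x\le2m\\2m+5x&2m<x\le3m\\5m+4x&3m<x\le4m\\9m+3x&4m<x\le5m\\14m+2x&5m<x\le6m\\20m+x+\gamma&6m<x\le d\\20m+x+\gamma+1&d<x\le7m-1\\20m+x+\gamma+1+\varepsilon&7m-1<x\le7m\end{cases}$$ and $r_j=r(j)$ for $1\le j\le M$ (then $r_M$ is even and $N=1+r_1+\dots+r_{M-1}+r_M/2$). For $1\le j\le M-1$ let $$z_j=1-\frac{1+r_j+2\sum_{k=1}^{j-1}r_k}{2N-1}.$$ Then $\diamond_{\mathbb P}(N)$ consists of (the classes of) the north pole $(0,0,1)$; for each $1\le j\le M-1$, the $r_j$ points $$\left(\sqrt{1-z_j^2}\cos\left(\tfrac{2\pi i}{r_j}+\theta_j\right),\ \sqrt{1-z_j^2}\sin\left(\tfrac{2\pi i}{r_j}+\theta_j\right),\ z_j\right),\quad 1\le i\le r_j;$$ and the $r_M/2$ points $\left(\cos\frac{2\pi k}{r_M},\sin\frac{2\pi k}{r_M},0\right)$, $0\le k\le\frac{r_M}{2}-1$. The random parameters are the phases $\theta_1,\dots,\theta_{M-1}$, independent and uniform in $[0,2\pi]$; the expectation is taken with respect to them. *)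

(* Defs.v *)
From HB Require Import structures.
From mathcomp Require Import all_boot all_order all_algebra.
From mathcomp Require Import all_classical all_reals all_analysis.

Set Implicit Arguments.
Unset Strict Implicit.
Unset Printing Implicit Defensive.

Import Order.TTheory GRing.Theory Num.Theory numFieldNormedType.Exports.

Local Open Scope classical_set_scope.
Local Open Scope ring_scope.

Definition dotp (R : realType) (x y : 'rV[R]_3) : R :=
  \sum_(i < 3) x 0 i * y 0 i.

(* A point of RP^2 is represented by a unit vector x of R^3, with x and -x
   identified: s represents a set of N (distinct) points of RP^2. The norm is
   spelled out through dotp because `|x| is the sup norm on row vectors. *)
Definition RP2_points (R : realType) (N : nat) (s : seq 'rV[R]_3) : Prop :=
  [/\ size s = N,
      {in s, forall x, dotp x x = 1} &
      pairwise (fun x y => (x != y) && (x != - y)) s].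

Definition log_energy (R : realType) (s : seq 'rV[R]_3) : R :=
  - \sum_(i < size s) \sum_(j < size s | j != i)
      ln (Num.sqrt (1 - dotp s`_i s`_j ^+ 2)).

(* The continuous logarithmic energy of RP^2: the mean of
   - ln (sqrt (1 - t ^+ 2)) over t uniform in [-1, 1]. *)
Definition W_log_RP2 (R : realType) : R := 1 - ln 2.

Definition c_diamond (R : realType) : R :=
  (19120%:R * ln 239 - 2270 * ln 227 - 1460 * ln 73 - 265 * ln 53
   - 1935 * ln 43 - 930 * ln 31 - 1710 * ln 19 - 1938 * ln 17
   + 19825%:R * ln 13 + 1750 * ln 7 - 4250 * ln 5
   - 131307%:R * ln 3 + 56586%:R * ln 2 - 7170%:R) / 14340%:R.

(* For N >= 121 one has 1 <= m and 239 * m ^ 2 + 2 <= 2 * N, so that no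
   subtraction on nat below is truncated. *)
Definition diamond_m (R : realType) (N : nat) : nat :=
  Num.truncn (Num.sqrt (((2 * N)%:R - 2) / 239) : R).

Definition diamond_gamma (R : realType) (N : nat) : nat :=
  let m := diamond_m R N in ((2 * N - 239 * m ^ 2 - 2) %/ (2 * m - 1))%N.

Definition diamond_eta (R : realType) (N : nat) : nat :=
  let m := diamond_m R N in ((2 * N - 239 * m ^ 2 - 2) %% (2 * m - 1))%N.

Definition diamond_M (R : realType) (N : nat) : nat := (7 * diamond_m R N)%N.

Definition diamond_d (R : realType) (N : nat) : nat :=
  let m := diamond_m R N in let eta := diamond_eta R N in
  if eta == 0%N then (7 * m - 1)%N
  else if odd eta then (7 * m - 1 - (eta - 1) %/ 2)%N
  else (7 * m - 1 - (eta - 2) %/ 2)%N.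

Definition diamond_eps (R : realType) (N : nat) : int :=
  let eta := diamond_eta R N in
  if eta == 0%N then - 1 else if odd eta then 0 else 1.

(* In the last case, `|1 + eps| is just 1 + eps >= 0, as a nat. *)
Definition diamond_r (R : realType) (N x : nat) : nat :=
  let m := diamond_m R N in
  (if x <= 2 * m then 6 * x
   else if x <= 3 * m then 2 * m + 5 * x
   else if x <= 4 * m then 5 * m + 4 * x
   else if x <= 5 * m then 9 * m + 3 * x
   else if x <= 6 * m then 14 * m + 2 * x
   else if x <= diamond_d R N then 20 * m + x + diamond_gamma R N
   else if x <= 7 * m - 1 then 20 * m + x + diamond_gamma R N + 1
   else 20 * m + x + diamond_gamma R N + `|(1 + diamond_eps R N)%R|)%N.

Definition diamond_z (R : realType) (N j : nat) : R :=
  1 - (1 + (diamond_r R N j)%:R + 2 * \sum_(1 <= k < j) (diamond_r R N k)%:R)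
      / (2 * N%:R - 1).

Definition vec3 (R : realType) (x y z : R) : 'rV[R]_3 :=
  \row_(i < 3) [:: x; y; z]`_i.

Definition diamond_parallel (R : realType) (N j : nat) (theta : R) :
    seq 'rV[R]_3 :=
  let z := diamond_z R N j in let r := diamond_r R N j in
  [seq vec3 (Num.sqrt (1 - z ^+ 2) * cos (2 * pi * i%:R / r%:R + theta))
            (Num.sqrt (1 - z ^+ 2) * sin (2 * pi * i%:R / r%:R + theta))
            z | i <- iota 1 r].

Definition diamond_equator (R : realType) (N : nat) : seq 'rV[R]_3 :=
  let r := diamond_r R N (diamond_M R N) in
  [seq vec3 (cos (2 * pi * k%:R / r%:R)) (sin (2 * pi * k%:R / r%:R)) 0
     | k <- iota 0 (r %/ 2)].

(* theta_1, ..., theta_(M-1) are the entries 0, ..., M-2 of theta. *)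
Definition diamond (R : realType) (N : nat)
    (theta : (diamond_M R N).-1.-tuple R) : seq 'rV[R]_3 :=
  vec3 0 0 1 ::
  flatten [seq diamond_parallel N j theta`_j.-1
             | j <- iota 1 (diamond_M R N).-1]
  ++ diamond_equator R N.

Lemma twopi_gt0 (R : realType) : 0 < 2 * pi :> R.
Proof. by rewrite mulr_gt0// pi_gt0. Qed.

Definition uniform_phase (R : realType) : probability (measurableTypeR R) R :=
  uniform_prob (twopi_gt0 R).

Definition cons_pair (R : realType) (n : nat)
    (p : measurableTypeR R * n.-tuple (measurableTypeR R)) :
  n.+1.-tuple (measurableTypeR R) := [tuple of p.1 :: p.2].

Lemma measurable_cons_pair (R : realType) (n : nat) :
  measurable_fun [set: _] (@cons_pair R n).
Proof. exact: measurable_cons. Qed.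

HB.instance Definition _ (R : realType) (n : nat) :=
  isMeasurableFun.Build _ _ _ _ (@cons_pair R n)
    (@measurable_cons_pair R n).

(* The joint law of n independent uniform phases in [0, 2 pi], that is, the
   n-fold product of uniform_phase (see phase_law_box). *)
Fixpoint phase_law (R : realType) (n : nat) :
    probability (n.-tuple (measurableTypeR R)) R :=
  match n with
  | 0 => \d_[tuple]
  | n'.+1 => distribution (uniform_phase R \x phase_law R n')%E
               (@cons_pair R n')
  end.

Lemma phase_law_box (R : realType) (n : nat)
    (A : 'I_n -> set (measurableTypeR R)) : (forall i, measurable (A i)) ->
  phase_law R n [set t | forall i, A i (tnth t i)] =
  (\prod_(i < n) uniform_phase R (A i))%E.
Proof.
elim: n A => [|n IH] A mA.
  by rewrite big_ord0 /= diracE mem_set//= => -[].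
rewrite big_ord_recl /= -IH// /distribution /pushforward -product_measure1E//=.
  congr (product_measure1 _ _ _); apply/seteqP; split => -[x t] /=.
    move=> Axt; split; first exact: (Axt ord0).
    by move=> i; have := Axt (lift ord0 i); rewrite tnthS.
  by move=> [Ax At] i; case: (unliftP ord0 i) => [j|] ->; rewrite ?tnthS.
rewrite (_ : [set t | _] =
    \big[setI/setT]_(i < n) ((@tnth n R ^~ i) @^-1` A (lift ord0 i))).
  apply: bigsetI_measurable => i _; rewrite -[X in measurable X]setTI.
  exact: measurable_tnth.
rewrite -bigcap_seq; apply/seteqP; split => t /= At i.
  by move=> _; exact: At.
by apply: (At i); rewrite /= mem_index_enum.
Qed.

(* Main.v *)
(* Two points of the same parallel interact through a fixed difference of
   longitudes, and two points of different parallels through an independent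
   uniform one. For heights 0 <= w < z the chord factor 1 - <x, y>^2 splits into
   two factors of the form c |1 - q exp(i u)|^2 with |q| < 1; averaging over the
   phases kills the logarithms of the moduli (ln |1 - q exp(i u)|^2 has mean 0,
   because the product over the n-th roots of unity is |1 - q^n exp(i n u)|^2).
   The expected energy is therefore an explicit sum over the parallels.

   With S_j = 2 (r_1 + ... + r_(j-1)) + r_j and K = 2 N - 1 one has
   z_j = 1 - (1 + S_j) / K, so that the main sum is a midpoint rule for the
   integral of u ln u over cells of width 2 r_j; its second-order correction
   telescopes on each piece where r is affine, the sums of r_j ln r_j are again
   midpoint rules, and the interaction of the points of one parallel contributes
   a term O(sum 1 / z_j) = O(sqrt N log N). *)

Require Import Defs.
From HB Require Import structures.
From mathcomp Require Import all_boot all_order all_algebra.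
From mathcomp Require Import all_classical all_reals all_analysis.
From mathcomp Require Import measurable_realfun complex.
From mathcomp Require Import ring lra zify.
Import Order.TTheory GRing.Theory Num.Theory numFieldNormedType.Exports.
Local Open Scope classical_set_scope.
Local Open Scope ring_scope.
Set Implicit Arguments.
Unset Strict Implicit.
Unset Printing Implicit Defensive.

(** * The mean of a function under independent uniform phases *)

Section shift.
Context {R : realType}.
Notation mu := (@lebesgue_measure R).

(** No logarithm is ever integrated: the mean is invariant under shifts of a single phase, and k
    times the mean of a logarithmic factor stays bounded as k grows, so this mean is 0. Only bounded
    periodic functions and nonnegative integrals are needed for that. The error budget shapes the
    rest. Write m for [diamond_m], of order sqrt (2 N / 239). There are 7 m parallels and the target
    error is of order m ln m, so every parallel may contribute O(1 + ln m), but uniformly from the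
    pole to the equator. Near the pole r_j is of order j and S_j of order j^2, so the cells are not
    narrow relative to their distance from 0: r_j / (S_j + 1) equals 6 / 7 at j = 1. All midpoint
    estimates are therefore proved with explicit remainders up to the ratio 6 / 7. The number 239 is
    the limit of K / m^2. The points left over after 239 m^2 + 2 change r by a bounded amount, and
    only on the last affine piece; there the exact identities of the other pieces become
    estimates. *)

Lemma integral_shift (h : R -> R) (a b c : R) : a <= b -> continuous h ->
  (\int[mu]_(x in `[(a + c)%R, (b + c)%R]) (h x)%:E =
   \int[mu]_(x in `[a, b]) (h (x + c)%R)%:E)%E.
Proof.
move=> ab ch.
have D (x : R) : is_derive x 1 (fun y => y + c) 1.
  by apply: is_derive_eq; rewrite addr0.
have dE : (fun y => y + c)^`()%classic = cst 1.
  by apply/funext => x; rewrite derive1E; apply: derive_val.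
have co : continuous (fun y : R => y + c).
  by move=> x; apply: differentiable_continuous; apply/derivable1_diffP; apply: ex_derive.
rewrite (@integration_by_substitution_increasing R (fun y => y + c) h a b) //.
- by apply: eq_integral => x _; rewrite dE /= mulr1.
- by move=> x y _ _ xy; rewrite ltrD2r.
- by rewrite dE => x _; apply: cvg_cst.
- by rewrite dE; apply: is_cvg_cst.
- by rewrite dE; apply: is_cvg_cst.
- split.
  + by move=> x _; apply: ex_derive.
  + by apply: cvg_at_right_filter; apply: co.
  + by apply: cvg_at_left_filter; apply: co.
- exact: continuous_subspaceT.
Qed.

Lemma integral_itv_split (h : R -> R) (a b c : R) : a <= b -> b <= c ->
  continuous h -> (forall x, 0 <= h x) ->
  (\int[mu]_(x in `[a, c]) (h x)%:E =
   \int[mu]_(x in `[a, b]) (h x)%:E + \int[mu]_(x in `[b, c]) (h x)%:E)%E.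
Proof.
move=> ab bc ch h0.
have mh (A : set R) : measurable_fun A h.
  exact: (measurable_funTS (continuous_measurable_fun ch)).
rewrite -(@integral_itv_obnd_cbnd _ b); last by apply/measurable_EFinP; exact: mh.
rewrite -ge0_integral_setU//=.
- congr (integral _ _ _); apply/seteqP; split => x /=; rewrite !in_itv/=.
    by move=> /andP[-> ->]; case: (lerP x b) => ?; [left|right].
  move=> [|] /andP[H1 H2]; apply/andP; split => //.
  + exact: le_trans H2 bc.
  + by apply: le_trans ab _; apply: ltW.
- by apply/measurable_EFinP; exact: mh.
- by move=> x _; rewrite lee_fin.
- apply/disj_set2P; apply/seteqP; split => // x [] /=; rewrite !in_itv/=.
  by move=> /andP[_ H1] /andP[]; rewrite ltNge H1.
Qed.

(** Periodicity moves the part of the shifted interval beyond 2 pi back to the beginning.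
    Nonnegativity makes the integrals additive with no integrability to check. *)
Lemma uniform_phase_shift (h : R -> R) (c : R) : 0 <= c <= 2 * pi ->
  continuous h -> (forall x, 0 <= h x) -> (forall x, h (x + 2 * pi) = h x) ->
  (\int[uniform_phase R]_x (h (x + c)%R)%:E = \int[uniform_phase R]_x (h x)%:E)%E.
Proof.
move=> /andP[c0 c2] ch h0 hp.
have chc : continuous (fun x => h (x + c)).
  move=> x; apply: (@continuous_comp _ _ _ (fun x => x + c) h); last exact: ch.
  by apply: cvgD; [exact: cvg_id|exact: cvg_cst].
have mh (f : R -> R) : continuous f -> measurable_fun [set: R] (EFin \o f).
  by move=> cf; apply/measurable_EFinP; exact: continuous_measurable_fun.
rewrite !(@integral_uniform _ _ _ _ (EFin \o _));
  [|exact: mh|by move=> x; rewrite lee_fin|exact: mh|by move=> x; rewrite lee_fin].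
congr (_ * _)%E.
rewrite -integral_shift//; last by rewrite mulr_ge0// pi_ge0.
rewrite add0r (@integral_itv_split _ c (2 * pi) (2 * pi + c))//; last by rewrite lerDl.
rewrite (@integral_itv_split _ 0 c (2 * pi))//.
rewrite addeC; congr (_ + _)%E.
rewrite -{1}[2 * pi]add0r addrC [X in `[_, X]]addrC (addrC _ 0) integral_shift//.
by apply: eq_integral => x _; rewrite hp.
Qed.
End shift.
Section phase.
Context {R : realType}.

Definition shift n (i : 'I_n) (c : R) (t : n.-tuple R) : n.-tuple R :=
  [tuple tnth t j + (if j == i then c else 0) | j < n].

Lemma tnth_shift n (i : 'I_n) c (t : n.-tuple R) j :
  tnth (shift i c t) j = tnth t j + (if j == i then c else 0).
Proof. by rewrite tnth_mktuple. Qed.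

Lemma shift_cons0 n c x (t : n.-tuple R) :
  shift ord0 c [tuple of x :: t] = [tuple of x + c :: t].
Proof.
apply: eq_from_tnth => j; rewrite tnth_shift.
by case: (unliftP ord0 j) => [k|] ->; rewrite ?tnthS ?tnth0 ?eqxx //= ?addr0.
Qed.

Lemma shift_consS n (i : 'I_n) c x (t : n.-tuple R) :
  shift (lift ord0 i) c [tuple of x :: t] = [tuple of x :: shift i c t].
Proof.
apply: eq_from_tnth => j; rewrite tnth_shift.
case: (unliftP ord0 j) => [k|] ->; last by rewrite !tnth0 addr0.
by rewrite !tnthS tnth_shift (inj_eq lift_inj).
Qed.

Lemma measurable_shift n (i : 'I_n) c :
  measurable_fun [set: n.-tuple (measurableTypeR R)]
    (shift i c : n.-tuple (measurableTypeR R) -> n.-tuple (measurableTypeR R)).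
Proof.
apply/measurable_fun_tnthP => j.
rewrite (_ : _ \o _ = (fun t : n.-tuple (measurableTypeR R) =>
   tnth t j + (if j == i then c else 0))).
  by apply: measurable_funD => //; exact: measurable_tnth.
by apply/funext => t /=; rewrite tnth_shift.
Qed.

(** Induction on the number of phases, with Tonelli's theorem in both orders: the head is integrated
    inside when it is the shifted coordinate, and outside otherwise. *)
Lemma integral_phase_shift n (F : n.-tuple (measurableTypeR R) -> R) (i : 'I_n) c :
  measurable_fun setT F -> (forall t, 0 <= F t) ->
  (forall t, continuous (fun x => F (shift i x t))) ->
  (forall t, F (shift i (2 * pi) t) = F t) -> 0 <= c <= 2 * pi ->
  (\int[phase_law R n]_t (F (shift i c t))%:E = \int[phase_law R n]_t (F t)%:E)%E.
Proof.
move=> + + + + c02.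
elim: n F i => [F []//|n IH] F i mF F0 cF pF.
have mFs : measurable_fun setT (fun t => F (shift i c t)).
  apply: (measurableT_comp mF); exact: measurable_shift.
have mEF (G : n.+1.-tuple (measurableTypeR R) -> R) : measurable_fun setT G ->
   measurable_fun setT (fun p => (G (cons_pair p))%:E).
  move=> mG; apply/measurable_EFinP; apply: (measurableT_comp mG).
  exact: measurable_cons_pair.
have Edist (G : n.+1.-tuple (measurableTypeR R) -> R) : measurable_fun setT G ->
   (forall t, 0 <= G t) -> (\int[phase_law R n.+1]_t (G t)%:E =
   \int[(uniform_phase R \x phase_law R n)%E]_p (G (cons_pair p))%:E)%E.
  move=> mG G0; rewrite /= ge0_integral_distribution//=.
  by apply/measurable_EFinP.
rewrite !Edist//.
have P0 (G : n.+1.-tuple (measurableTypeR R) -> R) : (forall t, 0 <= G t) ->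
  forall p : measurableTypeR R * n.-tuple (measurableTypeR R),
   (0 <= (G (cons_pair p))%:E)%E by move=> G0 p; rewrite lee_fin.
case: (unliftP ord0 i) => [j ij|i0].
- rewrite !fubini_tonelli1; [|exact: (mEF F)|exact: (P0 F)|exact: (mEF (fun t => F (shift i c
  t)))|exact: (P0 (fun t => F (shift i c t)))].
  apply: eq_integral => x _; rewrite /fubini_F /=.
  transitivity (\int[phase_law R n]_y (F [tuple of x :: shift j c y])%:E)%E.
    by apply: eq_integral => y _; rewrite ij shift_consS.
  apply: (IH (fun t => F [tuple of x :: t])) => //.
  + apply: (measurableT_comp mF); exact: measurable_cons.
  + move=> t; rewrite (_ : (fun _ => _) = (fun y => F (shift i y [tuple of x :: t]))).
      exact: cF.
    by apply/funext => y; rewrite ij shift_consS.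
  + by move=> t; rewrite -shift_consS -ij pF.
- rewrite !fubini_tonelli2; [|exact: (mEF F)|exact: (P0 F)|exact: (mEF (fun t => F (shift i c
  t)))|exact: (P0 (fun t => F (shift i c t)))].
  apply: eq_integral => t _; rewrite /fubini_G /=.
  transitivity (\int[uniform_phase R]_x (F [tuple of x + c :: t])%:E)%E.
    by apply: eq_integral => y _; rewrite i0 shift_cons0.
  apply: (uniform_phase_shift (h := fun x => F [tuple of x :: t])) => //.
  + rewrite (_ : (fun _ => _) = (fun y => F (shift i y [tuple of 0 :: t]))).
      exact: cF.
    by apply/funext => y; rewrite i0 shift_cons0 add0r.
  + by move=> x; rewrite -shift_cons0 -i0 pF.
Qed.

(** Integrability is part of the predicate: linearity requires it, and [fine] would turn an infinite
    integral into 0. *)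
Definition has_mean n (F : n.-tuple R -> R) (c : R) : Prop :=
  (phase_law R n).-integrable setT (fun t => (F t)%:E) /\
  (\int[phase_law R n]_t (F t)%:E = c%:E)%E.

Lemma has_mean_cst n (c : R) : has_mean (fun _ : n.-tuple R => c) c.
Proof.
split.
  by apply: finite_measure_integrable_cst.
by rewrite integral_cst// [X in (_ * X)%E]probability_setT mule1.
Qed.

Lemma has_meanD n (F G : n.-tuple R -> R) a b :
  has_mean F a -> has_mean G b -> has_mean (fun t => F t + G t) (a + b).
Proof.
move=> [iF eF] [iG eG]; split.
  have -> : (fun t => (F t + G t)%:E) = (fun t => (F t)%:E + (G t)%:E)%E by [].
  exact: integrableD.
by under eq_integral do rewrite EFinD; rewrite integralD// eF eG.
Qed.

Lemma has_meanZ n (F : n.-tuple R -> R) k a :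
  has_mean F a -> has_mean (fun t => k * F t) (k * a).
Proof.
move=> [iF eF]; split.
  have -> : (fun t => (k * F t)%:E) = (fun t => k%:E * (F t)%:E)%E by [].
  exact: integrableZl.
by under eq_integral do rewrite EFinM; rewrite integralZl// eF.
Qed.

Lemma has_meanN n (F : n.-tuple R -> R) a :
  has_mean F a -> has_mean (fun t => - F t) (- a).
Proof.
move=> /(@has_meanZ _ _ (-1)); rewrite mulN1r.
by congr has_mean; apply/funext => t; rewrite mulN1r.
Qed.

Lemma has_mean_sum n (I : eqType) (s : seq I) (F : I -> n.-tuple R -> R) a :
  {in s, forall i, has_mean (F i) (a i)} ->
  has_mean (fun t => \sum_(i <- s) F i t) (\sum_(i <- s) a i).
Proof.
elim: s => [_|x s IH H].
  rewrite big_nil (_ : (fun _ => _) = (fun _ => 0)); first exact: has_mean_cst.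
  by apply/funext => t; rewrite big_nil.
rewrite big_cons (_ : (fun _ => _) = (fun t => F x t + \sum_(i <- s) F i t)).
  apply: has_meanD; first by apply: H; rewrite mem_head.
  by apply: IH => i si; apply: H; rewrite inE si orbT.
by apply/funext => t; rewrite big_cons.
Qed.

Lemma has_mean_bounded n (F : n.-tuple (measurableTypeR R) -> R) B :
  measurable_fun setT F -> (forall t, `|F t| <= B) -> exists2 c, has_mean F c & `|c| <= B.
Proof.
move=> mF bF.
have iF : (phase_law R n).-integrable setT (EFin \o F).
  apply: measurable_bounded_integrable => //.
    by rewrite [X in (X < _)%E]probability_setT ltry.
  by exists B; split; [exact: num_real|move=> x Bx t _; apply: le_trans (bF t) (ltW Bx)].
have fi := integrable_fin_num measurableT iF.
exists (fine (\int[phase_law R n]_t (F t)%:E)%E).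
  by split => //; rewrite fineK.
rewrite -lee_fin -abse_EFin fineK//.
apply: le_trans (le_abse_integral _ _ _) _ => //.
  by case/integrableP: iF.
apply: le_trans (integral_le_bound B%:E _ _ _ _) _ => //=.
- by case/integrableP: iF.
- by rewrite lee_fin; apply: le_trans (bF [tuple 0 | i < n]).
- by apply: aeW => t _; rewrite lee_fin.
- by rewrite [X in (_ * X)%E]probability_setT mule1.
Qed.

Lemma has_mean_uniq n (F : n.-tuple R -> R) a b : has_mean F a -> has_mean F b -> a = b.
Proof. by move=> [_ ea] [_]; rewrite ea => -[]. Qed.

Lemma has_mean_shift n (F : n.-tuple (measurableTypeR R) -> R) (i : 'I_n) c B a :
  measurable_fun setT F -> (forall t, `|F t| <= B) ->
  (forall t, continuous (fun x => F (shift i x t))) ->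
  (forall t, F (shift i (2 * pi) t) = F t) -> 0 <= c <= 2 * pi ->
  has_mean F a -> has_mean (fun t => F (shift i c t)) a.
Proof.
move=> mF bF cF pF c02 mFa.
have mFs : measurable_fun setT (fun t => F (shift i c t)).
  apply: (measurableT_comp mF); exact: measurable_shift.
have [b mb _] := has_mean_bounded mFs (fun t => bF (shift i c t)).
suff -> : a = b by [].
(* Shift invariance is available for nonnegative functions; adding the bound [B] makes [F]
   nonnegative. *)
have h1 := has_meanD mFa (has_mean_cst n B).
have h2 := has_meanD mb (has_mean_cst n B).
apply: (addIr B); apply: (has_mean_uniq h1); split; first by case: h1.
case: (h2) => _ <-; symmetry.
apply: (@integral_phase_shift n (fun t => F t + B) i c) => //.
- by apply: measurable_funD.
- by move=> t; have := bF t; rewrite ler_norml => /andP[+ _]; lra.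
- by move=> t x; apply: cvgD; [exact: cF|exact: cvg_cst].
- by move=> t; rewrite pF.
Qed.

(* Averaging F over the shifts of coordinate i by the multiples of
   2 pi / (k + 1) does not change its mean; let k go to infinity. *)
Lemma has_mean_average n (F : n.-tuple (measurableTypeR R) -> R) (i : 'I_n) B C c :
  measurable_fun setT F -> (forall t, `|F t| <= B) ->
  (forall t, continuous (fun x => F (shift i x t))) ->
  (forall t, F (shift i (2 * pi) t) = F t) ->
  (forall k t, `|\sum_(l < k.+1) F (shift i (2 * pi * l%:R / k.+1%:R) t) - k.+1%:R * c| <= C) ->
  has_mean F c.
Proof.
move=> mF bF cF pF avF.
have [a ma _] := has_mean_bounded mF bF.
suff -> : c = a by [].
have main k : k.+1%:R * `|a - c| <= C.
  have h : has_mean (fun t => \sum_(l < k.+1) F (shift i (2 * pi * l%:R / k.+1%:R) t) - k.+1%:R * c)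
     (k.+1%:R * (a - c)).
    rewrite mulrBr; apply: has_meanD; last exact: has_mean_cst.
    rewrite (_ : _ * a = \sum_(l < k.+1) a); last by rewrite sumr_const card_ord mulr_natl.
    apply: has_mean_sum => l _; apply: has_mean_shift bF cF pF _ ma => //.
    rewrite !mulr_ge0 ?invr_ge0 ?pi_ge0//= ler_pdivrMr ?ltr0n//.
    by rewrite ler_wpM2l ?mulr_ge0 ?pi_ge0// ler_nat ltnW.
  have mS : measurable_fun setT (fun t : n.-tuple (measurableTypeR R) =>
      \sum_(l < k.+1) F (shift i (2 * pi * l%:R / k.+1%:R) t) - k.+1%:R * c).
    apply: measurable_funD => //; apply: measurable_sum => l.
    apply: (measurableT_comp mF); exact: measurable_shift.
  have [b mb bC] := has_mean_bounded mS (avF k).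
  by rewrite -(normr_nat R k.+1) -normrM (has_mean_uniq h mb).
apply/eqP; rewrite eq_sym -subr_eq0 -normr_eq0; apply/eqP/le_anti; rewrite normr_ge0 andbT leNgt.
apply/negP => ac.
have C0 : 0 <= C by apply: le_trans (main 0%N); rewrite mulr_ge0.
have := main (Num.truncn (C / `|a - c|)).
have := @truncnS_gt R (C / `|a - c|).
by rewrite ltr_pdivrMr// => h1 h2; have := lt_le_trans h1 h2; rewrite ltxx.
Qed.

Lemma integral_has_mean n (F : n.-tuple R -> R) c : has_mean F c ->
  fine ('E_(phase_law R n)[F])%E = c.
Proof. by move=> [_]; rewrite unlock => ->. Qed.
End phase.

(** * Products of chords *)

Lemma prod_sub_prim_root (F : fieldType) n (w z : F) : n.-primitive_root w ->
  \prod_(l < n) (z - w ^+ l) = z ^+ n - 1.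
Proof.
move=> /factor_Xn_sub_1 /(congr1 (fun p => p.[z])).
rewrite big_mkord horner_prod !hornerE => <-.
by apply: eq_bigr => l _; rewrite !hornerE.
Qed.

(** Differentiate the factorization of X^n - 1 and evaluate at w^i: only the term that omits the
    factor l = i survives. *)
Lemma prod_sub_prim_root_neq (F : fieldType) n (w : F) (i : 'I_n) : n.-primitive_root w ->
  \prod_(l < n | l != i) (w ^+ i - w ^+ l) = n%:R * w ^+ i ^+ n.-1.
Proof.
move=> /factor_Xn_sub_1 /(congr1 (fun p => (deriv p).[w ^+ i])).
rewrite big_mkord (bigD1 i)//= derivM !derivB derivXn derivX !derivC !subr0 mul1r.
rewrite hornerD hornerM hornerXsubC subrr mul0r addr0 hornerMn hornerXn horner_prod mulr_natl => <-.
by apply: eq_bigr => l _; rewrite hornerXsubC.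
Qed.

Section roots.
Context {R : realType}.
Implicit Types (x y q : R) (n l i : nat).

Lemma cos_lt1 x : 0 < x < 2 * pi -> cos x < 1.
Proof.
move=> /andP[x0 x2].
have -> : x = (x / 2) *+ 2 by rewrite mulr2n; field.
have /sin_gt0_pi s0 : 0 < x / 2 < pi by apply/andP; split; lra.
rewrite cos_mulr2n cos2sin2 mulr2n.
have := exprn_gt0 2 s0; lra.
Qed.

Definition cexp x : R[i] := Complex (cos x) (sin x).

(** The squared modulus as an element of [R]; the norm of [R[i]] has values in [R[i]]. *)
Definition nsq (z : R[i]) : R := complex.Re z ^+ 2 + complex.Im z ^+ 2.

Lemma cexpD x y : cexp (x + y) = cexp x * cexp y.
Proof. by rewrite /cexp cosD sinD; simpc; rewrite (addrC (sin x * _)). Qed.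

Lemma cexp0 : cexp 0 = 1.
Proof. by rewrite /cexp cos0 sin0. Qed.

Lemma cexpX x n : cexp x ^+ n = cexp (n%:R * x).
Proof.
elim: n => [|n IH]; first by rewrite expr0 mul0r cexp0.
by rewrite exprS IH -cexpD -natr1 mulrDl mul1r addrC.
Qed.

Lemma nsqM a b : nsq (a * b) = nsq a * nsq b.
Proof. by case: a b => [a1 a2] [b1 b2]; rewrite /nsq; simpc => /=; ring. Qed.

Lemma nsq1 : nsq 1 = 1.
Proof. by rewrite /nsq /= expr0n addr0 expr1n. Qed.

Lemma nsq_prod (I : Type) (s : seq I) (P : pred I) (F : I -> R[i]) :
  nsq (\prod_(i <- s | P i) F i) = \prod_(i <- s | P i) nsq (F i).
Proof. exact: (big_morph nsq nsqM nsq1). Qed.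

Lemma nsqB_cexp q x y : nsq ((q%:C)%C * cexp x - cexp y) = 1 - 2 * q * cos (x - y) + q ^+ 2.
Proof.
rewrite /nsq /cexp; simpc => /=; rewrite cosB.
have := cos2Dsin2 x; have := cos2Dsin2 y; nra.
Qed.

Lemma cexp_prim n : (0 < n)%N -> n.-primitive_root (cexp (2 * pi / n%:R)).
Proof.
move=> n0; rewrite /primitive_root_of_unity n0 /=; apply/forallP => i.
have nR : n%:R != 0 :> R by rewrite pnatr_eq0 -lt0n.
rewrite unity_rootE cexpX; apply/eqP; apply/eqP/eqP => [|in_].
  have [//|ine] := eqVneq i.+1 n.
  move=> [c _]; exfalso; move: c; apply/eqP; rewrite lt_eqF//.
  apply: cos_lt1; have p0 := pi_gt0 R; apply/andP; split.
    by rewrite !(mulr_gt0, invr_gt0) ?ltr0n.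
  rewrite mulrCA gtr_pMr ?mulr_gt0// ltr_pdivrMr ?ltr0n// mul1r ltr_nat.
  by rewrite ltn_neqAle ine ltn_ord.
by rewrite in_ mulrC divfK// /cexp mulr_natl cos2pi sin2pi.
Qed.

Lemma cexp_primX n l : cexp (2 * pi / n%:R) ^+ l = cexp (2 * pi * l%:R / n%:R).
Proof. by rewrite cexpX; congr cexp; ring. Qed.

Lemma prod_cexp n (z : R[i]) : (0 < n)%N ->
  \prod_(l < n) (z - cexp (2 * pi * l%:R / n%:R)) = z ^+ n - 1.
Proof.
move=> n0; rewrite -(prod_sub_prim_root _ (cexp_prim n0)).
by apply: eq_bigr => l _; rewrite cexp_primX.
Qed.

(** Squared moduli of both sides of [prod_cexp] at z = q e^(-ix), each computed by the law of
    cosines. *)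
Lemma prod_cos q x n : (0 < n)%N ->
  \prod_(l < n) (1 - 2 * q * cos (x + 2 * pi * l%:R / n%:R) + q ^+ 2) =
  1 - 2 * q ^+ n * cos (n%:R * x) + q ^+ n ^+ 2.
Proof.
move=> n0; have := congr1 nsq (prod_cexp ((q%:C)%C * cexp (- x)) n0).
rewrite nsq_prod exprMn cexpX -[in RHS]cexp0.
rewrite (_ : (q%:C)%C ^+ n = ((q ^+ n)%:C)%C); last by rewrite rmorphXn.
rewrite nsqB_cexp subr0 mulrN cosN => <-.
by apply: eq_bigr => l _; rewrite nsqB_cexp -opprD cosN.
Qed.

Lemma prod_cos_neq n (i : 'I_n) :
  \prod_(l < n | l != i) (2 - 2 * cos (2 * pi * i%:R / n%:R - 2 * pi * l%:R / n%:R : R)) =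
  n%:R ^+ 2.
Proof.
have n0 : (0 < n)%N by apply: leq_ltn_trans (ltn_ord i).
have := congr1 nsq (prod_sub_prim_root_neq i (cexp_prim n0)).
rewrite nsq_prod nsqM -exprM [in RHS]cexpX [nsq (cexp _)](_ : _ = 1) ?mulr1; last by rewrite
  /nsq /= cos2Dsin2.
rewrite -(rmorph_nat (@real_complex R)) [RHS](_ : _ = n%:R ^+ 2); last by rewrite /nsq /= expr0n
  addr0.
move=> <-; apply: eq_bigr => l _; rewrite !cexp_primX.
by rewrite /nsq /= cosB; have := cos2Dsin2 (2 * pi * i%:R / n%:R : R);
  have := cos2Dsin2 (2 * pi * l%:R / n%:R : R); nra.
Qed.
End roots.

(** * Interaction of two points, and of all points of one parallel *)

Section pairs.
Context {R : realType}.

Lemma cosDM2pi n (x : R) : cos (x + 2 * pi * n%:R) = cos x.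
Proof.
elim: n => [|n IH]; first by rewrite mulr0 addr0.
rewrite -[n.+1%:R]natr1 mulrDr mulr1 addrA.
by rewrite -IH !(mulr_natl pi 2) cosD2pi.
Qed.

Lemma ln_prod (I : eqType) (s : seq I) (P : pred I) (F : I -> R) :
  {in s, forall i, P i -> 0 < F i} ->
  ln (\prod_(i <- s | P i) F i) = \sum_(i <- s | P i) ln (F i).
Proof.
move=> F0; suff [] : 0 < \prod_(i <- s | P i) F i /\
   ln (\prod_(i <- s | P i) F i) = \sum_(i <- s | P i) ln (F i) by [].
elim: s F0 => [|x s IH] F0; first by rewrite !big_nil ltr01 ln1.
have [|p0 ps] := IH; first by move=> i si; apply: F0; rewrite inE si orbT.
rewrite !big_cons; case: ifPn => Px; last by split.
have Fx : 0 < F x by apply: F0; rewrite ?mem_head.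
by split; rewrite ?mulr_gt0// lnM ?posrE// ps.
Qed.

(** This is ln |1 - q e^(iu)|^2. *)
Definition lnP (q u : R) := ln (1 - 2 * q * cos u + q ^+ 2).

Lemma lnP_arg_bounds (a q u : R) : `|q| <= a -> a < 1 ->
  (1 - a) ^+ 2 <= 1 - 2 * q * cos u + q ^+ 2 <= 4.
Proof.
move=> qa a1; have : `|q * cos u| <= `|q| by rewrite normrM ler_piMr// cos_max.
have := normr_ge0 q; move: qa; rewrite -mulrA -(real_normK (num_real q)).
move: `|q| => p pa p0; rewrite ler_norml => /andP[h1 h2].
by apply/andP; split; nra.
Qed.

Lemma lnP_arg_gt0 (q u : R) : `|q| < 1 -> 0 < 1 - 2 * q * cos u + q ^+ 2.
Proof.
move=> q1; have /andP[+ _] := lnP_arg_bounds u (lexx `|q|) q1.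
by apply: lt_le_trans; rewrite exprn_gt0// subr_gt0.
Qed.

(** The bound depends on [a] only, so that one constant serves [lnP q] and all the [lnP (q ^+ k.+1)]
    produced by averaging. *)
Lemma lnP_bound (a q u : R) : `|q| <= a -> a < 1 -> `|lnP q u| <= ln 4 - ln ((1 - a) ^+ 2).
Proof.
move=> qa a1; have a0 : 0 <= a by apply: le_trans qa.
have /andP[h1 h2] := lnP_arg_bounds u qa a1.
have h0 : 0 < (1 - a) ^+ 2 by rewrite exprn_gt0// subr_gt0.
have l4 : 0 <= ln (4 : R) by rewrite ln_ge0//; lra.
have la : ln ((1 - a) ^+ 2) <= 0 by rewrite ln_le0// expr_le1//; lra.
have p0 := lt_le_trans h0 h1.
have : ln ((1 - a) ^+ 2) <= lnP q u by rewrite ler_ln.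
have : lnP q u <= ln 4 by rewrite ler_ln// posrE.
by rewrite ler_norml; lra.
Qed.

Lemma continuous_lnP q : `|q| < 1 -> continuous (lnP q).
Proof.
move=> q1 u; rewrite (_ : lnP q = @ln R \o (fun u => 1 - 2 * q * cos u + q ^+ 2))//.
apply: continuous_comp.
  apply: cvgD; last exact: cvg_cst.
  apply: cvgB; first exact: cvg_cst.
  by apply: cvgM; [exact: cvg_cst|exact: continuous_cos].
exact/continuous_ln/lnP_arg_gt0.
Qed.

Lemma has_mean_lnP n (i : 'I_n) (b : n.-tuple (measurableTypeR R) -> R) (q : R) :
  `|q| < 1 -> measurable_fun setT b -> (forall c t, b (shift i c t) = b t) ->
  has_mean (fun t => lnP q (tnth t i + b t)) 0.
Proof.
move=> q1 mb bi.
apply: (@has_mean_average _ _ _ i (ln 4 - ln ((1 - `|q|) ^+ 2)) (ln 4 - ln ((1 - `|q|) ^+ 2))).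
- apply: (measurableT_comp (f := lnP q)).
    by apply: continuous_measurable_fun; exact: continuous_lnP.
  by apply: measurable_funD => //; exact: measurable_tnth.
- by move=> t; exact: lnP_bound.
- move=> t x.
  rewrite (_ : (fun _ => _) = (fun x => lnP q (tnth t i + x + b t))); last first.
    by apply/funext => y; rewrite tnth_shift eqxx bi.
  apply: (@continuous_comp _ _ _ (fun x => tnth t i + x + b t) (lnP q)); last exact: continuous_lnP.
  apply: cvgD; last exact: cvg_cst.
  by apply: cvgD; [exact: cvg_cst|exact: cvg_id].
- move=> t; rewrite tnth_shift eqxx bi /lnP (addrAC (tnth t i)).
  by have := cosDM2pi 1 (tnth t i + b t); rewrite mulr1 => ->.
- move=> k t; rewrite mulr0 subr0.
  rewrite (_ : \sum_(l < _) _ = lnP (q ^+ k.+1) (k.+1%:R * (tnth t i + b t))).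
    apply: lnP_bound => //; rewrite normrX exprS ler_piMr//.
    by rewrite exprn_ile1// ltW.
  rewrite /lnP -prod_cos// -[in RHS](big_mkord xpredT (fun l => 1 - 2 * q * cos (tnth t i + b t
    + 2 * pi * l%:R / k.+1%:R) + q ^+ 2)).
  rewrite ln_prod ?big_mkord.
    by apply: eq_bigr => l _; rewrite tnth_shift eqxx bi (addrAC (tnth t i)).
  by move=> l _ _; apply: lnP_arg_gt0.
Qed.

Definition pt (z a : R) : 'rV[R]_3 :=
  vec3 (Num.sqrt (1 - z ^+ 2) * cos a) (Num.sqrt (1 - z ^+ 2) * sin a) z.

Lemma dotp_pt (z w a b : R) :
  dotp (pt z a) (pt w b) =
  z * w + Num.sqrt (1 - z ^+ 2) * Num.sqrt (1 - w ^+ 2) * cos (a - b).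
Proof. by rewrite /dotp !big_ord_recl big_ord0 !mxE /= cosB; ring. Qed.

Lemma dotp_sym (x y : 'rV[R]_3) : dotp x y = dotp y x.
Proof. by apply: eq_bigr => i _; rewrite mulrC. Qed.

Definition kern (x y : 'rV[R]_3) := ln (Num.sqrt (1 - dotp x y ^+ 2)).

Lemma kern_sym x y : kern x y = kern y x.
Proof. by rewrite /kern dotp_sym. Qed.

Lemma ln_sqrt (x : R) : 0 < x -> ln (Num.sqrt x) = ln x / 2.
Proof.
by move=> x0; rewrite -{2}(sqr_sqrtr (ltW x0)) lnXn ?sqrtr_gt0// mulr2n; field.
Qed.

(* Both factors of 1 - <x, y>^2 = (1 - <x, y>) (1 + <x, y>) are, up to a
   constant, of the form |1 - q exp(i u)|^2 with u the difference of the
   longitudes. *)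
Lemma kern_pt_neq (z w a b : R) : 0 <= w -> w < z -> z <= 1 ->
  exists q1 q2 : R, [/\ `|q1| < 1, `|q2| < 1 &
  forall a b, kern (pt z a) (pt w b) =
    (ln (1 + z) + ln (1 - w ^+ 2) / 2 - ln 2) + (lnP q1 (a - b) + lnP q2 (a - b)) / 2].
Proof.
move=> w0 wz z1.
(* In stereographic projection the height z has radius rho_z = sqrt ((1 - z) / (1 + z)). The first
   witness is rho_z / rho_w. The antipode of the second point has radius 1 / rho_w and opposite
   longitude, whence - rho_z rho_w. Both are below 1 in modulus as 0 <= w < z. *)
exists (Num.sqrt ((1 - z) * (1 + w) / ((1 + z) * (1 - w)))).
exists (- Num.sqrt ((1 - z) * (1 - w) / ((1 + z) * (1 + w)))).
set x1 := _ / _; set x2 := _ / _.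
have p1 : 0 < (1 + z) * (1 - w) by apply: mulr_gt0; lra.
have p2 : 0 < (1 + z) * (1 + w) by apply: mulr_gt0; lra.
have x10 : 0 <= x1 by rewrite divr_ge0 ?(ltW p1)//; apply: mulr_ge0; lra.
have x20 : 0 <= x2 by rewrite divr_ge0 ?(ltW p2)//; apply: mulr_ge0; lra.
have x11 : x1 < 1 by rewrite ltr_pdivrMr//; nra.
have x21 : x2 < 1 by rewrite ltr_pdivrMr//; nra.
have q11 : `|Num.sqrt x1| < 1.
  by rewrite ger0_norm ?sqrtr_ge0// -sqrtr1 ltr_sqrt.
have q21 : `|- Num.sqrt x2| < 1.
  by rewrite normrN ger0_norm ?sqrtr_ge0// -sqrtr1 ltr_sqrt.
split => // {a b} a b; have := dotp_pt z w a b; move: (a - b) => u.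
have A1 := lnP_arg_gt0 u q11; have A2 := lnP_arg_gt0 u q21.
have e1 : (1 + z) * (1 - w) / 2 * (2 * Num.sqrt x1) = Num.sqrt (1 - z ^+ 2) * Num.sqrt (1 - w ^+ 2).
  rewrite -sqrtrM; last by nra.
  rewrite mulrA divfK// -{1}(ger0_norm (ltW p1)) -sqrtr_sqr -sqrtrM ?sqr_ge0//.
  by congr Num.sqrt; rewrite /x1; field; apply/andP; split; lra.
have e2 : (1 + z) * (1 + w) / 2 * (2 * Num.sqrt x2) = Num.sqrt (1 - z ^+ 2) * Num.sqrt (1 - w ^+ 2).
  rewrite -sqrtrM; last by nra.
  rewrite mulrA divfK// -{1}(ger0_norm (ltW p2)) -sqrtr_sqr -sqrtrM ?sqr_ge0//.
  by congr Num.sqrt; rewrite /x2; field; apply/andP; split; lra.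
have s1 : (1 + z) * (1 - w) / 2 * x1 = (1 - z) * (1 + w) / 2.
  by rewrite /x1; field; apply/andP; split; lra.
have s2 : (1 + z) * (1 + w) / 2 * x2 = (1 - z) * (1 - w) / 2.
  by rewrite /x2; field; apply/andP; split; lra.
move=> dE; rewrite /kern /lnP dE.
set A := 1 - 2 * Num.sqrt x1 * cos u + Num.sqrt x1 ^+ 2 in A1 *.
set B := 1 - 2 * - Num.sqrt x2 * cos u + (- Num.sqrt x2) ^+ 2 in A2 *.
have -> : 1 - (z * w + Num.sqrt (1 - z ^+ 2) * Num.sqrt (1 - w ^+ 2) * cos u) ^+ 2 =
   ((1 + z) ^+ 2 * (1 - w ^+ 2) / 2 ^+ 2) * (A * B).
  transitivity ((1 + z) * (1 - w) / 2 * A * ((1 + z) * (1 + w) / 2 * B)); last by field.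
  have -> : (1 + z) * (1 - w) / 2 * A = 1 - (z * w + Num.sqrt (1 - z ^+ 2) * Num.sqrt (1 - w ^+
    2) * cos u).
    by rewrite /A sqr_sqrtr// mulrDr s1 mulrBr mulr1 [X in _ - X]mulrA e1; field.
  have -> : (1 + z) * (1 + w) / 2 * B = 1 + (z * w + Num.sqrt (1 - z ^+ 2) * Num.sqrt (1 - w ^+
    2) * cos u).
    by rewrite /B sqrrN sqr_sqrtr// mulrDr s2 mulrBr mulr1 mulrN mulNr mulrN opprK [X in _ + X +
      _]mulrA e2; field.
  by ring.
have w20 : 0 < 1 - w ^+ 2 by nra.
have z20 : 0 < 1 + z by lra.
rewrite ln_sqrt; last by rewrite !mulr_gt0 ?invr_gt0 ?exprn_gt0.
rewrite lnM ?posrE ?mulr_gt0 ?invr_gt0 ?exprn_gt0//.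
rewrite lnM ?posrE ?mulr_gt0 ?invr_gt0 ?exprn_gt0//.
rewrite lnM ?posrE ?mulr_gt0 ?invr_gt0 ?exprn_gt0//.
rewrite lnV ?posrE ?exprn_gt0// !lnXn// (lnM (x := A)) ?posrE//.
by rewrite !mulr2n; field.
Qed.

Lemma has_mean_kern n (i : 'I_n) (b : n.-tuple (measurableTypeR R) -> R) (z w a : R) :
  0 <= w -> w < z -> z <= 1 ->
  measurable_fun setT b -> (forall c t, b (shift i c t) = b t) ->
  has_mean (fun t => kern (pt z (a + tnth t i)) (pt w (b t)))
    (ln (1 + z) + ln (1 - w ^+ 2) / 2 - ln 2).
Proof.
move=> w0 wz z1 mb bi.
have [q1 [q2 [q11 q21 kE]]] := kern_pt_neq 0 0 w0 wz z1.
rewrite -[X in has_mean _ X]addr0.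
rewrite (_ : (fun t => kern _ _) = (fun t => (ln (1 + z) + ln (1 - w ^+ 2) / 2 - ln 2) +
   2^-1 * (lnP q1 (tnth t i + (a - b t)) + lnP q2 (tnth t i + (a - b t))))).
  apply: has_meanD; first exact: has_mean_cst.
  rewrite -[X in has_mean _ X](mulr0 2^-1); apply: has_meanZ.
  rewrite -[X in has_mean _ X](addr0 0); have mab : measurable_fun setT (fun t => a - b t).
    by apply: measurable_funB.
  have bi' c t : a - b (shift i c t) = a - b t by rewrite bi.
  apply: has_meanD.
    exact: (@has_mean_lnP _ i (fun t => a - b t)).
  exact: (@has_mean_lnP _ i (fun t => a - b t)).
apply/funext => t; rewrite kE (mulrC 2^-1).
by rewrite (_ : a + tnth t i - b t = tnth t i + (a - b t)); last by ring.
Qed.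

(** The case of equal heights: the first factor degenerates to q = 1 and becomes 2 - 2 cos u, while
    the factor coming from the antipode keeps |q| < 1. *)
Lemma kern_parallel (z a b : R) : 0 < z < 1 -> cos (a - b) != 1 ->
  kern (pt z a) (pt z b) =
  (ln ((1 - z ^+ 2) / 2) + ln (2 - 2 * cos (a - b))
   + ln ((1 + z) ^+ 2 / 2) + lnP (- ((1 - z) / (1 + z))) (a - b)) / 2.
Proof.
move=> /andP[z0 z1] c1.
have cu : cos (a - b) < 1 by rewrite lt_neqAle c1 cos_le1.
have q1 : `|- ((1 - z) / (1 + z))| < 1.
  rewrite normrN ger0_norm; first by rewrite ltr_pdivrMr; lra.
  by apply: divr_ge0; lra.
have := lnP_arg_gt0 (a - b) q1; rewrite /kern /lnP dotp_pt.
move: (a - b) cu {c1 q1} => u cu.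
rewrite sqrrN => A0.
have z20 : 0 < 1 - z ^+ 2 by nra.
have z3 : 0 < 1 + z by lra.
have u0 : 0 < 2 - 2 * cos u by lra.
rewrite -(expr2 (Num.sqrt _)) sqr_sqrtr ?(ltW z20)//.
have -> : 1 - (z * z + (1 - z ^+ 2) * cos u) ^+ 2 =
  (1 - z ^+ 2) / 2 * (2 - 2 * cos u) * ((1 + z) ^+ 2 / 2) *
   (1 - 2 * - ((1 - z) / (1 + z)) * cos u + ((1 - z) / (1 + z)) ^+ 2).
  by field; rewrite gt_eqF.
have h1 : 0 < (1 - z ^+ 2) / 2 by rewrite divr_gt0.
have h2 : 0 < (1 + z) ^+ 2 / 2 by rewrite divr_gt0// exprn_gt0.
rewrite ln_sqrt; last by rewrite !mulr_gt0.
by rewrite !lnM ?posrE ?mulr_gt0.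
Qed.

Lemma cos_neq1 n (i l : 'I_n) : l != i ->
  cos (2 * pi * i%:R / n%:R - 2 * pi * l%:R / n%:R : R) != 1.
Proof.
wlog : i l / (i < l)%N => [H li|il _].
  have [il|il|/val_inj il] := ltngtP i l; first exact: H.
    by rewrite -cosN opprB H// eq_sym.
  by rewrite il eqxx in li.
rewrite -cosN opprB lt_eqF// cos_lt1//.
have n0 : 0 < n%:R :> R by rewrite ltr0n; apply: leq_ltn_trans (ltn_ord i).
have p0 := pi_gt0 R.
rewrite -mulrBl -mulrBr -natrB ?(ltnW il)//; apply/andP; split.
  by rewrite !mulr_gt0 ?invr_gt0// ltr0n subn_gt0.
rewrite -mulrA gtr_pMr ?mulr_gt0// ltr_pdivrMr// mul1r ltr_nat.
by apply: leq_ltn_trans (ltn_ord l); rewrite leq_subr.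
Qed.

Lemma sum_ln_chord n (i : 'I_n) :
  \sum_(l < n | l != i) ln (2 - 2 * cos (2 * pi * i%:R / n%:R - 2 * pi * l%:R / n%:R)) =
  2 * ln n%:R :> R.
Proof.
rewrite -ln_prod; last first.
  by move=> l _ /(@cos_neq1 n i) c1; have := cos_le1 (2 * pi * i%:R / n%:R - 2 * pi * l%:R /
    n%:R : R);
    rewrite le_eqVlt (negbTE c1) /=; lra.
rewrite prod_cos_neq lnXn ?mulr_natl// ltr0n; apply: leq_ltn_trans (ltn_ord i) => //.
Qed.

Lemma sum_kern_parallel (z t : R) (r : nat) (i : 'I_r) : 0 < z < 1 ->
  \sum_(l < r | l != i) kern (pt z (2 * pi * i.+1%:R / r%:R + t)) (pt z (2 * pi * l.+1%:R / r%:R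
    + t)) =
  (r.-1%:R * ln ((1 - z ^+ 2) / 2) + 2 * ln r%:R + r%:R * ln ((1 + z) ^+ 2 / 2)
   + 2 * ln (1 - (- ((1 - z) / (1 + z))) ^+ r) - ln 2) / 2.
Proof.
move=> z01; have r0 : (0 < r)%N by apply: leq_ltn_trans (ltn_ord i).
have [z0 z1] := andP z01.
pose d l : R := 2 * pi * i%:R / r%:R - 2 * pi * l%:R / r%:R.
have dE (l : 'I_r) : 2 * pi * i.+1%:R / r%:R + t - (2 * pi * l.+1%:R / r%:R + t) = d l.
  by rewrite /d -[i.+1%:R]natr1 -[l.+1%:R]natr1; field; rewrite pnatr_eq0 -lt0n.
set q := - ((1 - z) / (1 + z)).
have q1 : `|q| < 1.
  rewrite normrN ger0_norm; first by rewrite ltr_pdivrMr; lra.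
  by apply: divr_ge0; lra.
transitivity (\sum_(l < r | l != i) (((ln ((1 - z ^+ 2) / 2) + ln ((1 + z) ^+ 2 / 2)) +
    ln (2 - 2 * cos (d l)) + lnP q (d l)) / 2)).
  by apply: eq_bigr => l li; rewrite kern_parallel// dE ?cos_neq1// -/q; congr (_ / 2); ring.
rewrite -mulr_suml; congr (_ / 2).
rewrite !big_split /= !sumr_const !cardC1 !card_ord sum_ln_chord.
have : \sum_(l < r) lnP q (d l) = 2 * ln (1 - q ^+ r).
  rewrite /lnP -ln_prod; last by move=> l _ _; apply: lnP_arg_gt0.
  transitivity (ln ((1 - q ^+ r) ^+ 2)).
    congr ln; rewrite -[RHS](_ : 1 - 2 * q ^+ r * cos (r%:R * - (2 * pi * i%:R / r%:R)) + q ^+ r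
      ^+ 2 = _).
      rewrite -prod_cos//; apply: eq_bigr => l _; rewrite -[cos (d l)]cosN.
      by rewrite /d opprB [X in _ = 1 - _ * cos X + _]addrC.
    rewrite mulrN cosN mulrCA mulfV ?pnatr_eq0 -?lt0n// mulr1.
    by have := cosDM2pi i 0; rewrite add0r cos0 => ->; ring.
  rewrite lnXn ?mulr_natl// subr_gt0; apply: le_lt_trans (ler_norm _) _.
  by rewrite normrX exprn_ilt1// -lt0n.
rewrite (bigD1 i)//= {1}/d subrr /lnP cos0.
have -> : 1 - 2 * q * 1 + q ^+ 2 = 2 / ((1 + z) ^+ 2 / 2).
  by rewrite /q; field; lra.
have z3 : 0 < 1 + z by lra.
have h2 : 0 < (1 + z) ^+ 2 / 2 by rewrite divr_gt0// exprn_gt0.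
rewrite [ln (2 / _)]ln_div ?posrE// => E.
have -> : r%:R = 1 + r.-1%:R :> R by rewrite nat1r prednK.
rewrite -(mulr_natl (ln ((1 - z ^+ 2) / 2))) -(mulr_natl (ln ((1 + z) ^+ 2 / 2))).
by rewrite -E; ring.
Qed.

(** The points fill half of the equator, and sin^2 u = (1 - cos 2u) / 2: doubling the longitudes
    gives the full regular n-gon. *)
Lemma sum_kern_equator (n : nat) (i : 'I_n) :
  \sum_(l < n | l != i) kern (pt (0 : R) (pi * i%:R / n%:R)) (pt 0 (pi * l%:R / n%:R)) =
  ln n%:R - n.-1%:R * ln 2 :> R.
Proof.
transitivity (\sum_(l < n | l != i) (ln (2 - 2 * cos (2 * pi * i%:R / n%:R - 2 * pi * l%:R /
  n%:R)) / 2 - ln (2 : R))).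
  apply: eq_bigr => l li; rewrite /kern dotp_pt mul0r add0r expr0n subr0 sqrtr1 !mul1r.
  have c1 := @cos_neq1 _ _ _ li.
  have := cos_le1 (2 * pi * i%:R / n%:R - 2 * pi * l%:R / n%:R : R); rewrite le_eqVlt (negbTE
    c1) /= => c2.
  have -> : 1 - cos (pi * i%:R / n%:R - pi * l%:R / n%:R) ^+ 2 =
     (2 - 2 * cos (2 * pi * i%:R / n%:R - 2 * pi * l%:R / n%:R)) / 2 ^+ 2 :> R.
    have -> : 2 * pi * i%:R / n%:R - 2 * pi * l%:R / n%:R = (pi * i%:R / n%:R - pi * l%:R /
      n%:R) *+ 2 :> R.
      by rewrite mulr2n; ring.
    by rewrite cos_mulr2n mulr2n; field.
  rewrite ln_sqrt; last by rewrite divr_gt0//; lra.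
  rewrite ln_div ?posrE//; last by lra.
  by rewrite lnXn// mulr2n; field.
rewrite big_split /= -mulr_suml sum_ln_chord sumr_const cardC1 card_ord mulNrn.
by rewrite [2 * _]mulrC mulfK// mulr_natl.
Qed.
End pairs.

(** * Arithmetic of the construction *)

Section arithmetic.
Context {R : realType}.
Variable N : nat.
Hypothesis N121 : (121 <= N)%N.
Local Notation m := (diamond_m R N).
Local Notation g := (diamond_gamma R N).
Local Notation eta := (diamond_eta R N).
Local Notation r := (diamond_r R N).
Local Notation M := (diamond_M R N).

Lemma diamond_m_bounds : (239 * m ^ 2 + 2 <= 2 * N < 239 * m.+1 ^ 2 + 2)%N.
Proof.
have p239 : 0 < 239 :> R by rewrite (ltr0n R 239).
have x0 : 0 <= ((2 * N)%:R - 2) / 239 :> R.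
  by rewrite divr_ge0 ?(ltW p239)// subr_ge0 ler_nat; lia.
have /truncn_itv := sqrtr_ge0 (((2 * N)%:R - 2) / 239 : R).
rewrite -/m => /andP[h1 h2].
apply/andP; split.
  rewrite -(ler_nat R) natrD !natrM.
  have : m%:R ^+ 2 <= ((2 * N)%:R - 2) / 239 :> R.
    by rewrite -[leRHS]sqr_sqrtr// lerXn2r// nnegrE ?sqrtr_ge0.
  by rewrite ler_pdivlMr// natrM; lra.
rewrite -(ltr_nat R) natrD !natrM.
have : ((2 * N)%:R - 2) / 239 < m.+1%:R ^+ 2 :> R.
  by rewrite -[ltLHS](sqr_sqrtr x0) ltrXn2r ?nnegrE ?sqrtr_ge0 ?ler0n.
by rewrite ltr_pdivrMr// natrM; lra.
Qed.

Lemma diamond_m_gt0 : (0 < m)%N.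
Proof.
have /andP[_] := diamond_m_bounds; by case: m => [|k]; lia.
Qed.

Lemma diamond_N_eq : (2 * N = 239 * m ^ 2 + 2 + g * (2 * m - 1) + eta)%N.
Proof.
have /andP[h _] := diamond_m_bounds.
rewrite /diamond_gamma /diamond_eta -addnA -divn_eq; lia.
Qed.

Lemma diamond_eta_lt : (eta < 2 * m - 1)%N.
Proof. by rewrite /diamond_eta ltn_mod; have := diamond_m_gt0; lia. Qed.

(** Maximality of m gives 2 N - 239 m^2 - 2 < 239 (2 m + 1) = 239 (2 m - 1) + 478, which is at most
    717 (2 m - 1) since m >= 1. *)
Lemma diamond_gamma_le : (g <= 717)%N.
Proof.
have := diamond_N_eq; have := diamond_m_bounds; have := diamond_m_gt0.
move=> m0 mb NE; rewrite leqNgt; apply/negP => g718.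
have : (718 * (2 * m - 1) <= g * (2 * m - 1))%N by rewrite leq_mul2r g718 orbT.
move: mb NE; move: (g * _)%N => gm; rewrite -[m.+1]addn1 sqrnD; lia.
Qed.

Lemma diamond_r1 j : (j <= 2 * m)%N -> r j = (6 * j)%N.
Proof. by rewrite /diamond_r => ->. Qed.
Lemma diamond_r2 j : (2 * m <= j <= 3 * m)%N -> r j = (2 * m + 5 * j)%N.
Proof. by rewrite /diamond_r; do 2 (case: ifP => ?; try lia). Qed.
Lemma diamond_r3 j : (3 * m <= j <= 4 * m)%N -> r j = (5 * m + 4 * j)%N.
Proof. by rewrite /diamond_r; do 3 (case: ifP => ?; try lia). Qed.
Lemma diamond_r4 j : (4 * m <= j <= 5 * m)%N -> r j = (9 * m + 3 * j)%N.
Proof. by rewrite /diamond_r; do 4 (case: ifP => ?; try lia). Qed.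
Lemma diamond_r5 j : (5 * m <= j <= 6 * m)%N -> r j = (14 * m + 2 * j)%N.
Proof. by rewrite /diamond_r; do 5 (case: ifP => ?; try lia). Qed.

(** 720 covers [diamond_gamma], at most 717, and a last correction of at most 2. *)
Lemma diamond_r6 j : (6 * m < j <= 7 * m)%N ->
  (20 * m + j <= r j <= 20 * m + j + 720)%N.
Proof.
have := diamond_gamma_le; have : (`|(1 + diamond_eps R N)%R| <= 2)%N.
  by rewrite /diamond_eps; do 2 case: ifP => //.
by rewrite /diamond_r; repeat case: ifP => ?; lia.
Qed.

(** Later sections write [S] for the successor of this number, so that the heights are [1 - S / K]
    and [S = K] on the equator. *)
Definition diamond_S j : nat := (2 * \sum_(1 <= k < j) r k + r j)%N.

Lemma diamond_S_succ j : (0 < j)%N -> diamond_S j.+1 = (diamond_S j + r j + r j.+1)%N.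
Proof. by move=> j0; rewrite /diamond_S big_nat_recr//=; lia. Qed.

(** Consecutive values differ by r_j + r_(j+1) = 2 c m + e (2 j + 1), the increment of 2 c m j + e
    j^2. The offset [f] is fixed by the value at the start of the piece. *)
Lemma diamond_S_piece a b c e f : (0 < a <= b)%N ->
  (forall j, (a <= j <= b)%N -> r j = (c * m + e * j)%N) ->
  (diamond_S a + f * m ^ 2 = 2 * c * m * a + e * a ^ 2)%N ->
  forall j, (a <= j <= b)%N -> (diamond_S j + f * m ^ 2 = 2 * c * m * j + e * j ^ 2)%N.
Proof.
move=> ab rE Sa; elim=> [|j IH] jab; first by lia.
have [ja|ja] := eqVneq j.+1 a; first by rewrite ja.
rewrite diamond_S_succ; last by lia.
rewrite !rE; [|lia|lia].
have := IH ltac:(lia); rewrite !expnS !expn0 !muln1; nia.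
Qed.

Lemma diamond_S1 j : (0 < j <= 2 * m)%N -> diamond_S j = (6 * j ^ 2)%N.
Proof.
have m0 := diamond_m_gt0; move=> jm.
suff : (diamond_S j + 0 * m ^ 2 = 2 * 0 * m * j + 6 * j ^ 2)%N by lia.
apply: (@diamond_S_piece 1 (2 * m)) jm; first by lia.
  by move=> k km; rewrite diamond_r1//; lia.
by rewrite /diamond_S big_geq// diamond_r1//; lia.
Qed.
Lemma diamond_S2 j : (2 * m <= j <= 3 * m)%N -> (diamond_S j + 4 * m ^ 2 = 4 * m * j + 5 * j ^ 2)%N.
Proof.
have m0 := diamond_m_gt0.
move=> jm; apply: (@diamond_S_piece (2 * m) (3 * m) 2 5 4); rewrite ?diamond_S1//; try lia.
exact: diamond_r2.
Qed.
Lemma diamond_S3 j : (3 * m <= j <= 4 * m)%N -> (diamond_S j + 13 * m ^ 2 = 10 * m * j + 4 * j ^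
  2)%N.
Proof.
have m0 := diamond_m_gt0; have := @diamond_S2 (3 * m).
move=> S jm; apply: (@diamond_S_piece (3 * m) (4 * m) 5 4 13); try lia.
exact: diamond_r3.
Qed.
Lemma diamond_S4 j : (4 * m <= j <= 5 * m)%N -> (diamond_S j + 29 * m ^ 2 = 18 * m * j + 3 * j ^
  2)%N.
Proof.
have m0 := diamond_m_gt0; have := @diamond_S3 (4 * m).
move=> S jm; apply: (@diamond_S_piece (4 * m) (5 * m) 9 3 29); try lia.
exact: diamond_r4.
Qed.
Lemma diamond_S5 j : (5 * m <= j <= 6 * m)%N -> (diamond_S j + 54 * m ^ 2 = 28 * m * j + 2 * j ^
  2)%N.
Proof.
have m0 := diamond_m_gt0; have := @diamond_S4 (5 * m).
move=> S jm; apply: (@diamond_S_piece (5 * m) (6 * m) 14 2 54); try lia.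
exact: diamond_r5.
Qed.

Lemma diamond_d_ge : (6 * m <= diamond_d R N <= 7 * m - 1)%N.
Proof.
have := diamond_eta_lt; have := diamond_m_gt0.
by rewrite /diamond_d; repeat (case: ifP => ?; try lia).
Qed.

Lemma diamond_r6E j : (6 * m < j <= 7 * m - 1)%N ->
  r j = (20 * m + j + g + (diamond_d R N < j))%N.
Proof. by have := diamond_d_ge; rewrite /diamond_r; repeat (case: ifP => ?; try lia). Qed.

(** The truncated difference [j - diamond_d R N] counts the parallels that carry one extra point,
    and is 0 before the first of them. *)
Lemma diamond_sum6 j : (6 * m <= j <= 7 * m - 1)%N ->
  (2 * \sum_(1 <= k < j.+1) r k + 90 * m ^ 2 =
   40 * m * j + j ^ 2 + 20 * m + j + 2 * g * (j - 6 * m) + 2 * (j - diamond_d R N))%N.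
Proof.
have m0 := diamond_m_gt0; have d0 := diamond_d_ge.
elim: j => [|j IH] jm; first by lia.
rewrite big_nat_recr//=.
have [jE|jE] := eqVneq j.+1 (6 * m)%N.
  have := @diamond_S5 (6 * m); rewrite /diamond_S jE (@diamond_r5 (6 * m)); lia.
have jm' : (6 * m <= j <= 7 * m - 1)%N by lia.
have := IH jm'; rewrite diamond_r6E; last by lia.
move: (\sum_(_ <= _ < _) _)%N => s sE.
have [i jE'] : exists i, j = (6 * m + i)%N by exists (j - 6 * m)%N; lia.
subst j; rewrite (_ : (6 * m + i).+1 - 6 * m = i.+1)%N; last by lia.
rewrite (_ : (6 * m + i) - 6 * m = i)%N in sE; last by lia.
case: (ltnP (diamond_d R N) (6 * m + i).+1) => dj; lia.
Qed.

(** The construction places exactly the missing points. The number gamma is added to m - 1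
    parallels, which count twice, and to the equator, which counts once: gamma (2 m - 1) in all. The
    parallels beyond d and the correction on the equator add 2 (7 m - 1 - d) + 1 + eps, which is eta
    in each of the three cases. *)
Lemma diamond_S_last : (diamond_S M + 2 = 2 * N)%N.
Proof.
have m0 := diamond_m_gt0; have d0 := diamond_d_ge.
have := @diamond_sum6 (7 * m - 1) ltac:(lia).
rewrite /diamond_S /diamond_M (_ : (7 * m - 1).+1 = (7 * m)%N); last by lia.
have rM : r (7 * m) = (27 * m + g + `|(1 + diamond_eps R N)%R|)%N.
  by rewrite /diamond_r; repeat (case: ifP => ?; try lia).
have := diamond_N_eq; have := diamond_eta_lt; rewrite rM.
move: (\sum_(_ <= _ < _) _)%N => s.
rewrite /diamond_d /diamond_eps.
have [u mE] : exists u, m = u.+1 by exists m.-1; lia.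
rewrite mE (_ : 7 * u.+1 - 1 = 7 * u + 6)%N; last by lia.
rewrite (_ : 2 * u.+1 - 1 = 2 * u + 1)%N; last by lia.
rewrite (_ : 7 * u + 6 - 6 * u.+1 = u)%N; last by lia.
case: ifP => [/eqP e0|e0]; last case: ifP => eodd; first by lia.
- have := odd_double_half eta; rewrite eodd -divn2; lia.
- have := odd_double_half eta; rewrite eodd -divn2; lia.
Qed.

Lemma diamond_r_ge j : (j <= M)%N -> (3 * j <= r j)%N.
Proof.
have := diamond_m_gt0; rewrite /diamond_M => m0 jM.
have [h|h] := leqP j (2 * m); first by rewrite diamond_r1//; lia.
have [h3|h3] := leqP j (3 * m); first by rewrite diamond_r2; lia.
have [h4|h4] := leqP j (4 * m); first by rewrite diamond_r3; lia.
have [h5|h5] := leqP j (5 * m); first by rewrite diamond_r4; lia.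
have [h6|h6] := leqP j (6 * m); first by rewrite diamond_r5; lia.
by have := @diamond_r6 j; lia.
Qed.

Lemma diamond_r_le j : (j <= M)%N -> (r j <= 6 * j + 720)%N.
Proof.
have := diamond_m_gt0; rewrite /diamond_M => m0 jM.
have [h|h] := leqP j (2 * m); first by rewrite diamond_r1//; lia.
have [h3|h3] := leqP j (3 * m); first by rewrite diamond_r2; lia.
have [h4|h4] := leqP j (4 * m); first by rewrite diamond_r3; lia.
have [h5|h5] := leqP j (5 * m); first by rewrite diamond_r4; lia.
have [h6|h6] := leqP j (6 * m); first by rewrite diamond_r5; lia.
by have := @diamond_r6 j; lia.
Qed.

Lemma diamond_r_le_m j : (j <= M)%N -> (r j <= 27 * m + 720)%N.
Proof.
have := diamond_m_gt0; rewrite /diamond_M => m0 jM.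
have [h|h] := leqP j (2 * m); first by rewrite diamond_r1//; lia.
have [h3|h3] := leqP j (3 * m); first by rewrite diamond_r2; lia.
have [h4|h4] := leqP j (4 * m); first by rewrite diamond_r3; lia.
have [h5|h5] := leqP j (5 * m); first by rewrite diamond_r4; lia.
have [h6|h6] := leqP j (6 * m); first by rewrite diamond_r5; lia.
by have := @diamond_r6 j; lia.
Qed.

Lemma diamond_S6 j : (6 * m <= j <= 7 * m)%N ->
  (40 * m * j + j ^ 2 <= diamond_S j + 90 * m ^ 2 <=
   40 * m * j + j ^ 2 + 1440 * (j - 6 * m))%N.
Proof.
have m0 := diamond_m_gt0.
elim: j => [|j IH] jm; first by lia.
have [jE|jE] := eqVneq j.+1 (6 * m)%N.
  by have := @diamond_S5 (6 * m); rewrite jE; lia.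
rewrite diamond_S_succ; last by lia.
have := IH ltac:(lia); have h2 := @diamond_r6 j.+1 ltac:(lia).
have [jE'|jE'] := eqVneq j (6 * m)%N.
  subst j; rewrite (@diamond_r5 (6 * m)); last by lia.
  by rewrite (_ : (6 * m).+1 - 6 * m = 1)%N; lia.
have h1 := @diamond_r6 j ltac:(lia).
rewrite (_ : j.+1 - 6 * m = (j - 6 * m) + 1)%N; lia.
Qed.

Lemma diamond_S_ge j : (0 < j <= M)%N -> (3 * j ^ 2 <= diamond_S j)%N.
Proof.
elim: j => [//|j IH] jM; have rj := @diamond_r_ge j.+1 ltac:(lia).
case: (posnP j) => [j0|j0].
  by rewrite /diamond_S j0 in rj *; rewrite big_geq//; lia.
rewrite diamond_S_succ//; have := IH ltac:(lia); have := @diamond_r_ge j ltac:(lia).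
lia.
Qed.

(** From r_j >= 3 j one gets S_M - S_j >= 3 (M^2 - j^2) >= 3 M (M - j). Since K z_j = S_M - S_j,
    this bounds the heights from below by the distance to the equator. *)
Lemma diamond_S_gap j : (0 < j <= M)%N ->
  (3 * M * (M - j) <= 2 * (2 * N - 2 - diamond_S j))%N.
Proof.
have := diamond_S_last => SM jM.
suff H k : (j + k <= M)%N -> (diamond_S j + 3 * (j + k) ^ 2 <= diamond_S (j + k) + 3 * j ^ 2)%N.
  have [k kE] : exists k, M = (j + k)%N by exists (M - j)%N; lia.
  have := H k ltac:(lia); rewrite -kE => Hk.
  rewrite (_ : M - j = k)%N; last by lia.
  move: Hk; rewrite [in (3 * M ^ 2)%N]kE [in (3 * M * k)%N]kE; lia.
elim: k => [|k IH] jk; first by rewrite addn0; lia.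
rewrite addnS diamond_S_succ; last by lia.
have := IH ltac:(lia); have := @diamond_r_ge (j + k) ltac:(lia).
have := @diamond_r_ge (j + k).+1 ltac:(lia); lia.
Qed.

End arithmetic.

(** * The exact expected energy *)

Section energy.
Context {R : realType}.
Implicit Types (s t : seq 'rV[R]_3).

Definition cross s t : R := \sum_(x <- s) \sum_(y <- t) kern x y.

Lemma log_energyE s : log_energy s =
  - \sum_(i < size s) \sum_(j < size s | j != i) kern s`_i s`_j.
Proof. by []. Qed.

Lemma log_energy_cons x s : log_energy (x :: s) = log_energy s - 2 * \sum_(y <- s) kern x y.
Proof.
rewrite !log_energyE /= big_ord_recl /=.
have -> : \sum_(y <- s) kern x y = \sum_(i < size s) kern x s`_i.
  by rewrite (big_nth 0) big_mkord.
have eP (F : 'I_(size s).+1 -> R) (i : 'I_(size s)) :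
   \sum_(j < (size s).+1 | j != lift ord0 i) F j =
   F ord0 + \sum_(j < size s | j != i) F (lift ord0 j).
  by rewrite big_mkcond big_ord_recl /= -big_mkcond.
have -> : \sum_(j < (size s).+1 | j != ord0) kern x (x :: s)`_j = \sum_(i < size s) kern x s`_i.
  by rewrite big_mkcond big_ord_recl /= add0r; apply: eq_bigr.
have -> : \sum_(i < size s) \sum_(j < (size s).+1 | j != lift ord0 i) kern s`_(0 + i) (x :: s)`_j =
   \sum_(i < size s) (kern x s`_i + \sum_(j < size s | j != i) kern s`_i s`_j).
  by apply: eq_bigr => i _; rewrite eP /= kern_sym.
by rewrite big_split /=; ring.
Qed.

Lemma log_energy_nil : log_energy ([::] : seq 'rV[R]_3) = 0.
Proof. by rewrite log_energyE big_ord0 oppr0. Qed.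

Lemma log_energy_cat s t : log_energy (s ++ t) = log_energy s + log_energy t - 2 * cross s t.
Proof.
rewrite /cross; elim: s => [|x s IH] /=; first by rewrite log_energy_nil big_nil; ring.
by rewrite !log_energy_cons IH big_cat big_cons /=; ring.
Qed.

Lemma log_energy_flatten (B : nat -> seq 'rV[R]_3) n :
  log_energy (flatten [seq B j | j <- iota 0 n]) =
  \sum_(0 <= j < n) log_energy (B j) - 2 * \sum_(0 <= k < n) \sum_(0 <= j < k) cross (B j) (B k).
Proof.
elim: n => [|n IH]; first by rewrite /= log_energy_nil !big_geq//; ring.
rewrite -[n.+1]addn1 iotaD map_cat flatten_cat log_energy_cat IH add0n addn1 /= cats0.
rewrite !big_nat_recr//=.
suff -> : cross (flatten [seq B j | j <- iota 0 n]) (B n) = \sum_(0 <= j < n) cross (B j) (B n)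
  by ring.
rewrite /cross big_flatten big_map; congr bigop.body.
by rewrite /index_iota subn0.
Qed.

Section blocks.
Variable N : nat.
Hypothesis N121 : (121 <= N)%N.
Local Notation r := (diamond_r R N).
Local Notation M := (diamond_M R N).

(** Pole, parallels and equator become blocks 0 to M of a single family. The height 1 is imposed on
    block 0, where [diamond_z] would give 1 - 1 / (2 N - 1). *)
Definition block_z j : R := if j == 0%N then 1 else diamond_z R N j.
Definition block_n j : nat :=
  if j == 0%N then 1%N else if j == M then (r j %/ 2)%N else r j.
Definition block_angle (th : seq R) j i : R :=
  if j == 0%N then 0 else if j == M then 2 * pi * i%:R / (r j)%:R
  else 2 * pi * i.+1%:R / (r j)%:R + th`_j.-1.
Definition block (th : seq R) j := [seq pt (block_z j) (block_angle th j i) | i <- iota 0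
  (block_n j)].

Lemma diamond_M_ge7 : (7 <= M)%N.
Proof. by have := @diamond_m_gt0 R N N121; rewrite /diamond_M; lia. Qed.

Lemma diamond_zE j : diamond_z R N j = 1 - (@diamond_S R N j).+1%:R / (2 * N%:R - 1).
Proof.
rewrite /diamond_z /diamond_S; congr (1 - _ / _).
by rewrite -[RHS]natr1 natrD natrM natr_sum; ring.
Qed.

Lemma twoN1_gt0 : 0 < 2 * N%:R - 1 :> R.
Proof.
have : 1 <= N%:R :> R by rewrite (ler_nat R 1); lia.
lra.
Qed.

Lemma twoN1E : 2 * N%:R - 1 = (@diamond_S R N M).+1%:R :> R.
Proof.
have /(congr1 (fun n => n%:R : R)) := @diamond_S_last R N N121.
by rewrite natrD natrM -[X in _ -> _ = X]natr1; lra.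
Qed.

Lemma diamond_z_last : diamond_z R N M = 0.
Proof. by rewrite diamond_zE twoN1E divff ?subrr// pnatr_eq0. Qed.

Lemma diamond_S_lt j k : (0 < j)%N -> (j < k <= M)%N -> (@diamond_S R N j < @diamond_S R N k)%N.
Proof.
move=> j0; elim: k => [//|k IH] jk; rewrite (diamond_S_succ N121); last by lia.
have := @diamond_r_ge R N N121 k.+1 ltac:(lia).
have [->|kj] := eqVneq k j; first by lia.
by have := IH ltac:(lia); lia.
Qed.

Lemma block_z_lt j k : (j < k <= M)%N -> block_z k < block_z j.
Proof.
rewrite /block_z; case: j => [|j]; case: k => [|k]//= jk; rewrite !diamond_zE.
  by rewrite ltrBlDr ltrDl divr_gt0 ?twoN1_gt0 ?ltr0n.
rewrite ltrD2l ltrN2 ltr_pM2r ?invr_gt0 ?twoN1_gt0// ltr_nat ltnS.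
exact: diamond_S_lt.
Qed.

Lemma block_z_ge0 j : (j <= M)%N -> 0 <= block_z j.
Proof.
rewrite leq_eqVlt => /predU1P[->|jM]; last first.
  have M7 := diamond_M_ge7.
  apply: le_trans (ltW (@block_z_lt j M _)); last by rewrite jM leqnn.
  by rewrite /block_z diamond_z_last; case: eqP.
by rewrite /block_z diamond_z_last; case: eqP.
Qed.

Lemma block_z_le1 j : (j <= M)%N -> block_z j <= 1.
Proof.
case: j => [|j] jM; first by rewrite /block_z.
by apply: le_trans (ltW (@block_z_lt 0 j.+1 _)) _; rewrite ?jM// /block_z.
Qed.

Lemma pt1 a : pt (1 : R) a = vec3 0 0 1.
Proof. by rewrite /pt expr1n subrr sqrtr0 !mul0r. Qed.

Lemma diamond_blocks (th : M.-1.-tuple R) :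
  diamond th = flatten [seq block th j | j <- iota 0 M.+1].
Proof.
have M7 := diamond_M_ge7.
have -> : iota 0 M.+1 = 0%N :: iota 1 M.-1 ++ [:: M].
  have M1 : (0 < M)%N by lia.
  by rewrite /= -{1}(prednK M1) -[X in iota 1 X]addn1 iotaD /= add1n (prednK M1).
rewrite /= {1}/block /= pt1; congr (_ :: _).
rewrite map_cat flatten_cat; congr (_ ++ _).
  congr flatten; apply/eq_in_map => j; rewrite mem_iota => jM.
  rewrite /block /diamond_parallel /block_n /block_z /block_angle.
  have -> : (j == 0%N) = false by lia.
  have -> : (j == M) = false by lia.
  by rewrite (iotaDl 1 0) -map_comp; apply: eq_map => i /=.
rewrite /= cats0 /block /diamond_equator /block_n /block_z /block_angle eqxx.
have -> : (M == 0%N) = false by lia.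
rewrite diamond_z_last; apply: eq_map => k.
by rewrite /pt expr0n subr0 sqrtr1 !mul1r.
Qed.

Lemma log_energy_mkseq (f : nat -> 'rV[R]_3) n :
  log_energy (mkseq f n) = - \sum_(i < n) \sum_(j < n | j != i) kern (f i) (f j).
Proof.
rewrite log_energyE size_mkseq; congr (- _); apply: eq_bigr => i _.
by apply: eq_bigr => j _; rewrite !nth_mkseq.
Qed.

Definition block_energy j : R :=
  if j == 0%N then 0 else
  let n : R := (block_n j)%:R in
  if j == M then - (n * (ln n - (n - 1) * ln 2)) else
  let z := diamond_z R N j in
  - (n * (((n - 1) * ln ((1 - z ^+ 2) / 2) + 2 * ln n + n * ln ((1 + z) ^+ 2 / 2)
   + 2 * ln (1 - (- ((1 - z) / (1 + z))) ^+ r j) - ln 2) / 2)).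

Lemma odd_diamond_r_last : odd (r M) = false.
Proof.
have := @diamond_S_last R N N121; rewrite /diamond_S.
move: (\sum_(_ <= _ < _) _)%N => s E.
by rewrite (_ : r M = (N - 1 - s).*2) ?odd_double//; lia.
Qed.

Lemma block_n_gt0 j : (j <= M)%N -> (0 < block_n j)%N.
Proof.
move=> jM; have M7 := diamond_M_ge7.
have := @diamond_r_ge R N N121 j jM; rewrite /block_n.
by case: eqP => // j0; case: eqP => [jE|] rj; rewrite ?divn_gt0; lia.
Qed.

Lemma log_energy_block (th : seq R) j : (j <= M)%N ->
  log_energy (block th j) = block_energy j.
Proof.
move=> jM; rewrite -/(mkseq _ _) log_energy_mkseq /block_energy.
have n0 := block_n_gt0 jM.
have nE : (block_n j)%:R - 1 = (block_n j).-1%:R :> R by rewrite -subn1 natrB.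
case: ifP => [/eqP j0|j0].
  by rewrite /block_n j0 /= big_ord1 big_pred0 ?oppr0// => i; rewrite ord1 eqxx.
case: ifP => [/eqP jE|jnM]; congr (- _).
  rewrite nE /block_z j0 jE diamond_z_last.
  transitivity (\sum_(i < block_n M) (ln (block_n M)%:R - (block_n M).-1%:R * ln 2 : R)).
    apply: eq_bigr => i _; rewrite -(sum_kern_equator i).
    have aE (k : nat) : block_angle th M k = pi * k%:R / (block_n M)%:R.
      rewrite /block_angle /block_n eqxx -jE j0 jE.
      have r0 : (r M)%:R != 0 :> R.
        by rewrite pnatr_eq0; have := @diamond_r_ge R N N121 M (leqnn _); have := diamond_M_ge7;
          lia.
      have -> : (r M)%:R = 2 * (r M %/ 2)%:R :> R.
        by rewrite -natrM; congr (_%:R); rewrite -{1}[r M]odd_double_half odd_diamond_r_last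
          add0n -mul2n -divn2.
      field; rewrite pnatr_eq0 -lt0n; move: n0; by rewrite /block_n -{1}jE j0 jE eqxx.
    by apply: eq_bigr => l _; rewrite !aE.
  by rewrite sumr_const card_ord [RHS]mulr_natl.
rewrite nE.
transitivity (\sum_(i < block_n j) (((block_n j).-1%:R * ln ((1 - diamond_z R N j ^+ 2) / 2) + 2
  * ln (block_n j)%:R + (block_n j)%:R * ln ((1 + diamond_z R N j) ^+ 2 / 2)
   + 2 * ln (1 - (- ((1 - diamond_z R N j) / (1 + diamond_z R N j))) ^+ r j) - ln 2) / 2)); last
     first.
  by rewrite sumr_const card_ord [RHS]mulr_natl.
have rE : block_n j = r j by rewrite /block_n j0 jnM.
rewrite rE; apply: eq_bigr => i _; rewrite -(@sum_kern_parallel _ _ th`_j.-1 _ i).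
  by apply: eq_bigr => l _; rewrite /block_z /block_angle j0 jnM.
have zj : diamond_z R N j = block_z j by rewrite /block_z j0.
apply/andP; split.
  rewrite -diamond_z_last zj (_ : diamond_z R N M = block_z M) ?block_z_lt//.
    by rewrite leqnn andbT ltn_neqAle jnM jM.
  by rewrite /block_z; case: eqP => // M0; have := diamond_M_ge7; lia.
have -> : 1 = block_z 0 :> R by rewrite /block_z.
by rewrite zj block_z_lt// jM lt0n j0.
Qed.

(** Only the phase of the upper block j is averaged: block k does not depend on it, whether it
    carries its own phase or is the equator, which has none. *)
Lemma has_mean_cross j k : (j < k <= M)%N ->
  has_mean (fun th : M.-1.-tuple R => cross (block th j) (block th k))
   ((block_n j)%:R * (block_n k)%:R *
     (ln (1 + block_z j) + ln (1 - block_z k ^+ 2) / 2 - ln 2)).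
Proof.
move=> jk; set v := ln _ + _ - _.
rewrite (_ : _ * _ * v = \sum_(i <- iota 0 (block_n j)) \sum_(l <- iota 0 (block_n k)) v); last
  first.
  by rewrite !big_const_seq !count_predT !size_iota !iter_addr_0 -[RHS]mulr_natl -(mulr_natl v)
    mulrA.
rewrite (_ : (fun _ => _) = (fun th : M.-1.-tuple R =>
    \sum_(i <- iota 0 (block_n j)) \sum_(l <- iota 0 (block_n k))
      kern (pt (block_z j) (block_angle th j i)) (pt (block_z k) (block_angle th k l)))); last
        first.
  by apply/funext => th; rewrite /cross big_map; apply: eq_bigr => i _; rewrite big_map.
apply: has_mean_sum => i _; apply: has_mean_sum => l _.
have w0 : 0 <= block_z k by apply: block_z_ge0; lia.
have wz : block_z k < block_z j by apply: block_z_lt.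
have z1 : block_z j <= 1 by apply: block_z_le1; lia.
(* The pole has no phase, but its distance to the axis is 0, so [kern] is constant and equal to the
   announced mean. *)
have [j0|j0] := eqVneq j 0%N.
  rewrite (_ : (fun _ => _) = (fun=> v)); first exact: has_mean_cst.
  apply/funext => th; rewrite /kern dotp_pt /v j0.
  have -> : block_z 0 = 1 :> R by [].
  have w1 : block_z k < 1 by apply: lt_le_trans wz z1.
  have -> : Num.sqrt (1 - 1 ^+ 2) = 0 :> R by rewrite expr1n subrr sqrtr0.
  rewrite !mul0r addr0 mul1r ln_sqrt; last by rewrite subr_gt0 expr_lt1.
  by rewrite (_ : 1 + 1 = 2 :> R)// [X in _ = X - _]addrC addrK.
have jM : (j.-1 < M.-1)%N by lia.
rewrite (_ : (fun _ => _) = (fun th : M.-1.-tuple R =>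
   kern (pt (block_z j) (2 * pi * i.+1%:R / (r j)%:R + tnth th (Ordinal jM))) (pt (block_z k)
     (block_angle th k l)))); last first.
  apply/funext => th; rewrite /block_angle (negbTE j0).
  have -> : (j == M) = false by lia.
  by rewrite (tnth_nth 0).
apply: (@has_mean_kern _ _ (Ordinal jM) (fun th => block_angle th k l)) => //.
  rewrite /block_angle; have -> : (k == 0%N) = false by lia.
  have [kM|kM] := eqVneq k M; first exact: measurable_cst.
  apply: measurable_funD; first exact: measurable_cst.
  have kM' : (k.-1 < M.-1)%N by lia.
  rewrite (_ : (fun _ => _) = (fun th : M.-1.-tuple (measurableTypeR R) => tnth th (Ordinal kM'))).
    exact: measurable_tnth.
  by apply/funext => th; rewrite (tnth_nth 0).
move=> c th; rewrite /block_angle; case: ifP => // k0; case: ifP => // kM.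
have kM' : (k.-1 < M.-1)%N by lia.
congr (_ + _); have := tnth_shift (Ordinal jM) c th (Ordinal kM').
rewrite !(tnth_nth 0) /= => ->.
rewrite -val_eqE /=; have -> : (k.-1 == j.-1) = false by lia.
by rewrite addr0.
Qed.

Lemma has_mean_diamond :
  has_mean (fun th : M.-1.-tuple R => log_energy (diamond th))
   (\sum_(0 <= j < M.+1) block_energy j - 2 * \sum_(0 <= k < M.+1) \sum_(0 <= j < k)
     ((block_n j)%:R * (block_n k)%:R *
     (ln (1 + block_z j) + ln (1 - block_z k ^+ 2) / 2 - ln 2))).
Proof.
rewrite (_ : (fun _ => _) = (fun th : M.-1.-tuple R => \sum_(0 <= j < M.+1) block_energy j -
   2 * \sum_(0 <= k < M.+1) \sum_(0 <= j < k) cross (block th j) (block th k))); last first.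
  apply/funext => th; rewrite diamond_blocks log_energy_flatten; congr (_ - _).
  by apply: eq_big_nat => j jM; rewrite log_energy_block.
apply: has_meanD; first exact: has_mean_cst.
apply: has_meanN; apply: has_meanZ; apply: has_mean_sum => k; rewrite mem_index_iota => kM.
apply: has_mean_sum => j; rewrite mem_index_iota => jk.
by apply: has_mean_cross; lia.
Qed.
End blocks.
End energy.

(** The mean interaction of two blocks splits into a function of the upper one plus a function of
    the lower one, so each block meets the total mass below it with weight [l] and the total mass
    above it with weight [d]. *)
Lemma sum_triangle (R : comRingType) (a l d : nat -> R) n :
  \sum_(0 <= k < n) \sum_(0 <= j < k) a j * a k * (l j + d k) =
  \sum_(0 <= j < n) a j * (l j * (\sum_(0 <= i < n) a i - \sum_(0 <= i < j.+1) a i)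
                           + d j * \sum_(0 <= i < j) a i).
Proof.
elim: n => [|n IH]; first by rewrite !big_geq.
rewrite big_nat_recr// [RHS]big_nat_recr//= IH subrr mulr0 add0r.
transitivity (\sum_(0 <= j < n) a j * (l j * (\sum_(0 <= i < n) a i - \sum_(0 <= i < j.+1) a i)
   + d j * \sum_(0 <= i < j) a i) + a n * \sum_(0 <= j < n) a j * l j +
   a n * (d n * \sum_(0 <= i < n) a i)).
  rewrite -addrA; congr (_ + _); rewrite !mulr_sumr -big_split /=.
  by apply: eq_bigr => j _; ring.
congr (_ + _); rewrite mulr_sumr -big_split /=; apply: eq_bigr => j _.
by rewrite [X in _ = a j * (l j * (X - _) + _)]big_nat_recr//=; ring.
Qed.

(** * Closed form of the expected energy *)

Section closed_form.
Context {R : realType}.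
Variable N : nat.
Hypothesis N121 : (121 <= N)%N.
Local Notation r := (diamond_r R N).
Local Notation M := (diamond_M R N).
Local Notation K := (2 * N%:R - 1 : R).
Local Notation S j := ((@diamond_S R N j).+1%:R : R).

Definition diamond_V : R := \sum_(1 <= j < M) (r j)%:R *
  ln (1 - (- ((1 - diamond_z R N j) / (1 + diamond_z R N j))) ^+ r j).
Definition diamond_T : R := \sum_(1 <= j < M) (r j)%:R * ln (r j)%:R
  + (r M)%:R * ln (r M)%:R / 2.
(** The quotients S_j / K and (2 K - S_j) / K are 1 - z_j and 1 + z_j; S_j and 2 K - S_j are mirror
    images in K, the value at the equator. *)
Definition diamond_Q : R := \sum_(1 <= j < M) (r j)%:R / 2 *
  (S j * ln (S j / K) + (2 * K - S j) * ln ((2 * K - S j) / K)).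
Definition diamond_mean : R := (N%:R - 1) ^+ 2 * ln 2 - diamond_Q - diamond_T - diamond_V.

Lemma S_gt0 j : 0 < S j.
Proof. by rewrite ltr0n. Qed.

Lemma S_lt_K j : (0 < j < M)%N -> S j < K.
Proof.
move=> /andP[j0 jM]; rewrite twoN1E// ltr_nat ltnS.
by apply: diamond_S_lt => //; rewrite jM leqnn.
Qed.

Lemma block_n_mid j : (0 < j < M)%N -> block_n (R := R) N j = r j.
Proof.
move=> jM; rewrite /block_n; have -> : (j == 0%N) = false by lia.
by have -> : (j == M) = false by lia.
Qed.

Lemma sum_block_n j : (0 < j <= M)%N ->
  \sum_(0 <= i < j) (block_n (R := R) N i)%:R = 1 + \sum_(1 <= i < j) (r i)%:R :> R.
Proof.
move=> jM; rewrite big_ltn; last by lia.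
rewrite {1}/block_n /=; congr (_ + _); apply: eq_big_nat => i ij.
by rewrite block_n_mid//; lia.
Qed.

Lemma SE j : S j = 1 + 2 * \sum_(1 <= i < j) (r i)%:R + (r j)%:R.
Proof. by rewrite -natr1 /diamond_S natrD natrM natr_sum; ring. Qed.

Lemma half_r_last : (block_n (R := R) N M)%:R = (r M)%:R / 2 :> R.
Proof.
have M7 := @diamond_M_ge7 R N N121.
rewrite /block_n eqxx; have -> : (M == 0%N) = false by lia.
rewrite -{2}[r M]odd_double_half odd_diamond_r_last// add0n -mul2n natrM -divn2.
by rewrite [2 * _]mulrC mulfK.
Qed.

Lemma sum_block_n_all : \sum_(0 <= i < M.+1) (block_n (R := R) N i)%:R = N%:R :> R.
Proof.
have M7 := @diamond_M_ge7 R N N121.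
rewrite big_nat_recr//= sum_block_n; last by lia.
rewrite half_r_last; have := @twoN1E R N N121; rewrite SE.
by move: (bigop.body _ _ _) => s; lra.
Qed.

(** As S_j = 1 + 2 (r_1 + ... + r_(j-1)) + r_j, the product r_j S_j is a quarter of the increment of
    the square of 1 + 2 (r_1 + ... + r_j). *)
Lemma sum_S_telescope n : (0 < n)%N ->
  \sum_(1 <= j < n) (r j)%:R * (K - S j) =
  K * \sum_(1 <= j < n) (r j)%:R - ((1 + 2 * \sum_(1 <= j < n) (r j)%:R) ^+ 2 - 1) / 4.
Proof.
elim: n => [//|[|n] IH] _; first by rewrite !big_geq//; field.
by rewrite !(@big_nat_recr _ _ _ n.+1 1)//= IH// SE; field.
Qed.

(** The energy inside parallel j completes the coefficients left by the other blocks: ln (1 - z_j)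
    receives exactly - r_j S_j / 2 and ln (1 + z_j) exactly - r_j (2 K - S_j) / 2. The terms in ln 2
    are then summed by [sum_S_telescope]. *)
Lemma diamond_meanE :
  \sum_(0 <= j < M.+1) @block_energy R N j - 2 * \sum_(0 <= k < M.+1) \sum_(0 <= j < k)
     ((block_n (R := R) N j)%:R * (block_n (R := R) N k)%:R *
     (ln (1 + @block_z R N j) + ln (1 - @block_z R N k ^+ 2) / 2 - ln 2)) = diamond_mean.
Proof.
have M7 := @diamond_M_ge7 R N N121.
have -> : \sum_(0 <= k < M.+1) \sum_(0 <= j < k)
     ((block_n (R := R) N j)%:R * (block_n (R := R) N k)%:R *
     (ln (1 + @block_z R N j) + ln (1 - @block_z R N k ^+ 2) / 2 - ln 2)) =
   \sum_(0 <= k < M.+1) \sum_(0 <= j < k)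
     ((block_n (R := R) N j)%:R * (block_n (R := R) N k)%:R *
     ((ln (1 + @block_z R N j) - ln 2) + ln (1 - @block_z R N k ^+ 2) / 2)).
  by apply: eq_bigr => k _; apply: eq_bigr => j _; rewrite (addrAC (ln _)).
rewrite (sum_triangle (fun j => (block_n (R := R) N j)%:R) (fun j => ln (1 + @block_z R N j) - ln 2)
   (fun k => ln (1 - @block_z R N k ^+ 2) / 2)).
rewrite mulr_sumr -sumrB sum_block_n_all big_nat_recr//= big_ltn; last by lia.
rewrite {1}/block_energy /= {1}/block_z /= (_ : 1 + 1 = 2)// subrr mul0r add0r big_geq//.
rewrite !mulr0 addr0 !mulr0 oppr0 add0r sum_block_n_all subrr mulr0 add0r.
have -> : @block_z R N M = 0 by rewrite /block_z diamond_z_last//; case: eqP => //; lia.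
rewrite expr0n subr0 ln1 mul0r mul0r !mulr0 subr0.
have -> : @block_energy R N M = (r M)%:R ^+ 2 / 4 * ln 2 - (r M)%:R * ln (r M)%:R / 2.
  rewrite /block_energy eqxx; have -> : (M == 0%N) = false by lia.
  have r0 : 0 < (r M)%:R :> R by rewrite ltr0n; have := @diamond_r_ge R N N121 M (leqnn _); lia.
  by rewrite half_r_last ln_div ?posrE//; field.
have Kp := @twoN1_gt0 R N N121.
have -> : \sum_(1 <= j < M) (@block_energy R N j - 2 * ((block_n (R := R) N j)%:R *
   ((ln (1 + @block_z R N j) - ln 2) * (N%:R - \sum_(0 <= i < j.+1) (block_n (R := R) N i)%:R) +
     ln (1 - @block_z R N j ^+ 2) / 2 * \sum_(0 <= i < j) (block_n (R := R) N i)%:R))) =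
  \sum_(1 <= j < M) (ln 2 * ((r j)%:R * (K - S j)) - (r j)%:R / 2 *
  (S j * ln (S j / K) + (2 * K - S j) * ln ((2 * K - S j) / K)) - (r j)%:R * ln (r j)%:R -
   (r j)%:R * ln (1 - (- ((1 - diamond_z R N j) / (1 + diamond_z R N j))) ^+ r j)).
  apply: eq_big_nat => j jM; rewrite !sum_block_n; [|lia|lia].
  rewrite big_nat_recr/=; last by lia.
  have := S_lt_K jM; have := S_gt0 j; have := SE j.
  rewrite /block_energy block_n_mid//.
  have -> : (j == 0%N) = false by lia.
  have -> : (j == M) = false by lia.
  have -> : @block_z R N j = diamond_z R N j by rewrite /block_z; case: eqP => //; lia.
  move=> SjE S0 SK.
  have -> : (2 * K - S j) / K = 1 + diamond_z R N j by rewrite diamond_zE; field; lra.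
  have -> : S j / K = 1 - diamond_z R N j by rewrite diamond_zE; field; lra.
  have z1 : 0 < 1 - diamond_z R N j.
    by rewrite diamond_zE opprB addrC subrK divr_gt0.
  have z0 : 0 < 1 + diamond_z R N j.
    by rewrite diamond_zE; have : S j / K < 1 by [rewrite ltr_pdivrMr// mul1r]; lra.
  have -> : 1 - diamond_z R N j ^+ 2 = (1 - diamond_z R N j) * (1 + diamond_z R N j) by ring.
  rewrite !ln_div ?posrE ?mulr_gt0 ?exprn_gt0// lnM ?posrE// lnXn// mulr2n SjE.
  move: (bigop.body _ _ _) => s.
  move: (ln (1 - _)) (ln (1 + _)) (ln (1 - _)) (ln 2) (ln (r j)%:R) => a b c d e.
  by field.
rewrite /diamond_mean /diamond_Q /diamond_T /diamond_V !sumrB -mulr_sumr.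
rewrite sum_S_telescope; last by lia.
have := @twoN1E R N N121; rewrite SE.
move: (\sum_(1 <= i < M) (r i)%:R) => s KE.
have -> : s = (K - 1 - (r M)%:R) / 2 by rewrite KE; field.
move: (bigop.body _ _ _) (bigop.body _ _ _) (bigop.body _ _ _) => A B C.
by field.
Qed.

Lemma has_mean_diamond_closed :
  has_mean (fun th : M.-1.-tuple R => log_energy (diamond th)) diamond_mean.
Proof. by rewrite -diamond_meanE; exact: has_mean_diamond. Qed.

End closed_form.

(** * Midpoint rules with explicit remainders *)

Section calculus.
Context {R : realType}.
Implicit Types (x y t d : R).

Lemma ge0_of_derive (f df : R -> R) (b : R) :
  (forall x, 0 <= x <= b -> is_derive x 1 f (df x)) ->
  (forall x, 0 <= x <= b -> 0 <= df x) -> 0 <= f 0 ->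
  forall x, 0 <= x <= b -> 0 <= f x.
Proof.
move=> Df df0 f0 x /andP[x0 xb].
have [||c c0x] := @MVT_segment R f df 0 x x0.
- move=> y; rewrite in_itv/= => /andP[y0 yx].
  by apply: Df; rewrite (ltW y0) (le_trans (ltW yx)).
- apply: derivable_within_continuous => y; rewrite in_itv/= => /andP[y0 yx].
  by have := Df y; rewrite y0 (le_trans yx xb) => /(_ isT) D; apply: ex_derive.
rewrite subr0 => fE; rewrite -[f x](subrK (f 0)) addr_ge0// fE mulr_ge0//.
by move: c0x; rewrite in_itv/= => /andP[c0 cx]; apply: df0; rewrite c0 (le_trans cx).
Qed.

Lemma is_derive_ln1D x : -1 < x -> is_derive x 1 (fun y => ln (1 + y)) (1 + x)^-1.
Proof.
move=> x1; have x0 : 0 < 1 + x by lra.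
have D := @is_derive1_comp _ (@ln R) (fun y => 1 + y) x _ 1 (is_derive1_ln x0).
have := D _; rewrite mulr1; apply.
by apply: is_derive_eq; ring.
Qed.

Lemma is_derive_ln1B x : x < 1 -> is_derive x 1 (fun y => ln (1 - y)) (- (1 - x)^-1).
Proof.
move=> x1; have x0 : 0 < 1 - x by lra.
have D := @is_derive1_comp _ (@ln R) (fun y => 1 - y) x _ (-1) (is_derive1_ln x0).
have := D _; rewrite mulrN1; apply.
by apply: is_derive_eq; ring.
Qed.

(** The derivative 2 x^2 / (1 - x^2) is at most 8 x^2 because 1 - x^2 >= 13 / 49 > 1 / 4 on this
    interval. The next two estimates arise by integrating this one, so 8 / 3 becomes 2 / 3 and then
    2 / 15. *)
Lemma ln_ratio_bounds y : 0 <= y <= 6 / 7 ->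
  0 <= ln (1 + y) - ln (1 - y) - 2 * y <= 8 / 3 * y ^+ 3.
Proof.
move=> yb; rewrite -[X in _ && X]subr_ge0; apply/andP; split.
  apply: (@ge0_of_derive (fun y => ln (1 + y) - ln (1 - y) - 2 * y)
    (fun y => (1 + y)^-1 + (1 - y)^-1 - 2) (6 / 7) _ _ _ y yb).
  - move=> x /andP[x0 x1].
    have D1 := @is_derive_ln1D x ltac:(lra); have D2 := @is_derive_ln1B x ltac:(lra).
    by apply: is_derive_eq; rewrite /GRing.scale /=; ring.
  - move=> x /andP[x0 x1].
    have -> : (1 + x)^-1 + (1 - x)^-1 - 2 = 2 * x ^+ 2 / (1 - x ^+ 2) by field; apply/andP;
      split; nra.
    by rewrite divr_ge0//; nra.
  - by rewrite addr0 subr0 ln1; lra.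
apply: (@ge0_of_derive (fun y => 8 / 3 * y ^+ 3 - (ln (1 + y) - ln (1 - y) - 2 * y))
    (fun y => 8 * y ^+ 2 - ((1 + y)^-1 + (1 - y)^-1 - 2)) (6 / 7) _ _ _ y yb).
- move=> x /andP[x0 x1].
  have D1 := @is_derive_ln1D x ltac:(lra); have D2 := @is_derive_ln1B x ltac:(lra).
  apply: is_derive_eq; rewrite /GRing.scale /=.
  by field; apply/andP; split; lra.
- move=> x /andP[x0 x1].
  have -> : (1 + x)^-1 + (1 - x)^-1 - 2 = 2 * x ^+ 2 / (1 - x ^+ 2) by field; apply/andP; split;
    nra.
  have x2 : x ^+ 2 <= 36 / 49 by nra.
  rewrite subr_ge0 ler_pdivrMr; last by lra.
  have x3 : 0 <= 36 / 49 - x ^+ 2 by lra.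
  by have := mulr_ge0 (sqr_ge0 x) x3; have := sqr_ge0 x; lra.
- by rewrite addr0 subr0 ln1; lra.
Qed.

Lemma entropy_bounds y : 0 <= y <= 6 / 7 ->
  0 <= (1 + y) * ln (1 + y) + (1 - y) * ln (1 - y) - y ^+ 2 <= 2 / 3 * y ^+ 4.
Proof.
move=> yb; rewrite -[X in _ && X]subr_ge0; apply/andP; split.
  apply: (@ge0_of_derive (fun y => (1 + y) * ln (1 + y) + (1 - y) * ln (1 - y) - y ^+ 2)
    (fun y => ln (1 + y) - ln (1 - y) - 2 * y) (6 / 7) _ _ _ y yb).
  - move=> x /andP[x0 x1].
    have D1 := @is_derive_ln1D x ltac:(lra); have D2 := @is_derive_ln1B x ltac:(lra).
    apply: is_derive_eq; rewrite /GRing.scale /=.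
    by field; apply/andP; split; lra.
  - by move=> x /ln_ratio_bounds/andP[].
  - by rewrite addr0 subr0 ln1; lra.
apply: (@ge0_of_derive (fun y => 2 / 3 * y ^+ 4 - ((1 + y) * ln (1 + y) + (1 - y) * ln (1 - y) -
  y ^+ 2))
    (fun y => 8 / 3 * y ^+ 3 - (ln (1 + y) - ln (1 - y) - 2 * y)) (6 / 7) _ _ _ y yb).
- move=> x /andP[x0 x1].
  have D1 := @is_derive_ln1D x ltac:(lra); have D2 := @is_derive_ln1B x ltac:(lra).
  apply: is_derive_eq; rewrite /GRing.scale /=.
  by field; apply/andP; split; lra.
- by move=> x /ln_ratio_bounds/andP[_]; rewrite subr_ge0.
- by rewrite addr0 subr0 ln1; lra.
Qed.

Definition xlnx_int (u : R) := u ^+ 2 * ln u / 2 - u ^+ 2 / 4.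

Lemma xlnx_int_midpoint1 y : 0 <= y <= 6 / 7 ->
  0 <= xlnx_int (1 + y) - xlnx_int (1 - y) - y ^+ 3 / 3 <= 2 / 15 * y ^+ 5.
Proof.
move=> yb; rewrite -[X in _ && X]subr_ge0; apply/andP; split.
  apply: (@ge0_of_derive (fun y => xlnx_int (1 + y) - xlnx_int (1 - y) - y ^+ 3 / 3)
    (fun y => (1 + y) * ln (1 + y) + (1 - y) * ln (1 - y) - y ^+ 2) (6 / 7) _ _ _ y yb).
  - move=> x /andP[x0 x1]; rewrite /xlnx_int.
    have D1 := @is_derive_ln1D x ltac:(lra); have D2 := @is_derive_ln1B x ltac:(lra).
    apply: is_derive_eq; rewrite /GRing.scale /=.
    by field; apply/andP; split; lra.
  - by move=> x /entropy_bounds/andP[].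
  - by rewrite addr0 subr0; lra.
apply: (@ge0_of_derive (fun y => 2 / 15 * y ^+ 5 - (xlnx_int (1 + y) - xlnx_int (1 - y) - y ^+ 3
  / 3))
    (fun y => 2 / 3 * y ^+ 4 - ((1 + y) * ln (1 + y) + (1 - y) * ln (1 - y) - y ^+ 2)) (6 / 7) _
      _ _ y yb).
- move=> x /andP[x0 x1]; rewrite /xlnx_int.
  have D1 := @is_derive_ln1D x ltac:(lra); have D2 := @is_derive_ln1B x ltac:(lra).
  apply: is_derive_eq; rewrite /GRing.scale /=.
  by field; apply/andP; split; lra.
- by move=> x /entropy_bounds/andP[_]; rewrite subr_ge0.
- by rewrite addr0 subr0; lra.
Qed.

(** The midpoint rule for u ln u on [t - d, t + d]. Rescaling by t reduces it to the centre 1, since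
    ln t contributes exactly 2 d t ln t. *)
Lemma xlnx_int_midpoint t d : 0 < t -> 0 <= d <= 6 / 7 * t ->
  0 <= xlnx_int (t + d) - xlnx_int (t - d) - 2 * d * t * ln t - d ^+ 3 / (3 * t) <= 2 / 15 * d
    ^+ 5 / t ^+ 3.
Proof.
move=> t0 /andP[d0 dt].
have yb : 0 <= d / t <= 6 / 7 by rewrite divr_ge0 ?ler_pdivrMr ?(ltW t0).
have tn : t != 0 by rewrite gt_eqF.
have [y0 y1] := andP yb.
have -> : xlnx_int (t + d) - xlnx_int (t - d) - 2 * d * t * ln t - d ^+ 3 / (3 * t) =
   t ^+ 2 * (xlnx_int (1 + d / t) - xlnx_int (1 - d / t) - (d / t) ^+ 3 / 3).
  have -> : t + d = t * (1 + d / t) by field.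
  have -> : t - d = t * (1 - d / t) by field.
  rewrite /xlnx_int !lnM ?posrE//; [|lra|lra].
  by field.
have -> : 2 / 15 * d ^+ 5 / t ^+ 3 = t ^+ 2 * (2 / 15 * (d / t) ^+ 5) by field.
have /andP[h1 h2] := xlnx_int_midpoint1 yb; have t2 : 0 <= t ^+ 2 by rewrite sqr_ge0.
by rewrite mulr_ge0//= ler_wpM2l.
Qed.

Lemma ln_midpoint t d : 0 < t -> 0 <= d <= 6 / 7 * t ->
  0 <= ln (t + d) - ln (t - d) - 2 * (d / t) <= 8 / 3 * (d / t) ^+ 3.
Proof.
move=> t0 /andP[d0 dt].
have yb : 0 <= d / t <= 6 / 7 by rewrite divr_ge0 ?ler_pdivrMr ?(ltW t0).
have [y0 y1] := andP yb; have tn : t != 0 by rewrite gt_eqF.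
have -> : t + d = t * (1 + d / t) by field.
have -> : t - d = t * (1 - d / t) by field.
rewrite !lnM ?posrE//; [|lra|lra].
have := ln_ratio_bounds yb.
have -> : ln t + ln (1 + d / t) - (ln t + ln (1 - d / t)) = ln (1 + d / t) - ln (1 - d / t) by ring.
by [].
Qed.

Lemma ln_lip c x y : 0 < c -> c <= x -> c <= y -> `|ln x - ln y| <= `|x - y| / c.
Proof.
move=> c0; wlog xy : x y / x <= y => [H cx cy|cx cy].
  case: (leP x y) => h; first exact: H.
  by rewrite distrC (distrC x); apply: H => //; exact: ltW.
have x0 := lt_le_trans c0 cx; have y0 := lt_le_trans c0 cy.
rewrite distrC (distrC x) !ger0_norm ?subr_ge0 ?ler_ln//.
rewrite -ln_div ?posrE//; have -> : y / x = 1 + (y - x) / x by field; rewrite gt_eqF.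
have d0 : 0 <= (y - x) / x by rewrite divr_ge0 ?subr_ge0 ?(ltW x0).
apply: le_trans (le_ln1Dx _) _; first by lra.
by rewrite ler_wpM2l ?subr_ge0// lef_pV2 ?posrE.
Qed.

Lemma xlnx_int_lip x y : 1 <= x -> x <= y -> `|xlnx_int y - xlnx_int x| <= (y - x) * (y * ln y).
Proof.
move=> x1 xy.
have D (z : R) : 0 < z -> is_derive z 1 xlnx_int (z * ln z).
  move=> z0; have D1 := is_derive1_ln z0; apply: is_derive_eq; rewrite /GRing.scale /=.
  by field; rewrite gt_eqF.
have [||c] := @MVT_segment R xlnx_int (fun z => z * ln z) x y xy.
- by move=> z; rewrite in_itv/= => /andP[xz _]; apply: D; lra.
- apply: derivable_within_continuous => z; rewrite in_itv/= => /andP[xz _].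
  by have Dz := D z ltac:(lra); apply: ex_derive.
rewrite in_itv/= => /andP[xc cy] ->.
have lc : 0 <= ln c by apply: ln_ge0; lra.
rewrite ger0_norm ?mulr_ge0 ?subr_ge0//; last by lra.
rewrite mulrC ler_wpM2l ?subr_ge0// ler_pM//; first by lra.
by rewrite ler_ln ?posrE//; lra.
Qed.

End calculus.

(** * Asymptotics *)

Section asymptotics.
Context {R : realType}.
Implicit Types (f g : nat -> R) (C : R).
Local Notation m N := ((diamond_m R N)%:R : R).
Local Notation M N := (diamond_M R N).
Local Notation r N j := ((diamond_r R N j)%:R : R).
Local Notation S N j := ((@diamond_S R N j).+1%:R : R).
Local Notation K N := (2 * N%:R - 1 : R).

(* Everything is compared up to O(m (1 + ln m)), m being of order sqrt N. *)
Definition large N := (121 <= N)%N && (3 <= diamond_m R N)%N.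
Definition err N : R := m N * (1 + ln (m N)).
Definition asym f g := exists C, forall N, large N -> `|f N - g N| <= C * err N.

Lemma large_m N : large N -> 3 <= m N.
Proof. by move=> /andP[_ m3]; rewrite (ler_nat R 3). Qed.

Lemma ln_m_ge0 N : large N -> 0 <= ln (m N).
Proof. by move=> /large_m m3; apply: ln_ge0; lra. Qed.

Lemma err_ge N : large N -> m N <= err N.
Proof.
move=> Nl; have := large_m Nl; have := ln_m_ge0 Nl; rewrite /err => l0 m3.
by rewrite ler_peMr//; lra.
Qed.

Lemma asym_refl f : asym f f.
Proof.
exists 1 => N Nl; rewrite subrr normr0 mul1r.
by have := err_ge Nl; have := large_m Nl; lra.
Qed.

Lemma asym_eq f g : (forall N, large N -> f N = g N) -> asym f g.
Proof.
move=> fg; exists 1 => N Nl; rewrite fg// subrr normr0 mul1r.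
by have := err_ge Nl; have := large_m Nl; lra.
Qed.

Lemma asym_trans g f h : asym f g -> asym g h -> asym f h.
Proof.
move=> [C H] [D I]; exists (C + D) => N Nl; rewrite mulrDl.
by apply: le_trans (ler_distD (g N) _ _) _; rewrite lerD ?H ?I.
Qed.

Lemma asymD f g f' g' : asym f g -> asym f' g' ->
  asym (fun N => f N + f' N) (fun N => g N + g' N).
Proof.
move=> [C H] [D I]; exists (C + D) => N Nl; rewrite mulrDl opprD addrACA.
by apply: le_trans (ler_normD _ _) _; rewrite lerD ?H ?I.
Qed.

Lemma asymZ k f g : asym f g -> asym (fun N => k * f N) (fun N => k * g N).
Proof.
move=> [C H]; exists (`|k| * C) => N Nl; rewrite -mulrBr normrM -mulrA.
by rewrite ler_wpM2l ?H.
Qed.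

Lemma asymB f g f' g' : asym f g -> asym f' g' ->
  asym (fun N => f N - f' N) (fun N => g N - g' N).
Proof.
move=> fg /(asymZ (-1)) fg'.
have [C H] := asymD fg fg'; exists C => N Nl.
by have := H N Nl; rewrite !mulN1r.
Qed.

Lemma asym_m C f g : (forall N, large N -> `|f N - g N| <= C * m N) -> asym f g.
Proof.
move=> H; exists `|C| => N Nl; apply: le_trans (H N Nl) _.
have m3 := large_m Nl; apply: le_trans (ler_wpM2r _ (ler_norm C)) _; first by lra.
by rewrite ler_wpM2l// err_ge.
Qed.

(** At most 7 m terms, so each may be changed by O(1 + ln m). *)
Lemma asym_sum (a c : nat -> nat) (f g : nat -> nat -> R) C :
  (forall N, large N -> (c N <= 7 * diamond_m R N)%N) ->
  (forall N j, large N -> (a N <= j < c N)%N -> `|f N j - g N j| <= C * (1 + ln (m N))) ->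
  asym (fun N => \sum_(a N <= j < c N) f N j) (fun N => \sum_(a N <= j < c N) g N j).
Proof.
move=> cm H; exists (7 * `|C|) => N Nl; rewrite -sumrB.
have l0 := ln_m_ge0 Nl; have m3 := large_m Nl.
apply: le_trans (ler_norm_sum _ _ _) _.
apply: (@le_trans _ _ (\sum_(a N <= j < c N) `|C| * (1 + ln (m N)))).
  rewrite big_nat_cond [leRHS]big_nat_cond; apply: ler_sum => j /andP[jc _].
  apply: le_trans (H N j Nl jc) _; apply: ler_wpM2r; [lra|exact: ler_norm].
rewrite sumr_const_nat -[leLHS]mulr_natl /err.
rewrite (_ : 7 * `|C| * (m N * (1 + ln (m N))) = 7 * m N * (`|C| * (1 + ln (m N)))); last by ring.
apply: ler_wpM2r; first by apply: mulr_ge0 => //; lra.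
by rewrite -natrM ler_nat; have := cm N Nl; lia.
Qed.

Section facts.
Variable N : nat.
Hypothesis Nl : large N.

Let N121 : (121 <= N)%N. Proof. by case/andP: Nl. Qed.

(** The points beyond 239 m^2 + 2 in the doubled count are at most 717 (2 m - 1) + 2 m - 2 < 1436
    m. *)
Lemma K_bounds : 239 * m N ^+ 2 <= K N <= 239 * m N ^+ 2 + 1436 * m N.
Proof.
have h := @diamond_N_eq R N N121; have h2 := @diamond_gamma_le R N N121.
have h3 := @diamond_eta_lt R N N121; have h4 := @diamond_m_gt0 R N N121.
have h5 : (diamond_gamma R N * (2 * diamond_m R N - 1) <= 717 * (2 * diamond_m R N - 1))%N.
  by rewrite leq_mul2r h2 orbT.
move: h h5; move: (diamond_gamma R N * _)%N => gm h h5.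
have a : (239 * diamond_m R N ^ 2 + 1 <= 2 * N)%N by lia.
have b : (2 * N <= 239 * diamond_m R N ^ 2 + 1436 * diamond_m R N + 1)%N by lia.
have gen1 (x y z : nat) : (x * y ^ 2 + 1 <= 2 * z)%N -> x%:R * y%:R ^+ 2 + 1 <= 2 * z%:R :> R.
  by rewrite -(ler_nat R) natrD !natrM expr2.
have gen2 (x y z t : nat) : (2 * z <= x * y ^ 2 + t * y + 1)%N ->
   2 * z%:R <= x%:R * y%:R ^+ 2 + t%:R * y%:R + 1 :> R.
  by rewrite -(ler_nat R) natrD natrD !natrM expr2.
by have := gen1 _ _ _ a; have := gen2 _ _ _ _ b; lra.
Qed.

(** 726 = 6 + 720, and 267 = 27 + 240 because 720 <= 240 m once m >= 3. *)
Lemma r_bounds j : (0 < j <= M N)%N ->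
  [/\ 3 * j%:R <= r N j, r N j <= 726 * j%:R & r N j <= 267 * m N].
Proof.
move=> /andP[j0 jM]; have m3 : (3 <= diamond_m R N)%N by case/andP: Nl.
split.
- by rewrite -natrM ler_nat; apply: (diamond_r_ge N121).
- rewrite -natrM ler_nat; apply: leq_trans (diamond_r_le N121 jM) _; lia.
- rewrite -natrM ler_nat; apply: leq_trans (diamond_r_le_m N121 jM) _; lia.
Qed.

Lemma S_bounds j : (0 < j <= M N)%N -> 3 * j%:R ^+ 2 + 1 <= S N j <= K N.
Proof.
move=> /andP[j0 jM]; apply/andP; split.
  by rewrite -natrX -natrM natr1 ler_nat ltnS; apply: (diamond_S_ge N121); rewrite j0.
rewrite (@twoN1E R N N121) ler_nat ltnS; move: jM; rewrite leq_eqVlt => /predU1P[->//|jM].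
by apply: ltnW; apply: (diamond_S_lt N121) => //; rewrite jM leqnn.
Qed.

Lemma S_large j : (2 * diamond_m R N <= j <= M N)%N -> 24 * m N ^+ 2 <= S N j.
Proof.
move=> /andP[j0 jM]; have m0 := @diamond_m_gt0 R N N121.
rewrite -natrX -natrM ler_nat.
apply: (@leq_trans (@diamond_S R N (2 * diamond_m R N)).+1).
  by rewrite (diamond_S1 N121); lia.
rewrite ltnS; move: j0; rewrite leq_eqVlt => /predU1P[->//|j0].
by apply: ltnW; apply: (diamond_S_lt N121); lia.
Qed.

(** This is what allows the midpoint estimates on every cell. It is sharp at j = 1, where r = 6 and
    S = 7. *)
Lemma r_le_S j : (0 < j <= M N)%N -> 0 <= r N j <= 6 / 7 * S N j.
Proof.
move=> jM; rewrite ler0n /=; have [j0 jM'] := andP jM.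
have m3 : (3 <= diamond_m R N)%N by case/andP: Nl.
suff : (7 * diamond_r R N j <= 6 * (@diamond_S R N j).+1)%N.
  by rewrite -(ler_nat R) !natrM; lra.
have [j2|j2] := leqP j (2 * diamond_m R N).
  rewrite (diamond_r1 j2) (diamond_S1 N121); last by lia.
  by case: j {jM jM' j2} j0 => // -[|j] _; lia.
have [j6|j6] := leqP j (6 * diamond_m R N).
  have rj : (diamond_r R N j <= 6 * j)%N.
    have [h3|h3] := leqP j (3 * diamond_m R N); first by rewrite diamond_r2; lia.
    have [h4|h4] := leqP j (4 * diamond_m R N); first by rewrite diamond_r3; lia.
    have [h5|h5] := leqP j (5 * diamond_m R N); first by rewrite diamond_r4; lia.
    by rewrite diamond_r5; lia.
  have := diamond_S_ge N121 jM.
  have : (7 * j <= 3 * j ^ 2)%N by rewrite -mulnn mulnA leq_mul2r; lia.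
  lia.
have := diamond_r_le_m N121 jM'.
have S6 := @diamond_S5 R N N121 (6 * diamond_m R N).
have : (@diamond_S R N (6 * diamond_m R N) < @diamond_S R N j)%N.
  by apply: (diamond_S_lt N121); lia.
have : (3 * diamond_m R N <= diamond_m R N ^ 2)%N by rewrite -mulnn leq_mul2r m3 orbT.
lia.
Qed.

Lemma S_succ j : (0 < j)%N -> S N j.+1 = S N j + r N j + r N j.+1.
Proof. by move=> j0; rewrite (diamond_S_succ N121)// -!natrD -addSn -addSn. Qed.

End facts.
End asymptotics.

(** * The main sum as an integral of u ln u *)

Section asymptotic_Q.
Context {R : realType}.
Local Notation m N := ((diamond_m R N)%:R : R).
Local Notation M N := (diamond_M R N).
Local Notation r N j := ((diamond_r R N j)%:R : R).
Local Notation S N j := ((@diamond_S R N j).+1%:R : R).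
Local Notation K N := (2 * N%:R - 1 : R).
Local Notation large := (@large R).

(** A quarter of the term d^3 / (3 t) of [xlnx_int_midpoint], for d = r_j and t the centre S_j of a
    cell or its mirror image 2 K - S_j. *)
Definition midpoint_corr N : R := \sum_(1 <= j < M N) r N j ^+ 3 / 12 * ((S N j)^-1 + (2 * K N -
  S N j)^-1).
(* The S_j are the midpoints of the cells [cell_start j, cell_start (j + 1)],
   of width 2 r_j. *)
Definition cell_start N j : R := S N j - r N j.

Lemma cell_start1 N : large N -> cell_start N 1 = 1.
Proof.
move=> Nl; have [N121 m3] := andP Nl.
by rewrite /cell_start -natr1 /diamond_S big_geq// add0n addrC addKr.
Qed.

Lemma cell_start_succ N j : large N -> (0 < j)%N -> cell_start N j.+1 = S N j + r N j.
Proof. by move=> Nl j0; rewrite /cell_start S_succ// addrK. Qed.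

Lemma M_gt0 N : large N -> (7 <= M N)%N.
Proof. by move=> /andP[N121 _]; apply: diamond_M_ge7. Qed.

Lemma cell_start_last N : large N -> cell_start N (M N) = K N - r N (M N).
Proof. by move=> Nl; have [N121 _] := andP Nl; rewrite /cell_start (twoN1E N121). Qed.

(** Keeps the fifth-order remainder of the midpoint rule O(1) on every cell, even near the pole: s^3
    >= j^6 >= j^5. *)
Lemma ratio5_bound (c j s x : R) : 0 <= c -> 1 <= j -> j ^+ 2 <= s -> 0 <= x -> x <= c * j ->
  x ^+ 5 / s ^+ 3 <= c ^+ 5.
Proof.
move=> c0 j1 js x0 xc; have s0 : 0 < s by apply: lt_le_trans js; rewrite exprn_gt0//; lra.
rewrite ler_pdivrMr ?exprn_gt0//.
apply: (@le_trans _ _ ((c * j) ^+ 5)); first by rewrite lerXn2r// ?nnegrE//; apply: le_trans xc.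
rewrite exprMn; apply: ler_wpM2l; first exact: exprn_ge0.
apply: (@le_trans _ _ ((j ^+ 2) ^+ 3)).
  by rewrite -exprM; apply: ler_weXn2l.
by rewrite lerXn2r// nnegrE ?(ltW s0)// sqr_ge0.
Qed.

(** The midpoint rule is applied to the cell and to its image under u -> 2 K - u. The parts in ln K
    merge because the two centres add up to 2 K. *)
Lemma Q_term : exists C : R, forall N j, large N -> (1 <= j < M N)%N ->
  `|r N j / 2 * (S N j * ln (S N j / K N) + (2 * K N - S N j) * ln ((2 * K N - S N j) / K N)) -
   ((xlnx_int (cell_start N j.+1) - xlnx_int (cell_start N j)) / 4 + (xlnx_int (2 * K N -
     cell_start N j) - xlnx_int (2 * K N - cell_start N j.+1)) / 4
    - r N j ^+ 3 / 12 * ((S N j)^-1 + (2 * K N - S N j)^-1) - r N j * (K N * ln (K N)))| <= C.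
Proof.
exists (726 ^+ 5 / 30 + 726 ^+ 5 / 30) => N j Nl jM.
have jM' : (0 < j <= M N)%N by lia.
have j0 : (0 < j)%N by lia.
have j1 : 1 <= j%:R :> R by rewrite (ler_nat R 1).
rewrite cell_start_succ//; have m3 := large_m Nl.
have [r3 r726 r267] := r_bounds Nl jM'; have /andP[Sj SK] := S_bounds Nl jM'.
have /andP[r0 rS] := r_le_S Nl jM'; have /andP[Km _] := K_bounds Nl.
have S0 : 0 < S N j by rewrite ltr0n.
have K0 : 0 < K N by apply: lt_le_trans SK.
rewrite /cell_start; move: (r N j) (S N j) (K N) (j%:R : R) r3 r726 r267 Sj SK r0 rS Km j1 S0 K0.
move=> {jM jM'} x s k y r3 r726 r267 Sj SK r0 rS Km j1 S0 K0.
have t0 : 0 < 2 * k - s by lra.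
have xt : 0 <= x <= 6 / 7 * (2 * k - s) by apply/andP; split; lra.
have xs : 0 <= x <= 6 / 7 * s by apply/andP; split; lra.
have /andP[a1 a2] := xlnx_int_midpoint S0 xs; have /andP[b1 b2] := xlnx_int_midpoint t0 xt.
have e1 : 2 * k - (s - x) = 2 * k - s + x by ring.
have e2 : 2 * k - (s + x) = 2 * k - s - x by ring.
rewrite e1 e2 !ln_div ?posrE//.
have yb : y ^+ 2 <= s.
  by apply: le_trans Sj; have := sqr_ge0 y; clear; lra.
have c0 : 0 <= 726 :> R by exact: ler0n.
have sk : s <= 2 * k - s by clear -SK; lra.
have h1 := ratio5_bound c0 j1 yb r0 r726.
have yb' : y ^+ 2 <= 2 * k - s.
  exact: le_trans yb sk.
have h2 := ratio5_bound c0 j1 yb' r0 r726.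
move: (726 ^+ 5) h1 h2 => c5 h1 h2.
have d1 : x ^+ 3 / (3 * s) = x ^+ 3 / 3 * s^-1 by field; rewrite gt_eqF.
have d2 : x ^+ 3 / (3 * (2 * k - s)) = x ^+ 3 / 3 * (2 * k - s)^-1 by field; rewrite gt_eqF.
rewrite d1 in a1 a2; rewrite d2 in b1 b2.
rewrite -(mulrA (2 / 15) (x ^+ 5)) in a2; rewrite -(mulrA (2 / 15) (x ^+ 5)) in b2.
have -> : x / 2 * (s * (ln s - ln k) + (2 * k - s) * (ln (2 * k - s) - ln k)) -
   ((xlnx_int (s + x) - xlnx_int (s - x)) / 4 + (xlnx_int (2 * k - s + x) - xlnx_int (2 * k - s
     - x)) / 4 -
    x ^+ 3 / 12 * (s^-1 + (2 * k - s)^-1) - x * (k * ln k)) =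
  - ((xlnx_int (s + x) - xlnx_int (s - x) - 2 * x * s * ln s - x ^+ 3 / 3 * s^-1) / 4)
  - ((xlnx_int (2 * k - s + x) - xlnx_int (2 * k - s - x) - 2 * x * (2 * k - s) * ln (2 * k - s)
      - x ^+ 3 / 3 * (2 * k - s)^-1) / 4).
  move: (ln s) (ln (2 * k - s)) (ln k) (xlnx_int _) (xlnx_int _) (xlnx_int _) (xlnx_int _)
    (s^-1) ((2 * k - s)^-1) => *.
  by field.
move: a1 a2 b1 b2 h1 h2.
move: (x ^+ 5 / _) (x ^+ 5 / _) (_ - _ - _ - _) (_ - _ - _ - _); clear.
move=> u v p q a1 a2 b1 b2 h1 h2; by rewrite ler_norml; apply/andP; split; lra.
Qed.

Lemma asym_bounded C (f g : nat -> R) :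
  (forall N, large N -> `|f N - g N| <= C * (1 + ln (m N))) -> asym f g.
Proof.
move=> H; exists `|C| => N Nl; apply: le_trans (H N Nl) _.
have l0 := ln_m_ge0 Nl; have m3 := large_m Nl.
apply: (@le_trans _ _ (`|C| * (1 + ln (m N)))).
  by apply: ler_wpM2r; [lra|exact: ler_norm].
by apply: ler_wpM2l => //; rewrite /err ler_peMl//; lra.
Qed.

Lemma ln_le_m c x N : large N -> 1 <= c -> 0 < x -> x <= c * m N ^+ 2 -> ln x <= ln c + 2 * ln
  (m N).
Proof.
move=> Nl c1 x0 xm; have m3 := large_m Nl; have m0 : 0 < m N by lra.
have c0 : 0 < c by lra.
rewrite mulr_natl -lnXn// -lnM ?posrE ?exprn_gt0//.
by rewrite ler_ln// posrE mulr_gt0// exprn_gt0.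
Qed.

Lemma K_le N : large N -> K N <= 1675 * m N ^+ 2.
Proof.
move=> Nl; have m3 := large_m Nl; have /andP[_ h] := K_bounds Nl.
apply: le_trans h _; have : m N <= m N ^+ 2 by rewrite expr2 ler_peMr; lra.
lra.
Qed.

(** The cells stop at K - r_M and their mirror images at K + r_M. The gap is one more midpoint cell,
    centred at K, whose correction of order r_M^3 / K is O(m). *)
Lemma asym_xlnx_int_last :
  asym (fun N => xlnx_int (cell_start N (M N)) - xlnx_int (2 * K N - cell_start N (M N)))
       (fun N => - (2 * r N (M N) * K N * ln (K N))).
Proof.
apply: (@asym_m _ (267 ^+ 3 + 267 ^+ 5)) => N Nl.
have M7 := M_gt0 Nl; have MM : (0 < M N <= M N)%N by rewrite leqnn andbT; lia.
have m3 := large_m Nl.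
have [r3 _ r267] := r_bounds Nl MM; have /andP[r0 rS] := r_le_S Nl MM.
have /andP[_ SK] := S_bounds Nl MM; have /andP[Km _] := K_bounds Nl.
rewrite cell_start_last//; move: (r N (M N)) (S N (M N)) (K N) (m N) r3 r267 r0 rS SK Km m3.
move=> x s k y _ r267 r0 rS SK Km m3 {MM M7 Nl}.
have k1 : y ^+ 2 <= k by have := sqr_ge0 y; lra.
have y2 : 0 < y ^+ 2 by rewrite exprn_gt0//; lra.
have k0 : 0 < k by lra.
have xk : 0 <= x <= 6 / 7 * k by apply/andP; split; lra.
have /andP[a1 a2] := xlnx_int_midpoint k0 xk.
have c0 : 0 <= 267 :> R by exact: ler0n.
move: (267 : R) c0 r267 => c c0 r267.
have y1 : 1 <= y by lra.
have h5 := ratio5_bound c0 y1 k1 r0 r267.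
have h3 : x ^+ 3 / k <= c ^+ 3 * y.
  rewrite ler_pdivrMr//; apply: (@le_trans _ _ ((c * y) ^+ 3)).
    by rewrite lerXn2r// ?nnegrE//; apply: le_trans r267.
  rewrite exprMn -[leRHS]mulrA; apply: ler_wpM2l; first exact: exprn_ge0.
  by rewrite exprS; apply: ler_wpM2l => //; lra.
have p5 : 0 <= c ^+ 5 by exact: exprn_ge0.
move: (c ^+ 3) (c ^+ 5) h3 h5 p5 => c3 c5 h3 h5 p5.
have d1 : x ^+ 3 / (3 * k) = x ^+ 3 / k / 3 by field; rewrite gt_eqF.
rewrite d1 in a1 a2; rewrite -(mulrA (2 / 15) (x ^+ 5)) in a2.
have -> : 2 * k - (k - x) = k + x by ring.
have h5' : c5 <= c5 * y by rewrite ler_peMr.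
have q3 : 0 <= x ^+ 3 / k by rewrite divr_ge0 ?exprn_ge0 ?(ltW k0).
rewrite (mulrDl _ _ y) ler_norml; move: (c3 * y) (c5 * y) (x ^+ 3 / k) (x ^+ 5 / _) h3 h5 h5' q3
  a1 a2 => *.
by apply/andP; split; lra.
Qed.

(** The cells start at 1, so their mirror images end at 2 K - 1. The interval from there to 2 K is a
    midpoint cell of half-width 1 / 2. *)
Lemma xlnx_int_first (k : R) : 100 <= k ->
  `|xlnx_int (2 * k - 1) - (xlnx_int (2 * k) - 2 * k * ln (2 * k))| <= 2 + ln (2 * k).
Proof.
move=> k1; have t1 : 1 <= 2 * k - 2^-1 by lra.
have t0 : 0 < 2 * k - 2^-1 by lra.
have hf : 0 < 2^-1 :> R by rewrite invr_gt0.
have dt : 0 <= (2^-1 : R) <= 6 / 7 * (2 * k - 2^-1).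
  by rewrite (ltW hf) /=; lra.
have /andP[a1 a2] := xlnx_int_midpoint t0 dt.
have e1 : 2 * k - 2^-1 + 2^-1 = 2 * k by ring.
have e2 : 2 * k - 2^-1 - 2^-1 = 2 * k - 1 by field.
rewrite e1 e2 in a1 a2.
have b1 : 0 <= 2^-1 ^+ 3 / (3 * (2 * k - 2^-1)) <= 1.
  rewrite divr_ge0 ?exprn_ge0//=; last by lra.
  by rewrite ler_pdivrMr; lra.
have b2 : 2 / 15 * 2^-1 ^+ 5 / (2 * k - 2^-1) ^+ 3 <= 1.
  rewrite ler_pdivrMr ?exprn_gt0// mul1r; apply: (@le_trans _ _ 1); first by lra.
  exact: exprn_ege1.
have c1 := @ln_lip R (2 * k - 2^-1) (2 * k) (2 * k - 2^-1) t0 ltac:(lra) (lexx _).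
have c2 : (2 * k - 2^-1) * `|ln (2 * k) - ln (2 * k - 2^-1)| <= 2^-1.
  apply: le_trans (ler_wpM2l (ltW t0) c1) _.
  have -> : 2 * k - (2 * k - 2^-1) = 2^-1 by ring.
  by rewrite ger0_norm// mulrCA divff ?mulr1// gt_eqF.
have c3 : 0 <= ln (2 * k) - ln (2 * k - 2^-1).
  by rewrite subr_ge0 ler_ln ?posrE//; clear -k1; lra.
rewrite ger0_norm// in c2.
have l2 : 0 <= ln (2 * k) by apply: ln_ge0; clear -k1; lra.
have q0 := mulr_ge0 (ltW t0) c3.
have GE : xlnx_int (2 * k) - xlnx_int (2 * k - 1) - 2 * 2^-1 * (2 * k - 2^-1) * ln (2 * k - 2^-1)
    - 2^-1 ^+ 3 / (3 * (2 * k - 2^-1)) =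
  xlnx_int (2 * k) - xlnx_int (2 * k - 1) - 2 * k * ln (2 * k) + ln (2 * k) / 2 +
  (2 * k - 2^-1) * (ln (2 * k) - ln (2 * k - 2^-1)) - 2^-1 ^+ 3 / (3 * (2 * k - 2^-1)).
  by move: (_ / (3 * _)) => u; field.
rewrite GE in a1 a2; move: a1 a2 b1 b2 c2 q0 l2.
move: (2^-1 ^+ 3 / _) (_ / (2 * k - 2^-1) ^+ 3) ((2 * k - 2^-1) * (_ - _)) (2 * k * ln (2 * k)).
move: (ln (2 * k)) (xlnx_int _) (xlnx_int _); clear => l g g' u v w z a1 a2 /andP[b0 b1] b2 c2
  w0 l0.
by rewrite ler_norml; apply/andP; split; lra.
Qed.

Lemma asym_xlnx_int_first :
  asym (fun N => xlnx_int (2 * K N - 1)) (fun N => xlnx_int (2 * K N) - 2 * K N * ln (2 * K N)).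
Proof.
apply: (@asym_bounded (ln 3350 + 4)) => N Nl.
have m3 := large_m Nl; have /andP[Km _] := K_bounds Nl; have K1 := K_le Nl.
have l0 := ln_m_ge0 Nl.
have m2 : 1 <= m N ^+ 2 by rewrite exprn_ege1//; lra.
have c1 : 1 <= 3350 :> R by rewrite (ler_nat R 1 3350).
have l3 := ln_ge0 c1.
have lk : ln (2 * K N) <= ln 3350 + 2 * ln (m N).
  by apply: (ln_le_m Nl c1); move: (m N ^+ 2) m2 Km K1; clear => *; lra.
have k1 : 100 <= K N by move: (m N ^+ 2) m2 Km; clear => *; lra.
apply: le_trans (xlnx_int_first k1) _.
move: (ln (2 * K N)) (ln (m N)) (ln 3350) l0 l3 lk; clear => x y z l0 l3 lk.
have := mulr_ge0 l3 l0; lra.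
Qed.

End asymptotic_Q.

Section asymptotic_Q2.
Context {R : realType}.
Local Notation m N := ((diamond_m R N)%:R : R).
Local Notation M N := (diamond_M R N).
Local Notation r N j := ((diamond_r R N j)%:R : R).
Local Notation S N j := ((@diamond_S R N j).+1%:R : R).
Local Notation K N := (2 * N%:R - 1 : R).
Local Notation large := (@large R).

(** The cells tile [1, K - r_M] and their images [K + r_M, 2 K - 1], so the antiderivative
    telescopes on both sides and only the ends at the pole and at the equator remain to be
    estimated. *)
Lemma asym_Q :
  asym (fun N => @diamond_Q R N)
    (fun N => K N ^+ 2 / 2 * ln 2 - K N ^+ 2 / 4 - K N / 2 * ln 2 - midpoint_corr N).
Proof.
have [C HC] := @Q_term R.
apply: (@asym_trans _ (fun N => \sum_(1 <= j < M N)
   ((xlnx_int (cell_start N j.+1) - xlnx_int (cell_start N j)) / 4 + (xlnx_int (2 * K N -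
     cell_start N j) - xlnx_int (2 * K N - cell_start N j.+1)) / 4
    - r N j ^+ 3 / 12 * ((S N j)^-1 + (2 * K N - S N j)^-1) - r N j * (K N * ln (K N))))).
  apply: (@asym_sum R (fun=> 1%N) (fun N => M N) _ _ `|C|) => [//|N j Nl jM].
  apply: le_trans (HC N j Nl jM) _; have l0 := ln_m_ge0 Nl.
  apply: le_trans (ler_norm C) _; rewrite ler_peMr//; lra.
apply: (@asym_trans _ (fun N => ((xlnx_int (cell_start N (M N)) - xlnx_int (2 * K N - cell_start
  N (M N))) + (xlnx_int (2 * K N - 1) - xlnx_int 1)) / 4
   - midpoint_corr N - K N * ln (K N) * ((K N - 1 - r N (M N)) / 2))).
  apply: asym_eq => N Nl; have [N121 _] := andP Nl.
  rewrite !sumrB big_split /= -!mulr_suml.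
  rewrite telescope_sumr; last by have := M_gt0 Nl; lia.
  have -> : \sum_(1 <= j < M N) (xlnx_int (2 * K N - cell_start N j) - xlnx_int (2 * K N -
    cell_start N j.+1)) =
      - \sum_(1 <= j < M N) (xlnx_int (2 * K N - cell_start N j.+1) - xlnx_int (2 * K N -
        cell_start N j)).
    by rewrite -sumrN; apply: eq_bigr => j _; rewrite [RHS]opprB.
  rewrite (@telescope_sumr _ 1 (M N) (fun j => xlnx_int (2 * K N - cell_start N j))); last by
    have := M_gt0 Nl; lia.
  rewrite cell_start1//.
  have -> : \sum_(1 <= i < M N) r N i = (K N - 1 - r N (M N)) / 2.
    have := @twoN1E R N N121; rewrite (SE (R := R)); lra.
  rewrite /midpoint_corr; move: (bigop.body _ _ _) => s; ring.
apply: (@asym_trans _ (fun N => (- (2 * r N (M N) * K N * ln (K N)) +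
   (xlnx_int (2 * K N) - 2 * K N * ln (2 * K N) - xlnx_int 1)) / 4 - midpoint_corr N - K N * ln
     (K N) * ((K N - 1 - r N (M N)) / 2))).
  apply: asymB; last exact: asym_refl.
  apply: asymB; last exact: asym_refl.
  have h : asym (fun N => (xlnx_int (cell_start N (M N)) - xlnx_int (2 * K N - cell_start N (M
    N))) + (xlnx_int (2 * K N - 1) - xlnx_int 1))
     (fun N => - (2 * r N (M N) * K N * ln (K N)) + (xlnx_int (2 * K N) - 2 * K N * ln (2 * K N)
       - xlnx_int 1)).
    apply: asymD; first exact: asym_xlnx_int_last.
    by apply: asymB; [exact: asym_xlnx_int_first|exact: asym_refl].
  have := asymZ 4^-1 h; congr asym; apply/funext => N; exact: mulrC.
(* Once [xlnx_int (2 * K N)] is expanded, every term in ln K or r_M cancels and the difference is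
   the constant - [xlnx_int 1] / 4. *)
apply: (@asym_bounded R `|xlnx_int (1 : R)|) => N Nl.
have [N121 _] := andP Nl; have k0 := @twoN1_gt0 R N N121.
rewrite [X in `|X|](_ : _ = - (xlnx_int 1 / 4)).
  rewrite normrN normrM (ger0_norm (x := 4^-1))//.
  have l0 := ln_m_ge0 Nl; have := normr_ge0 (xlnx_int (1 : R)) => g0.
  have : `|xlnx_int 1| <= `|xlnx_int 1| * (1 + ln (m N)) by rewrite ler_peMr//; lra.
  lra.
rewrite /xlnx_int lnM ?posrE// ln1.
move: (ln 2) (ln (K N)) (K N) (midpoint_corr N) (r N (M N)) => a b c d e.
by field.
Qed.
End asymptotic_Q2.

(** * The second-order correction of the midpoint rule *)

Section asymptotic_T1.
Context {R : realType}.
Local Notation m N := ((diamond_m R N)%:R : R).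
Local Notation M N := (diamond_M R N).
Local Notation r N j := ((diamond_r R N j)%:R : R).
Local Notation S N j := ((@diamond_S R N j).+1%:R : R).
Local Notation K N := (2 * N%:R - 1 : R).
Local Notation large := (@large R).
Local Notation cell_start := (@cell_start R).

(* On each affine piece of r one has r_j ^ 2 = b S_j + al m ^ 2 + O(m),
   so that every term of midpoint_corr is close to a difference of logarithms,
   and the sum over the piece telescopes. *)
Lemma midpoint_corr_term_bound (b al D x s k y : R) : 0 <= b -> 0 <= al -> 0 <= D ->
  3 <= y -> 0 <= x -> x <= 267 * y -> x <= 6 / 7 * s -> 0 < s -> s <= k ->
  239 * y ^+ 2 <= k -> k <= 239 * y ^+ 2 + 1436 * y ->
  `|x * (x ^+ 2 - b * s - al * y ^+ 2)| <= D * s -> al * y ^+ 2 * (x / s) ^+ 3 <= D ->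
  `|x ^+ 3 / 12 * (s^-1 + (2 * k - s)^-1) -
    y ^+ 2 / 24 * (al * (ln (s + x) - ln (s - x)) -
      (478 * b + al) * (ln (2 * k - (s + x)) - ln (2 * k - (s - x))))|
  <= 1436 * b + D + 200 * b + al.
Proof.
move=> b0 al0 D0 y3 x0 xy xs s0 sk k1 k2 hD ha.
have t0 : 0 < 2 * k - s by lra.
have /andP[a1 a2] := @ln_midpoint R s x s0 ltac:(by rewrite x0).
have xt : 0 <= x <= 6 / 7 * (2 * k - s) by rewrite x0 /=; lra.
have /andP[b1 b2] := ln_midpoint t0 xt.
rewrite (_ : 2 * k - (s + x) = 2 * k - s - x); last by ring.
rewrite (_ : 2 * k - (s - x) = 2 * k - s + x); last by ring.
set p := x / s in a1 a2 ha; set q := x / (2 * k - s) in b1 b2.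
set th1 := ln (s + x) - ln (s - x) - 2 * p in a1 a2.
set th2 := ln (2 * k - s + x) - ln (2 * k - s - x) - 2 * q in b1 b2.
set de := x ^+ 2 - b * s - al * y ^+ 2 in hD.
have -> : ln (s + x) - ln (s - x) = 2 * p + th1 by rewrite /th1; ring.
have -> : ln (2 * k - s - x) - ln (2 * k - s + x) = - (2 * q + th2) by rewrite /th2; ring.
have -> : x ^+ 3 / 12 * (s^-1 + (2 * k - s)^-1) -
    y ^+ 2 / 24 * (al * (2 * p + th1) - (478 * b + al) * - (2 * q + th2)) =
  b * (k - 239 * y ^+ 2) * q / 6 + (de * p + de * q) / 12
   - (al * y ^+ 2 * th1 + (478 * b + al) * (y ^+ 2 * th2)) / 24.
  by rewrite /de /p /q; field; rewrite !gt_eqF.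
have y0 : 0 < y := lt_le_trans (ltr0n R 3) y3.
have q0 : 0 <= q by rewrite divr_ge0 ?(ltW t0).
have yq : q * y <= 2.
  rewrite /q mulrAC ler_pdivrMr//; apply: (@le_trans _ _ (267 * y * y)).
    by rewrite ler_wpM2r ?(ltW y0).
  by have := sqr_ge0 y; move: k1; rewrite !expr2; clear -sk; lra.
have h1 : 0 <= b * (k - 239 * y ^+ 2) * q <= b * 2872.
  have kd : 0 <= k - 239 * y ^+ 2 by rewrite subr_ge0.
  rewrite (mulr_ge0 (mulr_ge0 b0 kd) q0) /=.
  rewrite -mulrA ler_wpM2l//; apply: (@le_trans _ _ (1436 * y * q)).
    by rewrite ler_wpM2r// lerBlDl.
  by rewrite -mulrA (mulrC y); clear -yq; lra.
have h2 : `|de * p| <= D.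
  by rewrite /p mulrA normrM normfV (gtr0_norm s0) ler_pdivrMr// (mulrC de).
have h3 : `|de * q| <= D.
  rewrite /q mulrA normrM normfV (gtr0_norm t0) ler_pdivrMr// (mulrC de).
  by apply: le_trans hD _; rewrite ler_wpM2l//; clear -sk; lra.
have h4 : 0 <= al * y ^+ 2 * th1 <= 8 / 3 * D.
  have ay : 0 <= al * y ^+ 2 by rewrite mulr_ge0// sqr_ge0.
  rewrite mulr_ge0//=; apply: le_trans (ler_wpM2l ay a2) _.
  by rewrite mulrCA ler_wpM2l.
have h5 : 0 <= y ^+ 2 * th2 <= 8.
  rewrite mulr_ge0 ?sqr_ge0//=; apply: le_trans (ler_wpM2l (sqr_ge0 y) b2) _.
  rewrite (_ : y ^+ 2 * (8 / 3 * q ^+ 3) = 8 / 3 * ((q * y) ^+ 2 * q)); last by ring.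
  have qy0 : 0 <= q * y by rewrite mulr_ge0// ltW.
  have q1 : q <= 2 / 3.
    have : q * 3 <= 2 by apply: le_trans (ler_wpM2l q0 y3) yq.
    by clear; lra.
  have : (q * y) ^+ 2 <= 2 ^+ 2 by rewrite lerXn2r// nnegrE.
  by move=> h; have := ler_pM (sqr_ge0 (q * y)) q0 h q1; clear; lra.
have /andP[h5a h5b] := h5.
have h6 : 0 <= (478 * b + al) * (y ^+ 2 * th2) <= (478 * b + al) * 8.
  have c0 : 0 <= 478 * b + al := addr_ge0 (mulr_ge0 (ler0n R 478) b0) al0.
  by rewrite mulr_ge0//= ler_wpM2l.
move: h1 h2 h3 h4 h6 b0 al0 D0.
move: (b * (k - _) * q) (de * p) (de * q) (al * y ^+ 2 * th1) (_ * (y ^+ 2 * th2)).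
clear.
move=> u1 u2 u3 u4 u5 /andP[h1 h1'] /ler_normlP[h2 h2'] /ler_normlP[h3 h3'] /andP[h4 h4']
  /andP[h5 h5'] b0 al0 D0.
by rewrite ler_norml; apply/andP; split; lra.
Qed.


(** As K = 239 m^2 + O(m), an identity r^2 = b S + al m^2 reads r^2 = (478 b + al) m^2 - b (2 K - S)
    + O(m) in terms of the mirror image; hence the second coefficient. In r^3 (1 / S + 1 / (2 K -
    S)) the two terms b r then cancel. *)
Definition midpoint_corr_piece (b al : R) (N j : nat) : R := m N ^+ 2 / 24 *
  (al * (ln (cell_start N j.+1) - ln (cell_start N j)) -
   (478 * b + al) * (ln (2 * K N - cell_start N j.+1) - ln (2 * K N - cell_start N j))).

Lemma asym_midpoint_corr_piece (b al D : R) (a c : nat -> nat) : 0 <= b -> 0 <= al -> 0 <= D ->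
  (forall N, large N -> (0 < a N)%N /\ (c N <= M N)%N) ->
  (forall N j, large N -> (a N <= j < c N)%N ->
    `|r N j * (r N j ^+ 2 - b * S N j - al * m N ^+ 2)| <= D * S N j /\
     al * m N ^+ 2 * (r N j / S N j) ^+ 3 <= D) ->
  asym (fun N => \sum_(a N <= j < c N) r N j ^+ 3 / 12 * ((S N j)^-1 + (2 * K N - S N j)^-1))
       (fun N => \sum_(a N <= j < c N) midpoint_corr_piece b al N j).
Proof.
move=> b0 al0 D0 acM H.
apply: (@asym_sum R a c _ _ (1436 * b + D + 200 * b + al)).
  by move=> N Nl; have [_] := acM N Nl.
move=> N j Nl jac; have [a0 cM] := acM N Nl.
have jM : (0 < j <= M N)%N by lia.
have j0 : (0 < j)%N by lia.
have m3 := large_m Nl; have /andP[k1 k2] := K_bounds Nl; have /andP[_ sk] := S_bounds Nl jM.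
have [_ _ r267] := r_bounds Nl jM; have /andP[r0 rS] := r_le_S Nl jM.
have [h1 h2] := H N j Nl jac; have l0 := ln_m_ge0 Nl.
have s0 : 0 < S N j by rewrite ltr0n.
have := midpoint_corr_term_bound b0 al0 D0 m3 r0 r267 rS s0 sk k1 k2 h1 h2.
rewrite /midpoint_corr_piece (cell_start_succ Nl j0) => h.
apply: le_trans h _; rewrite ler_peMr; [by []| |by rewrite lerDl].
have c1 : 0 <= 1436 * b := mulr_ge0 (ler0n R 1436) b0.
have c2 : 0 <= 200 * b := mulr_ge0 (ler0n R 200) b0.
by rewrite !addr_ge0.
Qed.

Lemma sum_midpoint_corr_piece (b al : R) N (a c : nat) : (a <= c)%N ->
  \sum_(a <= j < c) midpoint_corr_piece b al N j = m N ^+ 2 / 24 *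
  (al * (ln (cell_start N c) - ln (cell_start N a)) -
   (478 * b + al) * (ln (2 * K N - cell_start N c) - ln (2 * K N - cell_start N a))).
Proof.
move=> ac; rewrite -mulr_sumr sumrB -!mulr_sumr telescope_sumr//.
by rewrite (telescope_sumr (fun j => ln (2 * K N - cell_start N j))).
Qed.

(** The factor m^2 is harmless: on arguments above c m^2 the logarithm is Lipschitz with constant 1
    / (c m^2), so a perturbation O(m) of the argument costs O(m). *)
Lemma asym_ln (f : nat -> R) (p c C : R) : 0 < c -> c <= p ->
  (forall N, large N -> c * m N ^+ 2 <= f N) ->
  (forall N, large N -> `|f N - p * m N ^+ 2| <= C * m N) ->
  asym (fun N => m N ^+ 2 * ln (f N)) (fun N => m N ^+ 2 * (ln p + 2 * ln (m N))).
Proof.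
move=> c0 cp fc fp; apply: (@asym_m R (C / c)) => N Nl.
have m3 := large_m Nl; have m0 : 0 < m N by lra.
have p0 : 0 < p by lra.
have m2 : 0 < m N ^+ 2 by rewrite exprn_gt0.
rewrite [2 * _]mulr_natl -lnXn// -lnM ?posrE// -mulrBr normrM (gtr0_norm m2).
have h := @ln_lip R (c * m N ^+ 2) (f N) (p * m N ^+ 2) (mulr_gt0 c0 m2) (fc N Nl) _.
apply: le_trans (ler_wpM2l (ltW m2) (h _)) _; first by rewrite ler_pM2r.
rewrite (_ : m N ^+ 2 * _ = `|f N - p * m N ^+ 2| / c); last by field; rewrite !gt_eqF.
by rewrite mulrAC ler_pM2r ?invr_gt0// fp.
Qed.

Lemma cell_start_end N X p rho : large N ->
  (@diamond_S R N X = p * diamond_m R N ^ 2)%N -> diamond_r R N X = (rho * diamond_m R N)%N ->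
  (0 < X)%N -> cell_start N X.+1 = p%:R * m N ^+ 2 + rho%:R * m N + 1.
Proof.
move=> Nl Sp rp X0; rewrite (cell_start_succ Nl X0) Sp rp -natr1 !natrM expr2; ring.
Qed.

Lemma asym_ln_cell_start (X : nat -> nat) p rho : (24 <= p)%N ->
  (forall N, large N -> (@diamond_S R N (X N) = p * diamond_m R N ^ 2)%N /\
    diamond_r R N (X N) = (rho * diamond_m R N)%N /\ (0 < X N)%N) ->
  asym (fun N => m N ^+ 2 * ln (cell_start N (X N).+1)) (fun N => m N ^+ 2 * (ln p%:R + 2 * ln
    (m N))).
Proof.
move=> p24 H; apply: (@asym_ln _ p%:R p%:R (rho%:R + 1)) => //.
- by rewrite ltr0n; lia.
- move=> N Nl; have [Sp [rp X0]] := H N Nl; rewrite (cell_start_end Nl Sp rp X0) -addrA lerDl.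
  by rewrite addr_ge0// mulr_ge0.
- move=> N Nl; have [Sp [rp X0]] := H N Nl; rewrite (cell_start_end Nl Sp rp X0).
  have m3 := large_m Nl; rewrite -(addrA (p%:R * _)) (addrC (p%:R * _)) addrK ger0_norm.
    by rewrite mulrDl mul1r lerD2l; lra.
  by rewrite addr_ge0// mulr_ge0.
Qed.

Lemma asym_ln_Kcell_start (X : nat -> nat) p rho : (p <= 238)%N ->
  (forall N, large N -> (@diamond_S R N (X N) = p * diamond_m R N ^ 2)%N /\
    diamond_r R N (X N) = (rho * diamond_m R N)%N /\ (0 < X N < M N)%N) ->
  asym (fun N => m N ^+ 2 * ln (2 * K N - cell_start N (X N).+1))
       (fun N => m N ^+ 2 * (ln (478 - p%:R) + 2 * ln (m N))).
Proof.
move=> p238 H; apply: (@asym_ln _ (478 - p%:R) 239 (2872 + rho%:R + 1)).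
- exact: (ltr0n R 239).
- by have : p%:R <= 238%:R :> R; [rewrite ler_nat|lra].
- move=> N Nl; have [Sp [rp /andP[X0 XM]]] := H N Nl.
  have /andP[k1 _] := K_bounds Nl.
  have XM1 : (0 < (X N).+1 <= M N)%N by rewrite XM.
  have /andP[_ s1] := S_bounds Nl XM1; have /andP[r0 _] := r_le_S Nl XM1.
  have : cell_start N (X N).+1 <= K N by apply: le_trans s1; rewrite /cell_start gerBl.
  lra.
- move=> N Nl; have [Sp [rp /andP[X0 XM]]] := H N Nl; rewrite (cell_start_end Nl Sp rp X0).
  have m3 := large_m Nl; have /andP[k1 k2] := K_bounds Nl.
  have h : 0 <= rho%:R * m N by rewrite mulr_ge0.
  have -> : (2872 + rho%:R + 1) * m N = 2872 * m N + rho%:R * m N + m N by ring.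
  have -> : 2 * K N - (p%:R * m N ^+ 2 + rho%:R * m N + 1) - (478 - p%:R) * m N ^+ 2 =
    2 * (K N - 239 * m N ^+ 2) - rho%:R * m N - 1 by ring.
  have k1' : 0 <= K N - 239 * m N ^+ 2 by rewrite subr_ge0.
  have k2' : K N - 239 * m N ^+ 2 <= 1436 * m N by rewrite lerBlDl.
  move: (K N - 239 * m N ^+ 2) (rho%:R * m N) (m N) h k1' k2' m3 => u v w h k1' k2' m3.
  clear - h k1' k2' m3; rewrite ler_norml; apply/andP; split; lra.
Qed.

Lemma asym_ln_cell_start_last :
  asym (fun N => m N ^+ 2 * ln (cell_start N (M N))) (fun N => m N ^+ 2 * (ln 239 + 2 * ln (m N))).
Proof.
have p239 : 0 < 239 :> R := ltr0n R 239.
(* The lower constant 239 / 7 comes from r_M <= 6 K / 7, which leaves K - r_M >= K / 7. *)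
apply: (@asym_ln _ 239 (239 / 7) (1436 + 267)); rewrite ?divr_gt0//.
- by rewrite ler_pdivrMr//; lra.
- move=> N Nl; have MM : (0 < M N <= M N)%N by rewrite leqnn andbT; have := M_gt0 Nl; lia.
  have [N121 _] := andP Nl.
  have /andP[k1 _] := K_bounds Nl; have /andP[r0 rS] := r_le_S Nl MM.
  rewrite (cell_start_last Nl); rewrite -(twoN1E (R := R) N121) in rS.
  by move: (r N (M N)) (K N) (m N ^+ 2) k1 rS => *; lra.
- move=> N Nl; have MM : (0 < M N <= M N)%N by rewrite leqnn andbT; have := M_gt0 Nl; lia.
  have /andP[k1 k2] := K_bounds Nl; have [_ _ r267] := r_bounds Nl MM; have /andP[r0 _] :=
    r_le_S Nl MM.
  rewrite (cell_start_last Nl) (mulrDl 1436); have m3 := large_m Nl.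
  move: (r N (M N)) (K N) (m N) (m N ^+ 2) k1 k2 r0 r267 m3 => x k y y2 k1 k2 r0 r267 m3.
  clear - k1 k2 r0 r267 m3; rewrite ler_norml; apply/andP; split; lra.
Qed.

Lemma asym_ln_Kcell_start_last :
  asym (fun N => m N ^+ 2 * ln (2 * K N - cell_start N (M N)))
       (fun N => m N ^+ 2 * (ln 239 + 2 * ln (m N))).
Proof.
apply: (@asym_ln _ 239 239 (1436 + 267)).
- exact: (ltr0n R 239).
- exact: lexx.
- move=> N Nl; have MM : (0 < M N <= M N)%N by rewrite leqnn andbT; have := M_gt0 Nl; lia.
  have /andP[k1 _] := K_bounds Nl; have /andP[r0 _] := r_le_S Nl MM.
  rewrite (cell_start_last Nl); move: (r N (M N)) (K N) (m N ^+ 2) k1 r0 => *; lra.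
- move=> N Nl; have MM : (0 < M N <= M N)%N by rewrite leqnn andbT; have := M_gt0 Nl; lia.
  have /andP[k1 k2] := K_bounds Nl; have [_ _ r267] := r_bounds Nl MM; have /andP[r0 _] :=
    r_le_S Nl MM.
  rewrite (cell_start_last Nl) (mulrDl 1436); have m3 := large_m Nl.
  move: (r N (M N)) (K N) (m N) (m N ^+ 2) k1 k2 r0 r267 m3 => x k y y2 k1 k2 r0 r267 m3.
  clear - k1 k2 r0 r267 m3; rewrite ler_norml; apply/andP; split; lra.
Qed.

Lemma asym_ln_K1 :
  asym (fun N => m N ^+ 2 * ln (2 * K N - 1)) (fun N => m N ^+ 2 * (ln 478 + 2 * ln (m N))).
Proof.
apply: (@asym_ln _ 478 239 (2872 + 1)).
- exact: (ltr0n R 239).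
- lra.
- move=> N Nl; have /andP[k1 _] := K_bounds Nl; have m3 := large_m Nl.
  have m2 : 1 <= m N ^+ 2 by rewrite exprn_ege1//; lra.
  by move: (K N) (m N ^+ 2) k1 m2 => *; lra.
- move=> N Nl; have /andP[k1 k2] := K_bounds Nl; have m3 := large_m Nl.
  rewrite (mulrDl 2872); move: (K N) (m N) (m N ^+ 2) k1 k2 m3 => k y y2 k1 k2 m3.
  clear - k1 k2 m3; rewrite ler_norml; apply/andP; split; lra.
Qed.
End asymptotic_T1.

Section asymptotic_T1_sum.
Context {R : realType}.
Local Notation m N := ((diamond_m R N)%:R : R).
Local Notation M N := (diamond_M R N).
Local Notation r N j := ((diamond_r R N j)%:R : R).
Local Notation S N j := ((@diamond_S R N j).+1%:R : R).
Local Notation K N := (2 * N%:R - 1 : R).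
Local Notation large := (@large R).
Local Notation cell_start := (@cell_start R).

(** Beyond the first piece r m / S <= 267 / 24 < 12, hence r / S <= 4 since m >= 3, and 12^2 * 4 =
    576. *)
Lemma ratio_cube_le (al : R) N j : large N -> (2 * diamond_m R N < j <= M N)%N -> 0 <= al ->
  al * m N ^+ 2 * (r N j / S N j) ^+ 3 <= 576 * al.
Proof.
move=> Nl jM al0; have jM1 : (0 < j <= M N)%N by lia.
have jM2 : (2 * diamond_m R N <= j <= M N)%N by lia.
have m3 := large_m Nl; have := S_large Nl jM2; have [_ _ r267] := r_bounds Nl jM1.
have /andP[r0 _] := r_le_S Nl jM1; move: (r N j) (S N j) (m N) r0 r267 m3 => x s y x0 xy y3 sy.
have y0 : 0 < y by lra.
have s0 : 0 < s by apply: lt_le_trans sy; apply: mulr_gt0; [exact: (ltr0n R 24)|exact: exprn_gt0].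
have xs : x / s * y <= 12.
  rewrite mulrAC ler_pdivrMr//; apply: (@le_trans _ _ (267 * y * y)).
    by rewrite ler_wpM2r// ltW.
  apply: (@le_trans _ _ (12 * (24 * y ^+ 2))); last by rewrite ler_wpM2l.
  by have := sqr_ge0 y; clear; rewrite expr2; lra.
have q0 : 0 <= x / s by rewrite divr_ge0// ltW.
move: (x / s) xs q0 => q xs q0.
rewrite (mulrC 576) -mulrA ler_wpM2l//.
have -> : y ^+ 2 * q ^+ 3 = (q * y) ^+ 2 * q by ring.
have q4 : q <= 4.
  have : q * 3 <= 12 by apply: le_trans (ler_wpM2l q0 y3) xs.
  clear; lra.
have qy0 : 0 <= q * y by rewrite mulr_ge0// ltW.
have : (q * y) ^+ 2 <= 12 ^+ 2 by rewrite lerXn2r// nnegrE.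
move=> h; have := ler_pM (sqr_ge0 (q * y)) q0 h q4; clear; lra.
Qed.

Lemma natr_quadratic (a b f w s x j : nat) :
  (s + f * x ^ 2 = 2 * a * x * j + b * j ^ 2 + w)%N ->
  s%:R = 2 * a%:R * x%:R * j%:R + b%:R * j%:R ^+ 2 + w%:R - f%:R * x%:R ^+ 2 :> R.
Proof.
by move=> /(congr1 (fun n => n%:R : R)); rewrite !natrD !natrM !expr2 => <-; rewrite addrK.
Qed.

(** Expanding (a m + b j)^2 shows that r_j^2 - b S_j - al m^2 is the constant - b; it is not 0
    because [S] is the successor of [diamond_S]. *)
Lemma linear_piece (a b f al : nat) (x y : nat -> nat) :
  (al = a ^ 2 + b * f)%N ->
  (forall N, large N -> (2 * diamond_m R N <= x N <= y N)%N /\ (y N < M N)%N) ->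
  (forall N j, large N -> (x N <= j <= y N)%N -> diamond_r R N j = (a * diamond_m R N + b * j)%N) ->
  (forall N j, large N -> (x N <= j <= y N)%N ->
     (@diamond_S R N j + f * diamond_m R N ^ 2 = 2 * a * diamond_m R N * j + b * j ^ 2)%N) ->
  asym (fun N => \sum_((x N).+1 <= j < (y N).+1) r N j ^+ 3 / 12 * ((S N j)^-1 + (2 * K N - S N
    j)^-1))
       (fun N => \sum_((x N).+1 <= j < (y N).+1) midpoint_corr_piece b%:R al%:R N j).
Proof.
move=> alE xy rE SE.
apply: (@asym_midpoint_corr_piece R b%:R al%:R (b%:R + 576 * al%:R)).
- exact: ler0n.
- exact: ler0n.
- exact: (addr_ge0 (ler0n R b) (mulr_ge0 (ler0n R 576) (ler0n R al))).
- by move=> N Nl; have [h1 h2] := xy N Nl; split; lia.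
move=> N j Nl jxy; have [h1 h2] := xy N Nl.
have jM : (0 < j <= M N)%N by lia.
have jM2 : (2 * diamond_m R N < j <= M N)%N by lia.
have jxy' : (x N <= j <= y N)%N by lia.
have c0 : 0 <= 576 * al%:R :> R := mulr_ge0 (ler0n R 576) (ler0n _ _).
split; last by apply: le_trans (ratio_cube_le Nl jM2 (ler0n R al)) _; rewrite lerDr.
have /andP[r0 rS] := r_le_S Nl jM.
have -> : r N j ^+ 2 - b%:R * S N j - al%:R * m N ^+ 2 = - b%:R.
  have := SE N j Nl jxy'; rewrite -[X in _ = X]addn0 => /natr_quadratic h.
  by rewrite -[S N j]natr1 h rE// alE natrD natrD !natrM expr2; ring.
rewrite mulrN normrN ger0_norm ?mulr_ge0// mulrC.
have s0 : 0 <= S N j by exact: ler0n.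
apply: (@le_trans _ _ (b%:R * S N j)); last by rewrite ler_wpM2r// lerDl.
by rewrite ler_wpM2l//; apply: le_trans rS _; rewrite ler_piMl//; lra.
Qed.

(** With r_j = 6 j the coefficient [al] is 0. Near the pole, where S_j is not of order m^2, only the
    logarithms of the mirror images remain. *)
Lemma first_piece :
  asym (fun N => \sum_(1 <= j < (2 * diamond_m R N).+1) r N j ^+ 3 / 12 * ((S N j)^-1 + (2 * K N
    - S N j)^-1))
       (fun N => \sum_(1 <= j < (2 * diamond_m R N).+1) midpoint_corr_piece 6 0 N j).
Proof.
apply: (@asym_midpoint_corr_piece R 6 0 6 (fun=> 1%N)) => //.
  by move=> N Nl; split=> //; have := M_gt0 Nl; rewrite /diamond_M; lia.
move=> N j Nl jm; have [N121 _] := andP Nl; have jm1 : (0 < j <= 2 * diamond_m R N)%N by lia.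
have jM : (0 < j <= M N)%N by rewrite /diamond_M; lia.
have jm2 : (j <= 2 * diamond_m R N)%N by lia.
rewrite !mul0r; split; last by exact: ler0n.
have /andP[r0 rS] := r_le_S Nl jM; have s0 : 0 <= S N j by exact: ler0n.
have -> : r N j ^+ 2 - 6 * S N j - 0 = - 6.
  rewrite -[S N j]natr1 (diamond_S1 N121 jm1) (diamond_r1 jm2) !natrM; ring.
rewrite mulrN normrN ger0_norm; last by rewrite mulr_ge0.
by move: (r N j) (S N j) rS s0 => *; lra.
Qed.

Lemma last_piece_nat N j : large N -> ((6 * diamond_m R N).+1 <= j < M N)%N ->
  exists u w : nat, [/\ diamond_r R N j = (20 * diamond_m R N + j + u)%N, (u <= 720)%N,
   (@diamond_S R N j + 90 * diamond_m R N ^ 2 = 2 * 20 * diamond_m R N * j + 1 * j ^ 2 + w)%N,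
   (w <= 2 * 720 * diamond_m R N)%N & (j <= 7 * diamond_m R N)%N].
Proof.
move=> Nl jm; have [N121 _] := andP Nl.
have jM6 : (6 * diamond_m R N < j <= 7 * diamond_m R N)%N by rewrite /diamond_M in jm; lia.
have jM6' : (6 * diamond_m R N <= j <= 7 * diamond_m R N)%N by lia.
exists (diamond_r R N j - (20 * diamond_m R N + j))%N.
exists (@diamond_S R N j + 90 * diamond_m R N ^ 2 - (40 * diamond_m R N * j + j ^ 2))%N.
have := diamond_r6 N121 jM6.
have : (1440 * (j - 6 * diamond_m R N) <= 1440 * diamond_m R N)%N by rewrite leq_mul2l; lia.
by have := diamond_S6 N121 jM6'; split; lia.
Qed.

Lemma last_piece_bound (c x y z t : R) : 0 <= x <= c -> 0 <= y <= 2 * c * t -> 0 <= z <= 7 * t ->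
  1 <= t -> `|2 * x * (20 * t + z) + x * x - 1 - y| <= (2 * c * 27 + c * c + 2 * c + 1) * t.
Proof.
move=> /andP[x0 xc] /andP[y0 yc] /andP[z0 zc] t1.
have t0 : 0 <= t by lra.
have c0 : 0 <= c by apply: le_trans xc.
have h1a : 0 <= 20 * t + z by lra.
have h1b : 20 * t + z <= 27 * t by lra.
have h2a : 0 <= x * (20 * t + z) by exact: mulr_ge0.
have h2b : x * (20 * t + z) <= c * (27 * t) by exact: ler_pM.
have h3a : 0 <= x * x by exact: mulr_ge0.
have h3b : x * x <= c * c by exact: ler_pM.
have h4 : c * c <= c * c * t by rewrite ler_peMr ?mulr_ge0.
have h5 : 0 <= c * t by exact: mulr_ge0.
have -> : (2 * c * 27 + c * c + 2 * c + 1) * t = 2 * (c * (27 * t)) + c * c * t + 2 * c * t + t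
  by ring.
rewrite -(mulrA 2 x).
move: (x * (20 * t + z)) (x * x) (c * (27 * t)) (c * c) (c * c * t) h2a h2b h3a h3b h4 => *.
by rewrite ler_norml; apply/andP; split; lra.
Qed.

(** The left-over points make r_j^2 - S_j - 490 m^2 of order m instead of constant. As r_j = O(m)
    and S_j >= 24 m^2, its product with r_j is still O(S_j). *)
Lemma last_piece :
  asym (fun N => \sum_((6 * diamond_m R N).+1 <= j < M N) r N j ^+ 3 / 12 * ((S N j)^-1 + (2 * K
    N - S N j)^-1))
       (fun N => \sum_((6 * diamond_m R N).+1 <= j < M N) midpoint_corr_piece 1 490 N j).
Proof.
pose d (c : R) : R := 2 * c * 27 + c * c + 2 * c + 1.
have d0 : 0 <= d 720.
  by rewrite /d; move: (720 : R) (ler0n R 720) => c c0; rewrite !addr_ge0 ?mulr_ge0.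
have d1 : 0 <= 576 * 490 :> R := mulr_ge0 (ler0n R 576) (ler0n R 490).
have d2 : 0 <= 267 * d 720 := mulr_ge0 (ler0n R 267) d0.
apply: (@asym_midpoint_corr_piece R 1 490 (576 * 490 + 267 * d 720)).
- exact: ler01.
- exact: (ler0n R 490).
- exact: addr_ge0.
- by move=> N Nl; split.
move=> N j Nl jm.
have [u [w [rE u720 SE w1440 j7]]] := last_piece_nat Nl jm.
move: u720 w1440 j7; rewrite -!(ler_nat R) => u720 w1440 j7.
have [jM [jM2 jM3]] : (0 < j <= M N)%N /\ (2 * diamond_m R N < j <= M N)%N /\ (2 * diamond_m R N
  <= j <= M N)%N.
  by clear -jm; lia.
split; last by apply: le_trans (ratio_cube_le Nl jM2 (ler0n R 490)) _; rewrite lerDl.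
have := S_large Nl jM3; have [_ _ r267] := r_bounds Nl jM; have /andP[r0 _] := r_le_S Nl jM.
have m3 := large_m Nl.
have -> : r N j ^+ 2 - 1 * S N j - 490 * m N ^+ 2 = 2 * u%:R * (20 * m N + j%:R) + u%:R * u%:R -
  1 - w%:R.
  by rewrite rE -[S N j]natr1 (natr_quadratic SE) natrD natrD natrM; ring.
have hd : `|2 * u%:R * (20 * m N + j%:R) + u%:R * u%:R - 1 - w%:R| <= d 720 * m N.
  apply: last_piece_bound; rewrite ?ler0n//=.
  - by move: w1440; rewrite natrM natrM.
  - by move: j7; rewrite natrM.
  - by apply: le_trans m3; rewrite (ler_nat R 1 3).
move=> s24; rewrite normrM (ger0_norm r0).
move: (d 720) d0 d2 hd {d1} => e e0 e2 hd.
apply: (@le_trans _ _ (267 * m N * (e * m N))); first by rewrite ler_pM.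
have -> : 267 * m N * (e * m N) = 267 * e * m N ^+ 2 by ring.
have ms : m N ^+ 2 <= S N j.
  by apply: le_trans s24; rewrite ler_peMl ?sqr_ge0// (ler_nat R 1 24).
apply: (@le_trans _ _ (267 * e * S N j)); first by rewrite ler_wpM2l.
by rewrite ler_wpM2r// lerDr (mulr_ge0 (ler0n R 576) (ler0n R 490)).
Qed.

Lemma asym_piece_ends (b al : R) (a c : nat -> nat) u v w z :
  (forall N, large N -> (a N <= c N)%N) ->
  asym (fun N => m N ^+ 2 * ln (cell_start N (c N))) u -> asym (fun N => m N ^+ 2 * ln
    (cell_start N (a N))) v ->
  asym (fun N => m N ^+ 2 * ln (2 * K N - cell_start N (c N))) w ->
  asym (fun N => m N ^+ 2 * ln (2 * K N - cell_start N (a N))) z ->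
  asym (fun N => \sum_(a N <= j < c N) midpoint_corr_piece b al N j)
       (fun N => 24^-1 * (al * (u N - v N) - (478 * b + al) * (w N - z N))).
Proof.
move=> ac hu hv hw hz.
apply: (@asym_trans R (fun N => 24^-1 * (al * (m N ^+ 2 * ln (cell_start N (c N)) - m N ^+ 2 *
  ln (cell_start N (a N)))
  - (478 * b + al) * (m N ^+ 2 * ln (2 * K N - cell_start N (c N)) - m N ^+ 2 * ln (2 * K N -
    cell_start N (a N)))))).
  by apply: asym_eq => N Nl; rewrite sum_midpoint_corr_piece ?ac//; ring.
by apply/asymZ/asymB; apply/asymZ/asymB.
Qed.
End asymptotic_T1_sum.

Section asymptotic_T1_end.
Context {R : realType}.
Local Notation m N := ((diamond_m R N)%:R : R).
Local Notation M N := (diamond_M R N).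
Local Notation K N := (2 * N%:R - 1 : R).
Local Notation large := (@large R).
Local Notation cell_start := (@cell_start R).

(** One line per affine piece of r. The numbers 24, 53, 91, 136, 186, 239 in the logarithms are the
    limits of S / m^2 at j = 2 m, ..., 7 m, and 454, ..., 239 are their complements to 478. The
    factors 24, 77, 168, 304, 490 are the values of a^2 + b f; on the first piece this value is
    0. *)
Definition midpoint_const : R := 24^-1 * (
  - (478 * 6 * (ln 454 - ln 478))
  + (24 * (ln 53 - ln 24) - (478 * 5 + 24) * (ln 425 - ln 454))
  + (77 * (ln 91 - ln 53) - (478 * 4 + 77) * (ln 387 - ln 425))
  + (168 * (ln 136 - ln 91) - (478 * 3 + 168) * (ln 342 - ln 387))
  + (304 * (ln 186 - ln 136) - (478 * 2 + 304) * (ln 292 - ln 342))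
  + (490 * (ln 239 - ln 186) - (478 * 1 + 490) * (ln 239 - ln 292))).

Lemma breakpoints N : large N ->
  [/\ @diamond_S R N (2 * diamond_m R N) = (24 * diamond_m R N ^ 2)%N,
      @diamond_S R N (3 * diamond_m R N) = (53 * diamond_m R N ^ 2)%N,
      @diamond_S R N (4 * diamond_m R N) = (91 * diamond_m R N ^ 2)%N,
      @diamond_S R N (5 * diamond_m R N) = (136 * diamond_m R N ^ 2)%N &
      @diamond_S R N (6 * diamond_m R N) = (186 * diamond_m R N ^ 2)%N].
Proof.
move=> Nl; have [N121 _] := andP Nl; have m0 := @diamond_m_gt0 R N N121.
have h1 := @diamond_S1 R N N121 (2 * diamond_m R N).
have h2 := @diamond_S2 R N N121 (3 * diamond_m R N).
have h3 := @diamond_S3 R N N121 (4 * diamond_m R N).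
have h4 := @diamond_S4 R N N121 (5 * diamond_m R N).
have h5 := @diamond_S5 R N N121 (6 * diamond_m R N).
by split; [clear -h1 m0|clear -h2 m0|clear -h3 m0|clear -h4 m0|clear -h5 m0]; lia.
Qed.

Lemma breakpoint_bounds N k : large N -> (0 < k < 7)%N -> (0 < k * diamond_m R N < M N)%N.
Proof.
move=> Nl k7; have [N121 _] := andP Nl; have m0 := @diamond_m_gt0 R N N121.
by rewrite /diamond_M muln_gt0 m0 andbT ltn_mul2r m0; lia.
Qed.

Lemma asym_break (k p rho : nat) : (0 < k < 7)%N -> (24 <= p <= 238)%N ->
  (forall N, large N -> @diamond_S R N (k * diamond_m R N) = (p * diamond_m R N ^ 2)%N /\
    diamond_r R N (k * diamond_m R N) = (rho * diamond_m R N)%N) ->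
  asym (fun N => m N ^+ 2 * ln (cell_start N (k * diamond_m R N).+1)) (fun N => m N ^+ 2 * (ln
    p%:R + 2 * ln (m N))) /\
  asym (fun N => m N ^+ 2 * ln (2 * K N - cell_start N (k * diamond_m R N).+1))
       (fun N => m N ^+ 2 * (ln (478 - p%:R) + 2 * ln (m N))).
Proof.
move=> k7 /andP[p24 p238] H; split.
  apply: (@asym_ln_cell_start R (fun N => k * diamond_m R N)%N p rho) => // N Nl.
  by have [h1 h2] := H N Nl; have /andP[] := breakpoint_bounds Nl k7.
apply: (@asym_ln_Kcell_start R (fun N => k * diamond_m R N)%N p rho) => // N Nl.
by have [h1 h2] := H N Nl; have := breakpoint_bounds Nl k7.
Qed.

(** Only differences of logarithms occur within a piece, so the terms 2 ln m cancel. The logarithm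
    at the pole, where [cell_start N 1] is 1, has no such term, but there [al] is 0. *)
Lemma asym_midpoint_corr : asym (@midpoint_corr R) (fun N => m N ^+ 2 * midpoint_const).
Proof.
have n478 (p q : nat) : (p + q = 478)%N -> 478 - p%:R = q%:R :> R.
  by move=> /(congr1 (fun n => n%:R : R)); rewrite natrD => <-; rewrite addrAC subrr add0r.
have [a2 b2] : asym (fun N => m N ^+ 2 * ln (cell_start N (2 * diamond_m R N).+1)) (fun N => m N
  ^+ 2 * (ln 24%:R + 2 * ln (m N))) /\
  asym (fun N => m N ^+ 2 * ln (2 * K N - cell_start N (2 * diamond_m R N).+1))
       (fun N => m N ^+ 2 * (ln (478 - 24%:R) + 2 * ln (m N))).
  apply: (@asym_break 2 24 12) => // N Nl; have [h _ _ _ _] := breakpoints Nl; split => //.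
  by have [N121 _] := andP Nl; rewrite diamond_r1; lia.
have [a3 b3] : asym (fun N => m N ^+ 2 * ln (cell_start N (3 * diamond_m R N).+1)) (fun N => m N
  ^+ 2 * (ln 53%:R + 2 * ln (m N))) /\
  asym (fun N => m N ^+ 2 * ln (2 * K N - cell_start N (3 * diamond_m R N).+1))
       (fun N => m N ^+ 2 * (ln (478 - 53%:R) + 2 * ln (m N))).
  apply: (@asym_break 3 53 17) => // N Nl; have [_ h _ _ _] := breakpoints Nl; split => //.
  by have [N121 _] := andP Nl; rewrite diamond_r2; lia.
have [a4 b4] : asym (fun N => m N ^+ 2 * ln (cell_start N (4 * diamond_m R N).+1)) (fun N => m N
  ^+ 2 * (ln 91%:R + 2 * ln (m N))) /\
  asym (fun N => m N ^+ 2 * ln (2 * K N - cell_start N (4 * diamond_m R N).+1))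
       (fun N => m N ^+ 2 * (ln (478 - 91%:R) + 2 * ln (m N))).
  apply: (@asym_break 4 91 21) => // N Nl; have [_ _ h _ _] := breakpoints Nl; split => //.
  by have [N121 _] := andP Nl; rewrite diamond_r3; lia.
have [a5 b5] : asym (fun N => m N ^+ 2 * ln (cell_start N (5 * diamond_m R N).+1)) (fun N => m N
  ^+ 2 * (ln 136%:R + 2 * ln (m N))) /\
  asym (fun N => m N ^+ 2 * ln (2 * K N - cell_start N (5 * diamond_m R N).+1))
       (fun N => m N ^+ 2 * (ln (478 - 136%:R) + 2 * ln (m N))).
  apply: (@asym_break 5 136 24) => // N Nl; have [_ _ _ h _] := breakpoints Nl; split => //.
  by have [N121 _] := andP Nl; rewrite diamond_r4; lia.
have [a6 b6] : asym (fun N => m N ^+ 2 * ln (cell_start N (6 * diamond_m R N).+1)) (fun N => m N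
  ^+ 2 * (ln 186%:R + 2 * ln (m N))) /\
  asym (fun N => m N ^+ 2 * ln (2 * K N - cell_start N (6 * diamond_m R N).+1))
       (fun N => m N ^+ 2 * (ln (478 - 186%:R) + 2 * ln (m N))).
  apply: (@asym_break 6 186 26) => // N Nl; have [_ _ _ _ h] := breakpoints Nl; split => //.
  by have [N121 _] := andP Nl; rewrite diamond_r5; lia.
have a7 := @asym_ln_cell_start_last R; have b7 := @asym_ln_Kcell_start_last R.
have a1 : asym (fun N => m N ^+ 2 * ln (cell_start N 1)) (fun=> 0).
  by apply: asym_eq => N Nl; rewrite cell_start1// ln1 mulr0.
have b1 : asym (fun N => m N ^+ 2 * ln (2 * K N - cell_start N 1)) (fun N => m N ^+ 2 * (ln 478
  + 2 * ln (m N))).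
  apply: asym_trans (@asym_ln_K1 R); apply: asym_eq => N Nl; by rewrite cell_start1.
rewrite (n478 24 454)// in b2; rewrite (n478 53 425)// in b3; rewrite (n478 91 387)// in b4.
rewrite (n478 136 342)// in b5; rewrite (n478 186 292)// in b6.
have mono N k l : (k <= l)%N -> ((k * diamond_m R N).+1 <= (l * diamond_m R N).+1)%N.
  by move=> kl; rewrite ltnS leq_mul2r kl orbT.
have kM N k : large N -> (1 < k < 6)%N ->
  (2 * diamond_m R N <= k * diamond_m R N <= k.+1 * diamond_m R N)%N /\ (k.+1 * diamond_m R N <
    M N)%N.
  move=> Nl k6; have := @breakpoint_bounds N k.+1 Nl ltac:(lia).
  by rewrite !leq_mul2r => /andP[_ ->]; split=> //; lia.
have p1 := asym_trans (@first_piece R) (@asym_piece_ends R 6 0 (fun=> 1%N) (fun N => (2 *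
  diamond_m R N).+1) _ _ _ _
   (fun _ _ => isT) a2 a1 b2 b1).
have p2 : asym _ _ := asym_trans (@linear_piece R 2 5 4 24 (fun N => 2 * diamond_m R N)%N (fun N
  => 3 * diamond_m R N)%N
   erefl (fun N Nl => kM N 2 Nl isT) (fun N j Nl => @diamond_r2 R N (proj1 (andP Nl)) j)
   (fun N j Nl => @diamond_S2 R N (proj1 (andP Nl)) j))
   (@asym_piece_ends R 5 24 _ _ _ _ _ _ (fun N _ => mono N 2 3 isT) a3 a2 b3 b2).
have p3 : asym _ _ := asym_trans (@linear_piece R 5 4 13 77 (fun N => 3 * diamond_m R N)%N (fun
  N => 4 * diamond_m R N)%N
   erefl (fun N Nl => kM N 3 Nl isT) (fun N j Nl => @diamond_r3 R N (proj1 (andP Nl)) j)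
   (fun N j Nl => @diamond_S3 R N (proj1 (andP Nl)) j))
   (@asym_piece_ends R 4 77 _ _ _ _ _ _ (fun N _ => mono N 3 4 isT) a4 a3 b4 b3).
have p4 : asym _ _ := asym_trans (@linear_piece R 9 3 29 168 (fun N => 4 * diamond_m R N)%N (fun
  N => 5 * diamond_m R N)%N
   erefl (fun N Nl => kM N 4 Nl isT) (fun N j Nl => @diamond_r4 R N (proj1 (andP Nl)) j)
   (fun N j Nl => @diamond_S4 R N (proj1 (andP Nl)) j))
   (@asym_piece_ends R 3 168 _ _ _ _ _ _ (fun N _ => mono N 4 5 isT) a5 a4 b5 b4).
have p5 : asym _ _ := asym_trans (@linear_piece R 14 2 54 304 (fun N => 5 * diamond_m R N)%N
  (fun N => 6 * diamond_m R N)%N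
   erefl (fun N Nl => kM N 5 Nl isT) (fun N j Nl => @diamond_r5 R N (proj1 (andP Nl)) j)
   (fun N j Nl => @diamond_S5 R N (proj1 (andP Nl)) j))
   (@asym_piece_ends R 2 304 _ _ _ _ _ _ (fun N _ => mono N 5 6 isT) a6 a5 b6 b5).
have le6 N : large N -> ((6 * diamond_m R N).+1 <= M N)%N.
  by move=> Nl; have := @breakpoint_bounds N 6 Nl isT; case/andP.
have p6 := asym_trans (@last_piece R) (@asym_piece_ends R 1 490 (fun N => (6 * diamond_m R
  N).+1) (fun N => M N) _ _ _ _
   le6 a7 a6 b7 b6).
have p := asymD (asymD (asymD (asymD (asymD p1 p2) p3) p4) p5) p6.
apply: (@asym_trans R _ _ _ _ (asym_trans p _)); apply: asym_eq => N Nl.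
  rewrite /midpoint_corr (@big_cat_nat _ _ _ (6 * diamond_m R N).+1) ?le6//=; congr (_ + _).
  rewrite (@big_cat_nat _ _ _ (5 * diamond_m R N).+1) ?mono//=; congr (_ + _).
  rewrite (@big_cat_nat _ _ _ (4 * diamond_m R N).+1) ?mono//=; congr (_ + _).
  rewrite (@big_cat_nat _ _ _ (3 * diamond_m R N).+1) ?mono//=; congr (_ + _).
  by rewrite (@big_cat_nat _ _ _ (2 * diamond_m R N).+1) ?mono//=; congr (_ + _).
rewrite /midpoint_const.
move: (ln 24%:R) (ln 53%:R) (ln 91%:R) (ln 136%:R) (ln 186%:R) (ln 239) (ln 478) (ln 454%:R) (ln
  425%:R) (ln 387%:R) (ln 342%:R) (ln 292%:R).
move: (24^-1) (ln (m N)) (m N ^+ 2) => *; ring.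
Qed.
End asymptotic_T1_end.

(** * The sums of r ln r *)

Section asymptotic_T.
Context {R : realType}.
Local Notation m N := ((diamond_m R N)%:R : R).
Local Notation M N := (diamond_M R N).
Local Notation r N j := ((diamond_r R N j)%:R : R).
Local Notation large := (@large R).

Lemma ln_le_m1 c x N : large N -> 1 <= c -> 0 < x -> x <= c * m N -> ln x <= (1 + ln c) * (1 +
  ln (m N)).
Proof.
move=> Nl c1 x0 xm; have m3 := large_m Nl; have l0 := ln_m_ge0 Nl; have c0 := ln_ge0 c1.
apply: (@le_trans _ _ (ln c + ln (m N))).
  by rewrite -lnM ?posrE; [rewrite ler_ln ?posrE//; apply: lt_le_trans xm| |]; lra.
have := mulr_ge0 c0 l0; rewrite mulrDl mul1r mulrDr mulr1; lra.
Qed.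

Lemma xlnx_lip c x y N : large N -> 1 <= c -> 1 <= x -> x <= y -> y <= c * m N ->
  `|y * ln y - x * ln x| <= (y - x) * (1 + (1 + ln c)) * (1 + ln (m N)).
Proof.
move=> Nl c1 x1 xy yc; have l0 := ln_m_ge0 Nl; have c0 := ln_ge0 c1.
have x0 : 0 < x by lra.
have y0 : 0 < y by lra.
have h := ln_le_m1 Nl c1 y0 yc.
have lxy : 0 <= ln y - ln x by rewrite subr_ge0 ler_ln ?posrE.
have := @ln_lip R x y x x0 xy (lexx x); rewrite (ger0_norm lxy) ger0_norm ?subr_ge0//.
rewrite ler_pdivlMr// => h2.
have ly : 0 <= ln y by apply: ln_ge0; lra.
have -> : y * ln y - x * ln x = (y - x) * ln y + (ln y - ln x) * x by ring.
have d0 : 0 <= y - x by lra.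
rewrite ger0_norm; last by rewrite addr_ge0 ?mulr_ge0// ltW.
have h3 := ler_wpM2l d0 h.
have h4 : y - x <= (y - x) * (1 + ln (m N)) by rewrite ler_peMr; lra.
have -> : (y - x) * (1 + (1 + ln c)) * (1 + ln (m N)) =
  (y - x) * (1 + ln (m N)) + (y - x) * ((1 + ln c) * (1 + ln (m N))) by ring.
lra.
Qed.

(** The derivative u ln u is O(m (1 + ln m)) for u = O(m), so a bounded displacement of the argument
    stays within the error. *)
Lemma asym_xlnx_int_near (f : nat -> R) (rho C c : R) : 0 <= C -> 1 <= c -> 1 <= rho -> rho <= c ->
  (forall N, large N -> 1 <= f N <= c * m N) ->
  (forall N, large N -> `|f N - rho * m N| <= C) ->
  asym (fun N => xlnx_int (f N)) (fun N => xlnx_int (rho * m N)).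
Proof.
move=> C0 c1 rho1 rhoc fb fr; exists (C * (c * (1 + ln c))) => N Nl.
have m3 := large_m Nl; have l0 := ln_m_ge0 Nl; have c0 := ln_ge0 c1.
have /andP[f1 fc] := fb N Nl; have := fr N Nl.
have g1 : 1 <= rho * m N by rewrite -[1]mulr1 ler_pM//; lra.
have gc : rho * m N <= c * m N by rewrite ler_wpM2r//; lra.
have main (x y : R) : 1 <= x -> x <= y -> y <= c * m N -> `|x - y| <= C ->
    `|xlnx_int y - xlnx_int x| <= C * (c * (1 + ln c)) * err N.
  move=> x1 xy yc xyC; apply: le_trans (xlnx_int_lip x1 xy) _.
  have y0 : 0 < y by lra.
  rewrite distrC ger0_norm ?subr_ge0// in xyC.
  have h := ln_le_m1 Nl c1 y0 yc; have ly : 0 <= ln y by apply: ln_ge0; lra.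
  rewrite -mulrA ler_pM ?subr_ge0 ?mulr_ge0 ?(ltW y0)//.
  rewrite /err (_ : c * (1 + ln c) * (m N * (1 + ln (m N))) = c * m N * ((1 + ln c) * (1 + ln (m
    N)))); last by ring.
  by rewrite ler_pM// ltW.
case: (leP (f N) (rho * m N)) => h hC; first by rewrite distrC; exact: main.
by apply: main => //; [exact: ltW|rewrite distrC].
Qed.

Lemma xlnx_int_scale rho N : 0 < rho -> large N ->
  xlnx_int (rho * m N) = m N ^+ 2 * (rho ^+ 2 * ln rho / 2 - rho ^+ 2 / 4) + rho ^+ 2 / 2 * (m N
    ^+ 2 * ln (m N)).
Proof.
move=> rho0 Nl; have m3 := large_m Nl; rewrite /xlnx_int lnM ?posrE//; last by lra.
by field.
Qed.

Lemma xlnx_midpoint (b t : R) : 1 <= b -> b <= t ->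
  `|t * ln t - b^-1 * (xlnx_int (t + b / 2) - xlnx_int (t - b / 2))| <= b ^+ 2.
Proof.
move=> b1 bt; have t0 : 0 < t by lra.
have bd : 0 <= b / 2 <= 6 / 7 * t by apply/andP; split; lra.
have /andP[h1 h2] := xlnx_int_midpoint t0 bd.
have -> : t * ln t - b^-1 * (xlnx_int (t + b / 2) - xlnx_int (t - b / 2)) =
  - (b^-1 * (xlnx_int (t + b / 2) - xlnx_int (t - b / 2) - 2 * (b / 2) * t * ln t - (b / 2) ^+ 3
    / (3 * t)))
  - b^-1 * ((b / 2) ^+ 3 / (3 * t)).
  move: (xlnx_int _) (xlnx_int _) (ln t) ((b / 2) ^+ 3 / (3 * t)) => *; field; lra.
have h3 : 0 <= (b / 2) ^+ 3 / (3 * t) <= b ^+ 2 / 24.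
  rewrite divr_ge0 ?exprn_ge0//=; [|lra|lra].
  rewrite ler_pdivrMr; last by lra.
  have -> : (b / 2) ^+ 3 = b ^+ 2 / 24 * (3 * b) by field.
  by rewrite ler_wpM2l; [|rewrite divr_ge0 ?sqr_ge0|lra].
have h4 : 2 / 15 * (b / 2) ^+ 5 / t ^+ 3 <= b ^+ 2 / 240.
  rewrite ler_pdivrMr ?exprn_gt0//.
  have -> : 2 / 15 * (b / 2) ^+ 5 = b ^+ 2 / 240 * b ^+ 3 by field.
  rewrite ler_wpM2l ?divr_ge0 ?sqr_ge0 ?(ler0n R 240)// lerXn2r ?nnegrE//; lra.
have bi : 0 <= b^-1 <= 1 by rewrite invr_ge0 invf_le1; [apply/andP; split|]; lra.
have [bi0 bi1] := andP bi; have [h3a h3b] := andP h3.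
have h5 := ler_pM bi0 h1 bi1 (le_trans h2 h4).
have h6 := ler_pM bi0 h3a bi1 h3b.
rewrite !mul1r in h5 h6.
have h7 := mulr_ge0 bi0 h1; have h8 := mulr_ge0 bi0 h3a.
move: h5 h6 h7 h8; move: (b^-1 * _) (b^-1 * _) (sqr_ge0 b); move: (b ^+ 2); clear.
by move=> c u v c0 h5 h6 h7 h8; rewrite ler_norml; apply/andP; split; lra.
Qed.

(** The arguments advance by b, so the midpoint cells of half-width b / 2 around them are adjacent
    and the antiderivative telescopes. *)
Lemma linear_T (a b : nat) (x c : nat -> nat) : (0 < b)%N ->
  (forall N, large N -> (0 < x N <= c N)%N /\ (c N <= 7 * diamond_m R N)%N) ->
  asym (fun N => \sum_(x N <= j < c N) (a%:R * m N + b%:R * j%:R) * ln (a%:R * m N + b%:R * j%:R))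
       (fun N => b%:R^-1 * (xlnx_int (a%:R * m N + b%:R * (c N)%:R - b%:R / 2) - xlnx_int (a%:R
         * m N + b%:R * (x N)%:R - b%:R / 2))).
Proof.
move=> b0 xc; have b1 : 1 <= b%:R :> R by rewrite (ler_nat R 1).
apply: (@asym_trans R (fun N => \sum_(x N <= j < c N) b%:R^-1 *
   (xlnx_int (a%:R * m N + b%:R * j.+1%:R - b%:R / 2) - xlnx_int (a%:R * m N + b%:R * j%:R -
     b%:R / 2)))).
  apply: (@asym_sum R x c _ _ (b%:R ^+ 2)) => [N Nl|N j Nl jxc]; have [h1 h2] := xc N Nl => //.
  have j1 : 1 <= j%:R :> R by rewrite (ler_nat R 1); lia.
  have l0 := ln_m_ge0 Nl; have m3 := large_m Nl.
  have bt : b%:R <= a%:R * m N + b%:R * j%:R :> R.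
    have : 0 <= a%:R * m N by rewrite mulr_ge0.
    by have : b%:R <= b%:R * j%:R :> R by [rewrite ler_peMr]; lra.
  have := xlnx_midpoint b1 bt.
  have -> : a%:R * m N + b%:R * j.+1%:R - b%:R / 2 = a%:R * m N + b%:R * j%:R + b%:R / 2 :> R.
    by rewrite -[j.+1%:R]natr1; field.
  move=> h; apply: le_trans h _; rewrite ler_peMr ?sqr_ge0//; lra.
apply: asym_eq => N Nl; have [/andP[h1 h2] h3] := xc N Nl.
by rewrite -mulr_sumr (telescope_sumr (fun j => xlnx_int (a%:R * m N + b%:R * j%:R - b%:R / 2))).
Qed.
End asymptotic_T.

Section asymptotic_T_sum.
Context {R : realType}.
Local Notation m N := ((diamond_m R N)%:R : R).
Local Notation M N := (diamond_M R N).
Local Notation r N j := ((diamond_r R N j)%:R : R).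
Local Notation large := (@large R).

Lemma asym_xlnx_int_shift (rho h : R) : 1 <= rho -> - 2^-1 <= h <= 3 ->
  asym (fun N => xlnx_int (rho * m N + h)) (fun N => xlnx_int (rho * m N)).
Proof.
move=> rho1 /andP[h1 h2]; apply: (@asym_xlnx_int_near R _ rho 3 (rho + 1)); [lra|lra|done|lra| |].
  move=> N Nl; have m3 := large_m Nl.
  have : 1 * m N <= rho * m N by rewrite ler_wpM2r//; lra.
  by move=> h3; rewrite mulrDl; apply/andP; split; lra.
move=> N Nl; rewrite addrAC subrr add0r ler_norml; apply/andP; split; lra.
Qed.

Lemma T_piece (a b k l : nat) : (0 < b <= 6)%N -> (0 < k <= l)%N -> (l < 7)%N ->
  (forall N j, large N -> (k * diamond_m R N <= j <= l * diamond_m R N)%N ->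
     diamond_r R N j = (a * diamond_m R N + b * j)%N) ->
  asym (fun N => \sum_((k * diamond_m R N).+1 <= j < (l * diamond_m R N).+1) r N j * ln (r N j))
       (fun N => b%:R^-1 * (xlnx_int ((a + b * l)%:R * m N) - xlnx_int ((a + b * k)%:R * m N))).
Proof.
move=> /andP[b0 b6] /andP[k0 kl] l7 rE.
have b3 : b%:R / 2 <= 3 :> R by rewrite ler_pdivrMr// -natrM ler_nat.
have b3' : - 2^-1 <= b%:R / 2 :> R.
  by apply: (@le_trans _ _ 0); [rewrite oppr_le0 invr_ge0|apply: divr_ge0].
have rho1 i : (0 < i)%N -> 1 <= (a + b * i)%:R :> R by move=> i0; rewrite (ler_nat R 1); lia.
(* A cell ends half a step, b / 2 in the value of r, beyond the last index of the piece; the same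
   shift occurs at the start. *)
apply: (@asym_trans R (fun N => b%:R^-1 * (xlnx_int ((a + b * l)%:R * m N + b%:R / 2) - xlnx_int
  ((a + b * k)%:R * m N + b%:R / 2)))); last first.
  apply/asymZ/asymB; apply: asym_xlnx_int_shift; rewrite ?b3 ?b3'// rho1//; lia.
apply: (@asym_trans R (fun N => \sum_((k * diamond_m R N).+1 <= j < (l * diamond_m R N).+1)
   (a%:R * m N + b%:R * j%:R) * ln (a%:R * m N + b%:R * j%:R))).
  apply: asym_eq => N Nl; apply: eq_big_nat => j jkl.
  by rewrite rE//; [rewrite natrD !natrM|lia].
apply: (@asym_trans R _ _ _ (@linear_T R a b (fun N => (k * diamond_m R N).+1) (fun N => (l *
  diamond_m R N).+1) b0 _)).
  move=> N Nl; have [N121 _] := andP Nl; have m0 := @diamond_m_gt0 R N N121.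
  by rewrite /= ltnS leq_mul2r kl orbT ltn_mul2r m0; split=> //; lia.
apply: asym_eq => N Nl; congr (_ * (xlnx_int _ - xlnx_int _)).
  by rewrite -[(l * _).+1%:R]natr1 natrD !natrM; field.
by rewrite -[(k * _).+1%:R]natr1 natrD !natrM; field.
Qed.

Lemma T_first : asym (fun N => \sum_(1 <= j < (2 * diamond_m R N).+1) r N j * ln (r N j))
  (fun N => 6^-1 * xlnx_int (12 * m N)).
Proof.
apply: (@asym_trans R (fun N => 6^-1 * (xlnx_int (12 * m N + 3) - xlnx_int 3))); last first.
  apply: asymZ; apply: (@asym_trans R (fun N => xlnx_int (12 * m N) - xlnx_int 3)).
    apply: asymB; last exact: asym_refl.
    by apply: asym_xlnx_int_shift; [lra|apply/andP; split; lra].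
  apply: (@asym_bounded R `|xlnx_int 3|) => N Nl; have l0 := ln_m_ge0 Nl.
  by rewrite addrAC subrr add0r normrN ler_peMr//; lra.
apply: (@asym_trans R (fun N => \sum_(1 <= j < (2 * diamond_m R N).+1)
   (0%:R * m N + 6%:R * j%:R) * ln (0%:R * m N + 6%:R * j%:R))).
  apply: asym_eq => N Nl; apply: eq_big_nat => j jkl.
  by rewrite diamond_r1; [rewrite natrM mul0r add0r|lia].
apply: (@asym_trans R _ _ _ (@linear_T R 0 6 (fun=> 1%N) (fun N => (2 * diamond_m R N).+1) isT _)).
  by move=> N Nl; have [N121 _] := andP Nl; have m0 := @diamond_m_gt0 R N N121; split; lia.
apply: asym_eq => N Nl; congr (_ * (xlnx_int _ - xlnx_int _)); last by field.
by rewrite -[(2 * _).+1%:R]natr1 !natrM; field.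
Qed.

(** Here r_j exceeds 20 m + j by at most 720, and replacing it changes r_j ln r_j by O(1 + ln m) on
    each parallel. *)
Lemma T_last : asym (fun N => \sum_((6 * diamond_m R N).+1 <= j < M N) r N j * ln (r N j))
  (fun N => xlnx_int (27 * m N) - xlnx_int (26 * m N)).
Proof.
apply: (@asym_trans R (fun N => \sum_((6 * diamond_m R N).+1 <= j < M N)
   (20%:R * m N + 1%:R * j%:R) * ln (20%:R * m N + 1%:R * j%:R))).
  apply: (@asym_sum R _ _ _ _ (720 * (1 + (1 + ln 267)))) => [//|N j Nl jm].
  have [u [w [rE u720 _ _ _]]] := last_piece_nat Nl jm.
  have jM : (0 < j <= M N)%N by clear -jm; lia.
  have j1 : 1 <= j%:R :> R by rewrite (ler_nat R 1); clear -jm; lia.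
  have [_ _ r267] := r_bounds Nl jM.
  have m3 := large_m Nl; have l0 := ln_m_ge0 Nl.
  have c1 : 1 <= 267 :> R by rewrite (ler_nat R 1 267).
  have e : 20%:R * m N + 1%:R * j%:R + u%:R = r N j.
    by rewrite rE natrD natrD natrM mul1r.
  have u0 : 0 <= u%:R :> R by [].
  have x1 : 1 <= 20%:R * m N + 1%:R * j%:R.
    rewrite mul1r; apply: le_trans j1 _; rewrite lerDr; apply: mulr_ge0 => //.
  have xy : 20%:R * m N + 1%:R * j%:R <= r N j by rewrite -e lerDl.
  apply: le_trans (xlnx_lip Nl c1 x1 xy r267) _.
  rewrite -e [_ + u%:R]addrC addrK; have c2 := ln_ge0 c1.
  rewrite ler_wpM2r; [by []|lra|].
  by rewrite ler_wpM2r ?(ler_nat R u 720)//; lra.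
apply: (@asym_trans R _ _ _ (@linear_T R 20 1 (fun N => (6 * diamond_m R N).+1) (fun N => M N)
  isT _)).
  move=> N Nl; split=> //; have := @breakpoint_bounds R N 6 Nl isT.
  by case/andP.
have h : asym (fun N => 1 * (xlnx_int (27 * m N + - 2^-1) - xlnx_int (26 * m N + 2^-1)))
   (fun N => 1 * (xlnx_int (27 * m N) - xlnx_int (26 * m N))).
  apply/asymZ/asymB; apply: asym_xlnx_int_shift; try lra; apply/andP; split; lra.
apply: (@asym_trans R _ _ _ _ (asym_trans h _)); apply: asym_eq => N Nl.
  rewrite invr1; congr (1 * (xlnx_int _ - xlnx_int _)).
    by rewrite /diamond_M natrM; field.
  by rewrite -[(6 * _).+1%:R]natr1 natrM; field.
by rewrite mul1r.
Qed.

Lemma T_equator : asym (fun N => r N (M N) * ln (r N (M N)) / 2) (fun=> 0).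
Proof.
exists (267 * (1 + ln 267)) => N Nl; rewrite subr0.
have MM : (0 < M N <= M N)%N by rewrite leqnn andbT; have := M_gt0 Nl; lia.
have c1 : 1 <= 267 :> R by rewrite (ler_nat R 1 267).
have m3 := large_m Nl; have [r3 _ r267] := r_bounds Nl MM.
have M1 : 1 <= (M N)%:R :> R by rewrite (ler_nat R 1); clear -MM; lia.
have r1 : 1 <= r N (M N) by lra.
have r0 : 0 < r N (M N) by lra.
have h := ln_le_m1 Nl c1 r0 r267; have l1 := ln_ge0 r1.
have h0 : 0 <= r N (M N) * ln (r N (M N)) by rewrite mulr_ge0// ltW.
rewrite ger0_norm ?divr_ge0//; apply: (@le_trans _ _ (r N (M N) * ln (r N (M N)))); first by lra.
rewrite /err (_ : 267 * (1 + ln 267) * (m N * (1 + ln (m N))) = (267 * m N) * ((1 + ln 267) * (1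
  + ln (m N)))); last by ring.
by rewrite ler_pM// ltW.
Qed.


(** 12, 17, 21, 24, 26, 27 are the values of r / m at j = 2 m, ..., 7 m, up to O(1 / m) for the last
    one; the divisors 6, ..., 1 are the slopes of r. *)
Definition parallel_const : R := xlnx_int 12 / 6 + (xlnx_int 17 - xlnx_int 12) / 5 + (xlnx_int
  21 - xlnx_int 17) / 4 +
  (xlnx_int 24 - xlnx_int 21) / 3 + (xlnx_int 26 - xlnx_int 24) / 2 + (xlnx_int 27 - xlnx_int 26).

(** The factor 239 / 2 is the sum of the integrals of r / m over the pieces, that is, the limit of N
    / m^2. *)
Lemma asym_T : asym (@diamond_T R) (fun N => m N ^+ 2 * parallel_const + 239 / 2 * (m N ^+ 2 *
  ln (m N))).
Proof.
have mono N k l : (k <= l)%N -> ((k * diamond_m R N).+1 <= (l * diamond_m R N).+1)%N.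
  by move=> kl; rewrite ltnS leq_mul2r kl orbT.
have le6 N : large N -> ((6 * diamond_m R N).+1 <= M N)%N.
  by move=> Nl; have := @breakpoint_bounds R N 6 Nl isT; case/andP.
have p2 := @T_piece 2 5 2 3 isT isT isT (fun N j Nl => @diamond_r2 R N (proj1 (andP Nl)) j).
have p3 := @T_piece 5 4 3 4 isT isT isT (fun N j Nl => @diamond_r3 R N (proj1 (andP Nl)) j).
have p4 := @T_piece 9 3 4 5 isT isT isT (fun N j Nl => @diamond_r4 R N (proj1 (andP Nl)) j).
have p5 := @T_piece 14 2 5 6 isT isT isT (fun N j Nl => @diamond_r5 R N (proj1 (andP Nl)) j).
have p := asymD (asymD (asymD (asymD (asymD (asymD T_first p2) p3) p4) p5) T_last) T_equator.
apply: (@asym_trans R _ _ _ _ (asym_trans p _)); apply: asym_eq => N Nl.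
  rewrite /diamond_T; congr (_ + _).
  rewrite (@big_cat_nat _ _ _ (6 * diamond_m R N).+1) ?le6//=; congr (_ + _).
  rewrite (@big_cat_nat _ _ _ (5 * diamond_m R N).+1) ?mono//=; congr (_ + _).
  rewrite (@big_cat_nat _ _ _ (4 * diamond_m R N).+1) ?mono//=; congr (_ + _).
  rewrite (@big_cat_nat _ _ _ (3 * diamond_m R N).+1) ?mono//=; congr (_ + _).
  by rewrite (@big_cat_nat _ _ _ (2 * diamond_m R N).+1) ?mono//=; congr (_ + _).
rewrite /= -[(2 + 5 * 3)%N]/17%N -[(2 + 5 * 2)%N]/12%N -[(5 + 4 * 4)%N]/21%N -[(5 + 4 * 3)%N]/17%N
 -[(9 + 3 * 5)%N]/24%N -[(9 + 3 * 4)%N]/21%N -[(14 + 2 * 6)%N]/26%N -[(14 + 2 * 5)%N]/24%N.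
have gs (k : nat) : (0 < k)%N -> xlnx_int (k%:R * m N) = m N ^+ 2 * xlnx_int k%:R + k%:R ^+ 2 /
  2 * (m N ^+ 2 * ln (m N)).
  by move=> k0; rewrite xlnx_int_scale// ltr0n.
rewrite (gs 12)// (gs 17)// (gs 21)// (gs 24)// (gs 26)// (gs 27)// /parallel_const.
move: (xlnx_int 12%:R) (xlnx_int 17%:R) (xlnx_int 21%:R) (xlnx_int 24%:R) (xlnx_int 26%:R)
  (xlnx_int 27%:R) (m N ^+ 2) (ln (m N)) => *.
by field.
Qed.
End asymptotic_T_sum.

(** * The negligible interaction inside the parallels *)

Section asymptotic_V.
Context {R : realType}.
Local Notation m N := ((diamond_m R N)%:R : R).
Local Notation M N := (diamond_M R N).
Local Notation r N j := ((diamond_r R N j)%:R : R).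
Local Notation S N j := ((@diamond_S R N j).+1%:R : R).
Local Notation K N := (2 * N%:R - 1 : R).
Local Notation large := (@large R).

Lemma bernoulli_ineq (x : R) n : 0 <= x -> 1 + n%:R * x <= (1 + x) ^+ n.
Proof.
move=> x0; elim: n => [|n IH]; first by rewrite mul0r addr0 expr0.
rewrite exprS; apply: (@le_trans _ _ ((1 + x) * (1 + n%:R * x))).
  have -> : (1 + x) * (1 + n%:R * x) = 1 + n.+1%:R * x + n%:R * x ^+ 2 by rewrite
    -[n.+1%:R]natr1; ring.
  by rewrite lerDl mulr_ge0// sqr_ge0.
by rewrite ler_wpM2l//; lra.
Qed.

(** Both signs come from ln (1 + y) <= y, at y = - x and at y = x / (1 - x), since 1 + x / (1 - x)
    is the inverse of 1 - x. *)
Lemma ln1B_bound (x p : R) : `|x| <= p -> p < 1 -> `|ln (1 - x)| <= p / (1 - p).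
Proof.
rewrite ler_norml => /andP[x1 x2] p1.
have p0 : 0 <= p by lra.
have q0 : 0 < 1 - p by lra.
have y0 : 0 < 1 - x by lra.
have pp : p <= p / (1 - p) by rewrite ler_pdivlMr//; nra.
have h1 := @le_ln1Dx R (- x) ltac:(lra).
have h2 := @le_ln1Dx R (x / (1 - x)).
have e : 1 + x / (1 - x) = (1 - x)^-1 by field; lra.
have h3 : x / (1 - x) <= p / (1 - p).
  by rewrite ler_pdivrMr// mulrAC ler_pdivlMr//; nra.
have h4 : -1 < x / (1 - x) by rewrite ltr_pdivlMr//; lra.
have := h2 h4; rewrite e lnV ?posrE// => h5.
by rewrite ler_norml; apply/andP; split; lra.
Qed.

(* Bernoulli: ((1 + z) / (1 - z)) ^ n >= 1 + 2 n z. *)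
Lemma V_term_bound (z : R) n : 0 < z < 1 ->
  n%:R * `|ln (1 - (- ((1 - z) / (1 + z))) ^+ n)| <= (2 * z)^-1.
Proof.
move=> /andP[z0 z1]; case: n => [|n]; first by rewrite mul0r invr_ge0; lra.
set q := (1 - z) / (1 + z).
have q0 : 0 <= q by apply: divr_ge0; lra.
have zn : 0 < n.+1%:R * (2 * z) :> R by rewrite !mulr_gt0.
have hq : q ^+ n.+1 * (1 + n.+1%:R * (2 * z)) <= 1.
  apply: (@le_trans _ _ (q ^+ n.+1 * (1 + 2 * z) ^+ n.+1)).
    by rewrite ler_wpM2l ?exprn_ge0// bernoulli_ineq//; lra.
  rewrite -exprMn exprn_ile1//; first by rewrite mulr_ge0//; lra.
  by rewrite /q mulrAC ler_pdivrMr; nra.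
have p0 : 0 <= q ^+ n.+1 by rewrite exprn_ge0.
have p1 : q ^+ n.+1 < 1.
  rewrite exprn_ilt1// /q ltr_pdivrMr; lra.
have := @ln1B_bound ((- q) ^+ n.+1) (q ^+ n.+1).
rewrite normrX normrN (ger0_norm q0) => /(_ (lexx _) p1) h.
apply: le_trans (ler_wpM2l (ler0n R n.+1) h) _.
rewrite -[leRHS]mul1r ler_pdivlMr ?mulr_gt0//.
have -> : n.+1%:R * (q ^+ n.+1 / (1 - q ^+ n.+1)) * (2 * z) =
  q ^+ n.+1 * (n.+1%:R * (2 * z)) / (1 - q ^+ n.+1) by ring.
by rewrite ler_pdivrMr ?subr_gt0// mul1r; move: hq; rewrite mulrDr mulr1; lra.
Qed.

Lemma harmonic_bound n : (0 < n)%N -> \sum_(1 <= k < n.+1) (k%:R : R)^-1 <= 1 + ln n%:R.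
Proof.
elim: n => [//|[|n] IH] _; first by rewrite big_nat1 invr1 ln1 addr0.
rewrite big_nat_recr//=; apply: le_trans (lerD (IH isT) (lexx _)) _.
rewrite -addrA lerD2l.
have n1 : 0 < n.+1%:R :> R by [].
have n2 : 0 < n.+2%:R :> R by [].
have := @le_ln1Dx R (- n.+2%:R^-1).
have -> : 1 + - n.+2%:R^-1 = n.+1%:R / n.+2%:R :> R.
  by rewrite -[n.+2%:R]natr1; field; lra.
rewrite ln_div ?posrE// ltrN2 invf_lt1// (ltr_nat R 1) => /(_ isT).
by rewrite lerBlDr (addrC (- _)) => h; rewrite -lerBrDr.
Qed.

Lemma asym_V : asym (@diamond_V R) (fun=> 0).
Proof.
exists (80 * (1 + (1 + ln 7))) => N Nl; rewrite subr0.
have [N121 _] := andP Nl; have m3 := large_m Nl; have l0 := ln_m_ge0 Nl.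
have K1 := K_le Nl; have K0 := @twoN1_gt0 R N N121.
have M7 := M_gt0 Nl; have M0 : 0 < (M N)%:R :> R by rewrite ltr0n; clear -M7; lia.
apply: le_trans (ler_norm_sum _ _ _) _.
(* [diamond_S_gap] with M = 7 m and K <= 1675 m^2 gives 21 (M - j) <= 3350 m z_j, and 3350 / 42 <
   80. A harmonic sum remains. *)
apply: (@le_trans _ _ (\sum_(1 <= j < M N) 80 * m N * ((M N - j)%N%:R : R)^-1)).
  rewrite big_nat_cond [leRHS]big_nat_cond; apply: ler_sum => j /andP[jM _].
  have jM' : (0 < j <= M N)%N by clear -jM; lia.
  have d0 : 0 < (M N - j)%N%:R :> R by rewrite ltr0n; clear -jM; lia.
  have S0 := S_gt0 (R := R) N j; have SK := S_lt_K N121 jM.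
  have zE := @diamond_zE R N j.
  have z01 : 0 < diamond_z R N j < 1.
    rewrite zE; have : 0 < S N j / K N by rewrite divr_gt0.
    have : S N j / K N < 1 by rewrite ltr_pdivrMr// mul1r.
    by move=> *; apply/andP; split; lra.
  rewrite normrM ger0_norm ?ler0n//; apply: le_trans (V_term_bound _ z01) _.
  have gap : 3 * (M N)%:R * (M N - j)%:R <= 2 * (K N * diamond_z R N j).
    have -> : K N * diamond_z R N j = K N - S N j by rewrite zE; field; lra.
    have h := @diamond_S_gap R N N121 j jM'.
    have SM := @diamond_S_last R N N121.
    have h2 : (3 * M N * (M N - j) + 2 * (@diamond_S R N j).+1 <= 2 * (@diamond_S R N (M N)).+1)%N.
      have := @diamond_S_lt R N N121 j (M N) ltac:(clear -jM; lia) ltac:(clear -jM; lia).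
      by move: h SM; move: (3 * M N * (M N - j))%N => g; clear; lia.
    move: h2; rewrite -(ler_nat R) natrD natrM natrM !(natrM R 2) (twoN1E N121).
    lra.
  have [z0 _] := andP z01.
  rewrite -[leLHS]mul1r ler_pdivrMr ?mulr_gt0// mulrAC ler_pdivlMr// mul1r.
  have M7E : (M N)%:R = 7 * m N by rewrite -natrM.
  rewrite M7E in gap.
  have h1 : K N * diamond_z R N j <= 1675 * m N ^+ 2 * diamond_z R N j.
    by rewrite ler_wpM2r// ltW.
  have h3 : 21 * m N * (M N - j)%:R <= m N * (3350 * m N * diamond_z R N j).
    have -> : 21 * m N * (M N - j)%:R = 3 * (7 * m N) * (M N - j)%:R by ring.
    apply: le_trans gap _; apply: (@le_trans _ _ (2 * (1675 * m N ^+ 2 * diamond_z R N j))).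
      by rewrite ler_wpM2l.
    by rewrite (_ : 2 * _ = m N * (3350 * m N * diamond_z R N j))//; ring.
  have m0 : 0 < m N := lt_le_trans (ltr0n R 3) m3.
  have h4 : 21 * (M N - j)%:R <= 3350 * m N * diamond_z R N j.
    by rewrite -(ler_pM2l m0) mulrA (mulrC (m N) 21).
  have h5 : 0 < m N * diamond_z R N j by rewrite mulr_gt0.
  move: h4 h5; rewrite -!(mulrA 3350) (_ : 80 * m N * (2 * _) = 160 * (m N * diamond_z R N j));
    last by ring.
  by move: (m N * _) ((M N - j)%:R : R); clear => *; lra.
rewrite -mulr_sumr big_nat_rev /=.
have -> : \sum_(1 <= i < M N) ((M N - (1 + M N - i.+1))%N%:R : R)^-1 = \sum_(1 <= i < (M
  N).-1.+1) (i%:R : R)^-1.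
  rewrite prednK; last by clear -M7; lia.
  by apply: eq_big_nat => i iM; congr (_%:R^-1); clear -iM; lia.
have M1 : (0 < (M N).-1)%N by clear -M7; lia.
have m0 : 0 <= 80 * m N by apply: mulr_ge0; [exact: (ler0n R 80)|lra].
apply: le_trans (ler_wpM2l m0 (harmonic_bound M1)) _.
rewrite /err (_ : 80 * _ * (m N * (1 + ln (m N))) = 80 * m N * ((1 + (1 + ln 7)) * (1 + ln (m
  N)))); last by ring.
apply: ler_wpM2l => //.
have p1 : 0 < (M N).-1%:R :> R by rewrite ltr0n.
have := @ln_le_m1 R 7 (M N).-1%:R N Nl _ p1; rewrite (ler_nat R 1 7) => /(_ isT) h.
have : ln (M N).-1%:R <= (1 + ln 7) * (1 + ln (m N)).
  by apply: h; rewrite -natrM ler_nat leq_pred.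
by rewrite mulrDl mul1r; lra.
Qed.

End asymptotic_V.

(** * Identification of the constant *)

Section constant.
Context {R : realType}.

(** The right-hand side collects the coefficients of N: ln 2 - 1 from (1 - ln 2) (N^2 - N), and the
    rest from m^2 = 2 N / 239 + O(m), the last term being left over when m^2 ln m is rewritten with
    N ln N. Both sides are combinations of the logarithms of 13 primes. *)
Lemma c_diamond_identity :
  c_diamond R - 1 / 2 * ln 2 = ln 2 - 1 + 2 / 239 * (@midpoint_const R - @parallel_const R) + ln
    (239 / 2) / 2.
Proof.
have lnMn (a b : nat) : (0 < a)%N -> (0 < b)%N -> ln (a * b)%:R = ln a%:R + ln b%:R :> R.
  by move=> a0 b0; rewrite natrM lnM// posrE ltr0n.
rewrite /c_diamond /midpoint_const /parallel_const /xlnx_int.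
have e454 := lnMn 2 227 isT isT; have e478 := lnMn 2 239 isT isT.
have e4 := lnMn 2 2 isT isT; have e6 := lnMn 2 3 isT isT; have e12 := lnMn 2 6 isT isT.
have e24 := lnMn 2 12 isT isT; have e85 := lnMn 5 17 isT isT; have e425 := lnMn 5 85 isT isT.
have e91 := lnMn 7 13 isT isT; have e9 := lnMn 3 3 isT isT; have e27 := lnMn 3 9 isT isT.
have e387 := lnMn 9 43 isT isT; have e34 := lnMn 2 17 isT isT; have e136 := lnMn 4 34 isT isT.
have e38 := lnMn 2 19 isT isT; have e342 := lnMn 9 38 isT isT; have e186 := lnMn 6 31 isT isT.
have e292 := lnMn 4 73 isT isT; have e21 := lnMn 3 7 isT isT; have e26 := lnMn 2 13 isT isT.
rewrite ln_div ?posrE ?(ltr0n R 239)//.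
rewrite /= in e454 e478 e4 e6 e12 e24 e85 e425 e91 e9 e27 e387 e34 e136 e38 e342 e186 e292 e21 e26.
rewrite e454 e478 e24 e12 e6 e425 e85 e91 e387 e27 e9 e136 e34 e4 e342 e9 e38 e186 e6 e292 e4
  e21 e26.
move: (ln 2%:R) (ln 3%:R) (ln 5%:R) (ln 7%:R) (ln 13%:R) (ln 17%:R) (ln 19%:R) (ln 31%:R).
move: (ln 43%:R) (ln 53%:R) (ln 73%:R) (ln 227%:R) (ln 239%:R) => *.
by field.
Qed.
End constant.

(** * From powers of m to powers of N *)

Section asymptotic_mean.
Context {R : realType}.
Local Notation m N := ((diamond_m R N)%:R : R).
Local Notation K N := (2 * N%:R - 1 : R).
Local Notation large := (@large R).

Lemma N_bounds N : large N -> 239 / 2 * m N ^+ 2 <= N%:R <= 239 / 2 * m N ^+ 2 + 719 * m N.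
Proof.
move=> Nl; have /andP[k1 k2] := K_bounds Nl; have m3 := large_m Nl.
move: (N%:R : R) (m N) (m N ^+ 2) k1 k2 m3 => x y z k1 k2 m3; clear -k1 k2 m3.
by apply/andP; split; lra.
Qed.

Lemma asym_m2 : asym (fun N => m N ^+ 2) (fun N => 2 / 239 * N%:R).
Proof.
apply: (@asym_m R 719) => N Nl; have /andP[k1 k2] := N_bounds Nl; have m3 := large_m Nl.
move: (N%:R : R) (m N) (m N ^+ 2) k1 k2 m3 => x y z k1 k2 m3; clear -k1 k2 m3.
by rewrite ler_norml; apply/andP; split; lra.
Qed.

(** N differs from 239 m^2 / 2 by O(m), and u ln u has derivative O(1 + ln m) in between. *)
Lemma asym_N_lnN : asym (fun N => 239 / 2 * m N ^+ 2 * ln (239 / 2 * m N ^+ 2)) (fun N => N%:R *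
  ln N%:R).
Proof.
exists (719 * (ln 360 + 3)) => N Nl; have /andP[k1 k2] := N_bounds Nl.
have m3 := large_m Nl; have l0 := ln_m_ge0 Nl; have [N121 _] := andP Nl.
have N0 : 0 < N%:R :> R by rewrite ltr0n; clear -N121; lia.
have mm : 3 * m N <= m N ^+ 2 by rewrite expr2 ler_wpM2r//; lra.
have c1 : 1 <= 360 :> R by rewrite (ler_nat R 1 360).
have lN : ln N%:R <= ln 360 + 2 * ln (m N).
  apply: ln_le_m => //; move: k2 m3 mm; move: (N%:R : R) (m N) (m N ^+ 2); clear => *; lra.
have lc := ln_ge0 c1; have m2 : 0 < m N ^+ 2 by rewrite exprn_gt0//; lra.
have x0 : 0 < 239 / 2 * m N ^+ 2 by rewrite mulr_gt0 ?divr_gt0 ?(ltr0n R 239) ?(ltr0n R 2).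
have N1 : 1 <= N%:R :> R by rewrite (ler_nat R 1); clear -N121; lia.
have l1 := ln_ge0 N1.
have := @ln_lip R _ _ _ x0 k1 (lexx _).
rewrite /err; move: (239 / 2 * m N ^+ 2) (N%:R : R) x0 k1 k2 N0 lN l1 => x y x0 k1 k2 N0 lN l1.
rewrite (ger0_norm (x := y - x)) ?subr_ge0// ger0_norm ?subr_ge0 ?ler_ln ?posrE//.
rewrite ler_pdivlMr// => h.
have -> : x * ln x - y * ln y = - ((y - x) * ln y + (ln y - ln x) * x) by ring.
have d0 : 0 <= y - x by rewrite subr_ge0.
have d1 : y - x <= 719 * m N by rewrite lerBlDl.
have l2 : 0 <= (ln y - ln x) * x.
  by apply: mulr_ge0; [rewrite subr_ge0 ler_ln ?posrE|exact: ltW].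
rewrite normrN ger0_norm ?addr_ge0// ?mulr_ge0//.
have h2 : (y - x) * ln y <= 719 * m N * (ln 360 + 2 * ln (m N)) by exact: ler_pM.
have -> : 719 * (ln 360 + 3) * (m N * (1 + ln (m N))) = 719 * m N * (ln 360 + 2 * ln (m N)) +
   719 * m N * (3 + ln 360 * ln (m N) + ln (m N)) by ring.
apply: lerD => //; apply: le_trans h _; apply: le_trans d1 _.
have c719 : 0 <= 719 * m N by apply: mulr_ge0; [exact: (ler0n R 719)|lra].
rewrite ler_peMr//; have := mulr_ge0 lc l0; lra.
Qed.

Lemma asym_mean : asym (@diamond_mean R)
  (fun N => W_log_RP2 R * N%:R ^+ 2 - 1 / 2 * N%:R * ln N%:R + (c_diamond R - 1 / 2 * ln 2) * N%:R).
Proof.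
have q := asym_trans asym_Q (asymB (asym_refl (fun N => K N ^+ 2 / 2 * ln 2 - K N ^+ 2 / 4 - K N
  / 2 * ln 2)) (@asym_midpoint_corr R)).
have := asymB (asymB (asymB (asym_refl (fun N => (N%:R - 1) ^+ 2 * ln 2 : R)) q) (@asym_T R))
  (@asym_V R).
move=> h; apply: (@asym_trans R _ _ _ h).
have a := asymZ (@midpoint_const R - @parallel_const R + 239 / 2 * ln (239 / 2) / 2) asym_m2.
have b := asymZ 2^-1 asym_N_lnN.
have ab := asymB (asymD (asym_refl (fun N => (1 - ln 2) * (N%:R ^+ 2 - N%:R) : R)) a) b.
apply: asym_trans (asym_trans _ ab) _; last first.
  apply: asym_eq => N Nl; rewrite c_diamond_identity /W_log_RP2.
  move: (@midpoint_const R) (@parallel_const R) (ln (N%:R : R)) (N%:R : R) (ln (239 / 2)) (ln 2)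
    => *; by field.
apply: (@asym_bounded R 1) => N Nl.
have m3 := large_m Nl; have l0 := ln_m_ge0 Nl.
have m0 : 0 < m N by lra.
have p : 0 < 239 / 2 :> R by rewrite divr_gt0 ?(ltr0n R 239) ?(ltr0n R 2).
have -> : ln (239 / 2 * m N ^+ 2) = ln (239 / 2) + 2 * ln (m N).
  by rewrite [2 * _]mulr_natl -lnXn// -lnM ?posrE ?exprn_gt0.
(* The terms in N alone, (N - 1)^2 ln 2 and those of Q in K = 2 N - 1, combine to (1 - ln 2) (N^2 -
   N) + 1 / 4; everything else agrees. *)
rewrite [X in `|X|](_ : _ = 4^-1).
  by rewrite ger0_norm// mul1r; lra.
move: (@midpoint_const R) (@parallel_const R) (ln (m N)) (m N) (N%:R : R) (ln (239 / 2)) (ln 2)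
  => *; by field.
Qed.
End asymptotic_mean.

(** * Numerical bounds on the constant *)

Section numerics.
Context {R : realType}.

(** Three terms of the series of 2 artanh y. The derivative of the remainder is 2 x^6 / (1 - x^2),
    at most 9 / 4 x^6 because x^2 <= 1 / 9, which integrates to 9 / 28 y^7. *)
Lemma atanh_bounds (y : R) : 0 <= y <= 1 / 3 ->
  2 * (y + y ^+ 3 / 3 + y ^+ 5 / 5) <= ln (1 + y) - ln (1 - y)
    <= 2 * (y + y ^+ 3 / 3 + y ^+ 5 / 5) + 9 / 28 * y ^+ 7.
Proof.
move=> yb; rewrite -subr_ge0 -[X in _ && X]subr_ge0; apply/andP; split.
  apply: (@ge0_of_derive R (fun y => ln (1 + y) - ln (1 - y) - 2 * (y + y ^+ 3 / 3 + y ^+ 5 / 5))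
    (fun y => (1 + y)^-1 + (1 - y)^-1 - 2 * (1 + y ^+ 2 + y ^+ 4)) (1 / 3) _ _ _ y yb).
  - move=> x /andP[x0 x1].
    have D1 := @is_derive_ln1D R x ltac:(lra); have D2 := @is_derive_ln1B R x ltac:(lra).
    apply: is_derive_eq; rewrite /GRing.scale /=.
    by field; apply/andP; split; lra.
  - move=> x /andP[x0 x1].
    have -> : (1 + x)^-1 + (1 - x)^-1 - 2 * (1 + x ^+ 2 + x ^+ 4) = 2 * x ^+ 6 / (1 - x ^+ 2).
      by field; apply/andP; split; nra.
    by rewrite divr_ge0 ?mulr_ge0 ?exprn_ge0//; nra.
  - by rewrite addr0 subr0 ln1; lra.
apply: (@ge0_of_derive R (fun y => 2 * (y + y ^+ 3 / 3 + y ^+ 5 / 5) + 9 / 28 * y ^+ 7 - (ln (1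
  + y) - ln (1 - y)))
  (fun y => 2 * (1 + y ^+ 2 + y ^+ 4) + 9 / 4 * y ^+ 6 - ((1 + y)^-1 + (1 - y)^-1)) (1 / 3) _ _
    _ y yb).
- move=> x /andP[x0 x1].
  have D1 := @is_derive_ln1D R x ltac:(lra); have D2 := @is_derive_ln1B R x ltac:(lra).
  apply: is_derive_eq; rewrite /GRing.scale /=.
  by field; apply/andP; split; lra.
- move=> x /andP[x0 x1].
  have -> : 2 * (1 + x ^+ 2 + x ^+ 4) + 9 / 4 * x ^+ 6 - ((1 + x)^-1 + (1 - x)^-1) =
     x ^+ 6 * (1 - 9 * x ^+ 2) / (4 * (1 - x ^+ 2)).
    by field; apply/andP; split; nra.
  have x2 : x ^+ 2 <= 1 / 9 by nra.
  by rewrite divr_ge0 ?mulr_ge0 ?exprn_ge0//; lra.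
- by rewrite addr0 subr0 ln1; lra.
Qed.

(** With t = 1 / (2 x + 1) one has (x + 1) / x = (1 + t) / (1 - t), so the difference is 2 artanh
    t. *)
Lemma ln_succ_bounds (x y t : R) : 1 <= x -> y = x + 1 -> t * (2 * x + 1) = 1 ->
  2 * (t + t ^+ 3 / 3 + t ^+ 5 / 5) <= ln y - ln x
    <= 2 * (t + t ^+ 3 / 3 + t ^+ 5 / 5) + 9 / 28 * t ^+ 7.
Proof.
move=> x1 -> te.
have tE : t = (2 * x + 1)^-1.
  by apply: (@mulIf _ (2 * x + 1)); rewrite ?te ?mulVf// gt_eqF//; lra.
have t0 : 0 <= t <= 1 / 3.
  rewrite tE invr_ge0; apply/andP; split; first by lra.
  by rewrite div1r lef_pV2 ?posrE; lra.
have -> : ln (x + 1) - ln x = ln (1 + t) - ln (1 - t).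
  have p1 : 0 < 1 + t by lra.
  have p2 : 0 < 1 - t by lra.
  rewrite -ln_div ?posrE; [|lra..].
  rewrite -ln_div ?posrE//; congr ln; rewrite tE; field.
  by apply/andP; split; lra.
exact: atanh_bounds.
Qed.

(* Large coefficients are split in base 1000, since numerals of R are unary. *)
Definition c_part1 : R := (8 * 10 ^+ 3 + 677) * (ln 81 - ln 80) + (171 * 10 ^+ 3 + 750) * (ln 25
  - ln 24) + (286 * 10 ^+ 3 + 223) * (ln 16 - ln 15).
Definition c_part2 : R := (23 * 10 ^+ 3 + 325) * (ln 49 - ln 48) + (39 * 10 ^+ 3 + 650) * (ln
  169 - ln 168) - (3 * 10 ^+ 3 + 876) * (ln 289 - ln 288) - (7 * 10 ^+ 3 + 960) * (ln 361 - ln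
  360) - (1 * 10 ^+ 3 + 860) * (ln 961 - ln 960).
Definition c_part3 : R := - ((7 * 10 ^+ 3 + 740) * (ln 129 - ln 128)) + (1 * 10 ^+ 3 + 60) * (ln
  160 - ln 159) - (5 * 10 ^+ 3 + 840) * (ln 73 - ln 72) + (9 * 10 ^+ 3 + 80) * (ln 228 - ln 227)
  - (76 * 10 ^+ 3 + 480) * (ln 240 - ln 239).

(* For each n used here the primes dividing n (n + 1) all occur in c_diamond,
   and the logarithms of these primes are rational combinations of the
   numbers ln (n + 1) - ln n. *)
Lemma c_diamond_partE :
  (57 * 10 ^+ 3 + 360) * (c_diamond R + 1 / 2) = c_part1 + c_part2 + c_part3.
Proof.
have lnMn (a b c : nat) : (a * b)%N = c -> (0 < a)%N -> (0 < b)%N -> ln c%:R = ln a%:R + ln b%:R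
  :> R.
  by move=> <- a0 b0; rewrite natrM lnM// posrE ltr0n.
have e10 := lnMn 2 5 10 erefl isT isT.
have e20 := lnMn 2 10 20 erefl isT isT.
have e40 := lnMn 2 20 40 erefl isT isT.
have e80 := lnMn 2 40 80 erefl isT isT.
have e9 := lnMn 3 3 9 erefl isT isT.
have e27 := lnMn 3 9 27 erefl isT isT.
have e81 := lnMn 3 27 81 erefl isT isT.
have e6 := lnMn 2 3 6 erefl isT isT.
have e12 := lnMn 2 6 12 erefl isT isT.
have e24 := lnMn 2 12 24 erefl isT isT.
have e25 := lnMn 5 5 25 erefl isT isT.
have e15 := lnMn 3 5 15 erefl isT isT.
have e4 := lnMn 2 2 4 erefl isT isT.
have e8 := lnMn 2 4 8 erefl isT isT.
have e16 := lnMn 2 8 16 erefl isT isT.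
have e48 := lnMn 2 24 48 erefl isT isT.
have e49 := lnMn 7 7 49 erefl isT isT.
have e21 := lnMn 3 7 21 erefl isT isT.
have e42 := lnMn 2 21 42 erefl isT isT.
have e84 := lnMn 2 42 84 erefl isT isT.
have e168 := lnMn 2 84 168 erefl isT isT.
have e169 := lnMn 13 13 169 erefl isT isT.
have e18 := lnMn 2 9 18 erefl isT isT.
have e36 := lnMn 2 18 36 erefl isT isT.
have e72 := lnMn 2 36 72 erefl isT isT.
have e144 := lnMn 2 72 144 erefl isT isT.
have e288 := lnMn 2 144 288 erefl isT isT.
have e289 := lnMn 17 17 289 erefl isT isT.
have e45 := lnMn 3 15 45 erefl isT isT.
have e90 := lnMn 2 45 90 erefl isT isT.
have e180 := lnMn 2 90 180 erefl isT isT.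
have e360 := lnMn 2 180 360 erefl isT isT.
have e361 := lnMn 19 19 361 erefl isT isT.
have e30 := lnMn 2 15 30 erefl isT isT.
have e60 := lnMn 2 30 60 erefl isT isT.
have e120 := lnMn 2 60 120 erefl isT isT.
have e240 := lnMn 2 120 240 erefl isT isT.
have e480 := lnMn 2 240 480 erefl isT isT.
have e960 := lnMn 2 480 960 erefl isT isT.
have e961 := lnMn 31 31 961 erefl isT isT.
have e32 := lnMn 2 16 32 erefl isT isT.
have e64 := lnMn 2 32 64 erefl isT isT.
have e128 := lnMn 2 64 128 erefl isT isT.
have e129 := lnMn 3 43 129 erefl isT isT.
have e159 := lnMn 3 53 159 erefl isT isT.
have e160 := lnMn 2 80 160 erefl isT isT.
have e57 := lnMn 3 19 57 erefl isT isT.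
have e114 := lnMn 2 57 114 erefl isT isT.
have e228 := lnMn 2 114 228 erefl isT isT.
rewrite /= in e4 e6 e8 e9 e10 e12 e15 e16 e18 e20 e21 e24 e25 e27 e30 e32 e36 e40 e42 e45 e48
  e49 e57 e60 e64 e72 e80 e81 e84 e90 e114 e120 e128 e129 e144 e159 e160 e168 e169 e180 e228
  e240 e288 e289 e360 e361 e480 e960 e961.
have d80 : ln 81 - ln (80 : R) = 4 * ln 3 - 4 * ln 2 - ln 5.
  by rewrite ?e81 ?e80 ?e40 ?e27 ?e20 ?e10 ?e9; ring.
have d24 : ln 25 - ln (24 : R) = 2 * ln 5 - 3 * ln 2 - ln 3.
  by rewrite ?e25 ?e24 ?e12 ?e6; ring.
have d15 : ln 16 - ln (15 : R) = 4 * ln 2 - ln 3 - ln 5.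
  by rewrite ?e16 ?e15 ?e8 ?e4; ring.
have d48 : ln 49 - ln (48 : R) = 2 * ln 7 - 4 * ln 2 - ln 3.
  by rewrite ?e49 ?e48 ?e24 ?e12 ?e6; ring.
have d168 : ln 169 - ln (168 : R) = 2 * ln 13 - 3 * ln 2 - ln 3 - ln 7.
  by rewrite ?e169 ?e168 ?e84 ?e42 ?e21; ring.
have d288 : ln 289 - ln (288 : R) = 2 * ln 17 - 5 * ln 2 - 2 * ln 3.
  by rewrite ?e289 ?e288 ?e144 ?e72 ?e36 ?e18 ?e9; ring.
have d360 : ln 361 - ln (360 : R) = 2 * ln 19 - 3 * ln 2 - 2 * ln 3 - ln 5.
  by rewrite ?e361 ?e360 ?e180 ?e90 ?e45 ?e15; ring.
have d960 : ln 961 - ln (960 : R) = 2 * ln 31 - 6 * ln 2 - ln 3 - ln 5.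
  by rewrite ?e961 ?e960 ?e480 ?e240 ?e120 ?e60 ?e30 ?e15; ring.
have d128 : ln 129 - ln (128 : R) = ln 3 + ln 43 - 7 * ln 2.
  by rewrite ?e129 ?e128 ?e64 ?e32 ?e16 ?e8 ?e4; ring.
have d159 : ln 160 - ln (159 : R) = 5 * ln 2 + ln 5 - ln 3 - ln 53.
  by rewrite ?e160 ?e159 ?e80 ?e40 ?e20 ?e10; ring.
have d72 : ln 73 - ln (72 : R) = ln 73 - 3 * ln 2 - 2 * ln 3.
  by rewrite ?e72 ?e36 ?e18 ?e9; ring.
have d227 : ln 228 - ln (227 : R) = 2 * ln 2 + ln 3 + ln 19 - ln 227.
  by rewrite ?e228 ?e114 ?e57; ring.
have d239 : ln 240 - ln (239 : R) = 4 * ln 2 + ln 3 + ln 5 - ln 239.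
  by rewrite ?e240 ?e120 ?e60 ?e30 ?e15; ring.
(* 57360 = 4 * 14340, and adding 1 / 2 removes the rational term - 7170 / 14340. *)
rewrite /c_diamond /c_part1 /c_part2 /c_part3.
rewrite d80 d24 d15 d48 d168 d288 d360 d960 d128 d159 d72 d227 d239; clear.
move: (ln 2%:R : R) (ln 3%:R : R) (ln 5%:R : R) (ln 7%:R : R) (ln 13%:R : R) (ln 17%:R : R) (ln
  19%:R : R) (ln 31%:R : R) (ln 43%:R : R) (ln 53%:R : R) (ln 73%:R : R) (ln 227%:R : R) (ln
  239%:R : R) => *.
by field.
Qed.

(** A classical decomposition of ln 2 along the three differences that make up [c_part1], so that
    the two can be subtracted before any bound is taken. *)
Lemma ln2_combination : ln 2 = 3 * (ln 81 - ln 80) + 5 * (ln 25 - ln 24) + 7 * (ln 16 - ln 15) :> R.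
Proof.
have lnMn (a b : nat) : (0 < a)%N -> (0 < b)%N -> ln (a * b)%:R = ln a%:R + ln b%:R :> R.
  by move=> a0 b0; rewrite natrM lnM// posrE ltr0n.
have e81 := lnMn 9 9 isT isT; have e9 := lnMn 3 3 isT isT; have e80 := lnMn 16 5 isT isT.
have e16 := lnMn 4 4 isT isT; have e4 := lnMn 2 2 isT isT; have e25 := lnMn 5 5 isT isT.
have e24 := lnMn 8 3 isT isT; have e8 := lnMn 2 4 isT isT; have e15 := lnMn 3 5 isT isT.
rewrite /= in e81 e9 e80 e16 e4 e25 e24 e8 e15.
rewrite e81 e9 e80 e16 e25 e24 e8 e4 e15; ring.
Qed.

(** The second pair of bounds serves c - ln 2 / 2, and 28680 is half of 57360. *)
Lemma c_part1_bounds :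
  ((25 * 10 ^+ 3 + 591) + 37 / 10 ^+ 2 + 68 / 10 ^+ 4) <= c_part1 <= ((25 * 10 ^+ 3 + 591) + 37
    / 10 ^+ 2 + 70 / 10 ^+ 4) /\
  ((5 * 10 ^+ 3 + 711) + 91 / 10 ^+ 2 + 57 / 10 ^+ 4) <= c_part1 - (28 * 10 ^+ 3 + 680) * ln 2
    <= ((5 * 10 ^+ 3 + 711) + 91 / 10 ^+ 2 + 58 / 10 ^+ 4).
Proof.
have /andP[l80 u80] : 12 / 10 ^+ 3 + 422 / 10 ^+ 6 + 519 / 10 ^+ 9 + 998 / 10 ^+ 12 <= ln 81 -
  ln (80 : R)
    <= 12 / 10 ^+ 3 + 422 / 10 ^+ 6 + 519 / 10 ^+ 9 + 999 / 10 ^+ 12.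
  clear; have /andP[h1 h2] := @ln_succ_bounds 80 81 (1 / 161) ltac:(lra) ltac:(lra) ltac:(lra).
  by apply/andP; split; move: h1 h2; lra.
have /andP[l24 u24] : 40 / 10 ^+ 3 + 821 / 10 ^+ 6 + 994 / 10 ^+ 9 + 519 / 10 ^+ 12 <= ln 25 -
  ln (24 : R)
    <= 40 / 10 ^+ 3 + 821 / 10 ^+ 6 + 994 / 10 ^+ 9 + 521 / 10 ^+ 12.
  clear; have /andP[h1 h2] := @ln_succ_bounds 24 25 (1 / 49) ltac:(lra) ltac:(lra) ltac:(lra).
  by apply/andP; split; move: h1 h2; lra.
have /andP[l15 u15] : 64 / 10 ^+ 3 + 538 / 10 ^+ 6 + 521 / 10 ^+ 9 + 127 / 10 ^+ 12 <= ln 16 -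
  ln (15 : R)
    <= 64 / 10 ^+ 3 + 538 / 10 ^+ 6 + 521 / 10 ^+ 9 + 139 / 10 ^+ 12.
  clear; have /andP[h1 h2] := @ln_succ_bounds 15 16 (1 / 31) ltac:(lra) ltac:(lra) ltac:(lra).
  by apply/andP; split; move: h1 h2; lra.
rewrite ln2_combination; split; apply/andP; split.
- move: l80 l24 l15; rewrite /c_part1; clear.
  by move: (ln 81 - ln 80 : R) (ln 25 - ln 24 : R) (ln 16 - ln 15 : R) => *; lra.
- move: u80 u24 u15; rewrite /c_part1; clear.
  by move: (ln 81 - ln 80 : R) (ln 25 - ln 24 : R) (ln 16 - ln 15 : R) => *; lra.
(* The coefficient of ln 81 - ln 80 is now 8677 - 3 * 28680 < 0, so its upper bound enters the lower
   estimate. *)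
- move: u80 l24 l15; rewrite /c_part1; clear.
  by move: (ln 81 - ln 80 : R) (ln 25 - ln 24 : R) (ln 16 - ln 15 : R) => *; lra.
- move: l80 u24 u15; rewrite /c_part1; clear.
  by move: (ln 81 - ln 80 : R) (ln 25 - ln 24 : R) (ln 16 - ln 15 : R) => *; lra.
Qed.

Lemma c_part2_bounds :
  (678 + 80 / 10 ^+ 2 + 51 / 10 ^+ 4) <= c_part2 <= (678 + 80 / 10 ^+ 2 + 52 / 10 ^+ 4).
Proof.
have /andP[l48 u48] : 20 / 10 ^+ 3 + 619 / 10 ^+ 6 + 287 / 10 ^+ 9 + 202 / 10 ^+ 12 <= ln 49 -
  ln (48 : R)
    <= 20 / 10 ^+ 3 + 619 / 10 ^+ 6 + 287 / 10 ^+ 9 + 203 / 10 ^+ 12.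
  clear; have /andP[h1 h2] := @ln_succ_bounds 48 49 (1 / 97) ltac:(lra) ltac:(lra) ltac:(lra).
  by apply/andP; split; move: h1 h2; lra.
have /andP[l168 u168] : 5 / 10 ^+ 3 + 934 / 10 ^+ 6 + 735 / 10 ^+ 9 + 519 / 10 ^+ 12 <= ln 169 -
  ln (168 : R)
    <= 5 / 10 ^+ 3 + 934 / 10 ^+ 6 + 735 / 10 ^+ 9 + 520 / 10 ^+ 12.
  clear; have /andP[h1 h2] := @ln_succ_bounds 168 169 (1 / 337) ltac:(lra) ltac:(lra) ltac:(lra).
  by apply/andP; split; move: h1 h2; lra.
have /andP[l288 u288] : 3 / 10 ^+ 3 + 466 / 10 ^+ 6 + 207 / 10 ^+ 9 + 976 / 10 ^+ 12 <= ln 289 -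
  ln (288 : R)
    <= 3 / 10 ^+ 3 + 466 / 10 ^+ 6 + 207 / 10 ^+ 9 + 977 / 10 ^+ 12.
  clear; have /andP[h1 h2] := @ln_succ_bounds 288 289 (1 / 577) ltac:(lra) ltac:(lra) ltac:(lra).
  by apply/andP; split; move: h1 h2; lra.
have /andP[l360 u360] : 2 / 10 ^+ 3 + 773 / 10 ^+ 6 + 926 / 10 ^+ 9 + 882 / 10 ^+ 12 <= ln 361 -
  ln (360 : R)
    <= 2 / 10 ^+ 3 + 773 / 10 ^+ 6 + 926 / 10 ^+ 9 + 883 / 10 ^+ 12.
  clear; have /andP[h1 h2] := @ln_succ_bounds 360 361 (1 / 721) ltac:(lra) ltac:(lra) ltac:(lra).
  by apply/andP; split; move: h1 h2; lra.
have /andP[l960 u960] : 1 / 10 ^+ 3 + 41 / 10 ^+ 6 + 124 / 10 ^+ 9 + 508 / 10 ^+ 12 <= ln 961 -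
  ln (960 : R)
    <= 1 / 10 ^+ 3 + 41 / 10 ^+ 6 + 124 / 10 ^+ 9 + 509 / 10 ^+ 12.
  clear; have /andP[h1 h2] := @ln_succ_bounds 960 961 (1 / 1921) ltac:(lra) ltac:(lra) ltac:(lra).
  by apply/andP; split; move: h1 h2; lra.
apply/andP; split.
- move: l48 l168 u288 u360 u960; rewrite /c_part2; clear.
  by move: (ln 49 - ln 48 : R) (ln 169 - ln 168 : R) (ln 289 - ln 288 : R) (ln 361 - ln 360 : R)
    (ln 961 - ln 960 : R) => *; lra.
- move: u48 u168 l288 l360 l960; rewrite /c_part2; clear.
  by move: (ln 49 - ln 48 : R) (ln 169 - ln 168 : R) (ln 289 - ln 288 : R) (ln 361 - ln 360 : R)
    (ln 961 - ln 960 : R) => *; lra.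
Qed.

Lemma c_part3_bounds :
  - (413 + 56 / 10 ^+ 2 + 13 / 10 ^+ 4) <= c_part3 <= - (413 + 56 / 10 ^+ 2 + 12 / 10 ^+ 4).
Proof.
have /andP[l128 u128] : 7 / 10 ^+ 3 + 782 / 10 ^+ 6 + 140 / 10 ^+ 9 + 442 / 10 ^+ 12 <= ln 129 -
  ln (128 : R)
    <= 7 / 10 ^+ 3 + 782 / 10 ^+ 6 + 140 / 10 ^+ 9 + 443 / 10 ^+ 12.
  clear; have /andP[h1 h2] := @ln_succ_bounds 128 129 (1 / 257) ltac:(lra) ltac:(lra) ltac:(lra).
  by apply/andP; split; move: h1 h2; lra.
have /andP[l159 u159] : 6 / 10 ^+ 3 + 269 / 10 ^+ 6 + 613 / 10 ^+ 9 + 13 / 10 ^+ 12 <= ln 160 -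
  ln (159 : R)
    <= 6 / 10 ^+ 3 + 269 / 10 ^+ 6 + 613 / 10 ^+ 9 + 14 / 10 ^+ 12.
  clear; have /andP[h1 h2] := @ln_succ_bounds 159 160 (1 / 319) ltac:(lra) ltac:(lra) ltac:(lra).
  by apply/andP; split; move: h1 h2; lra.
have /andP[l72 u72] : 13 / 10 ^+ 3 + 793 / 10 ^+ 6 + 322 / 10 ^+ 9 + 132 / 10 ^+ 12 <= ln 73 -
  ln (72 : R)
    <= 13 / 10 ^+ 3 + 793 / 10 ^+ 6 + 322 / 10 ^+ 9 + 133 / 10 ^+ 12.
  clear; have /andP[h1 h2] := @ln_succ_bounds 72 73 (1 / 145) ltac:(lra) ltac:(lra) ltac:(lra).
  by apply/andP; split; move: h1 h2; lra.
have /andP[l227 u227] : 4 / 10 ^+ 3 + 395 / 10 ^+ 6 + 611 / 10 ^+ 9 + 473 / 10 ^+ 12 <= ln 228 -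
  ln (227 : R)
    <= 4 / 10 ^+ 3 + 395 / 10 ^+ 6 + 611 / 10 ^+ 9 + 474 / 10 ^+ 12.
  clear; have /andP[h1 h2] := @ln_succ_bounds 227 228 (1 / 455) ltac:(lra) ltac:(lra) ltac:(lra).
  by apply/andP; split; move: h1 h2; lra.
have /andP[l239 u239] : 4 / 10 ^+ 3 + 175 / 10 ^+ 6 + 371 / 10 ^+ 9 + 410 / 10 ^+ 12 <= ln 240 -
  ln (239 : R)
    <= 4 / 10 ^+ 3 + 175 / 10 ^+ 6 + 371 / 10 ^+ 9 + 411 / 10 ^+ 12.
  clear; have /andP[h1 h2] := @ln_succ_bounds 239 240 (1 / 479) ltac:(lra) ltac:(lra) ltac:(lra).
  by apply/andP; split; move: h1 h2; lra.
apply/andP; split.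
- move: u128 l159 u72 l227 u239; rewrite /c_part3; clear.
  by move: (ln 129 - ln 128 : R) (ln 160 - ln 159 : R) (ln 73 - ln 72 : R) (ln 228 - ln 227 : R)
    (ln 240 - ln 239 : R) => *; lra.
- move: l128 u159 l72 u227 l239; rewrite /c_part3; clear.
  by move: (ln 129 - ln 128 : R) (ln 160 - ln 159 : R) (ln 73 - ln 72 : R) (ln 228 - ln 227 : R)
    (ln 240 - ln 239 : R) => *; lra.
Qed.

Lemma c_diamond_bounds :
  - (49223%:R / 10 ^+ 6) < c_diamond R <= - (49222%:R / 10 ^+ 6) /\
   - (395796%:R / 10 ^+ 6) < c_diamond R - 1 / 2 * ln 2
     <= - (395795%:R / 10 ^+ 6).
Proof.
have [/andP[l1 u1] /andP[l1' u1']] := c_part1_bounds; have /andP[l2 u2] := c_part2_bounds.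
have /andP[l3 u3] := c_part3_bounds; have e := c_diamond_partE.
move: l1 u1 l1' u1' l2 u2 l3 u3 e.
move: c_part1 c_part2 c_part3 (c_diamond R) (ln (2 : R)); clear => p1 p2 p3 c l.
move=> l1 u1 l1' u1' l2 u2 l3 u3 e; split.
  by clear l1' u1'; apply/andP; split; lra.
by clear l1 u1; apply/andP; split; lra.
Qed.
End numerics.

(** * The theorem *)

Section final.
Context {R : realType}.
Implicit Types (x y : 'rV[R]_3) (z w a b t : R) (N : nat).

Local Notation proj_neq := (fun x y => (x != y) && (x != - y)).

Lemma dotp_ptt z a : `|z| <= 1 -> dotp (pt z a) (pt z a) = 1.
Proof.
move=> z1; have h : 0 <= 1 - z ^+ 2 by rewrite subr_ge0 -real_normK ?num_real// exprn_ile1.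
by rewrite dotp_pt subrr cos0 mulr1 -[X in _ + X]expr2 sqr_sqrtr//; ring.
Qed.

Lemma dotpN x y : dotp x (- y) = - dotp x y.
Proof. by rewrite /dotp -sumrN; apply: eq_bigr => i _; rewrite !mxE mulrN. Qed.

Lemma proj_neq_dotp x y : dotp x x = 1 -> dotp x y ^+ 2 != 1 -> proj_neq x y.
Proof.
move=> xx xy; apply/andP; split; apply: contraNneq xy => xE.
  by rewrite -xE xx expr1n.
by rewrite -[y]opprK -xE dotpN xx sqrrN expr1n.
Qed.

Lemma proj_neq_height z w a b : 0 <= w -> w < z -> proj_neq (pt z a) (pt w b).
Proof.
move=> w0 wz; apply/andP; split; apply/eqP => /matrixP /(_ 0 ord_max); rewrite !mxE /=; lra.
Qed.

Lemma proj_neq_parallel z a b : 0 < z < 1 -> cos (a - b) != 1 -> proj_neq (pt z a) (pt z b).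
Proof.
move=> /andP[z0 z1] ab; apply/proj_neq_dotp; first by rewrite dotp_ptt// ger0_norm; lra.
rewrite dotp_pt -[_ * Num.sqrt _]expr2 sqr_sqrtr; last by nra.
have := cos_le1 (a - b); have := cos_geN1 (a - b); move: (cos _) ab => c /eqP ab c1 c2.
have {ab}c3 : c < 1 by rewrite lt_neqAle c2 andbT; apply/eqP.
have z2 : 0 < 1 - z ^+ 2 by nra.
have h1 : 0 < (1 - z ^+ 2) * (1 - c) by rewrite mulr_gt0//; lra.
have h2 : 0 <= (1 - z ^+ 2) * (1 + c) by rewrite mulr_ge0//; lra.
have h3 : 0 < z ^+ 2 by rewrite exprn_gt0.
set s := _ + _.
have s1 : s < 1 by rewrite /s; lra.
have s2 : -1 < s by rewrite /s; lra.
have : 0 < (1 - s) * (1 + s) by rewrite mulr_gt0//; lra.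
by move=> h; apply/eqP => h'; lra.
Qed.

(** On the equator <x, y>^2 = cos^2 (a - b), and doubling the angle identifies antipodes. *)
Lemma proj_neq_equator a b : cos (2 * a - 2 * b) != 1 -> proj_neq (pt 0 a) (pt 0 b).
Proof.
move=> ab; apply/proj_neq_dotp; first by rewrite dotp_ptt// normr0.
rewrite dotp_pt expr0n subr0 sqrtr1 mul0r add0r !mul1r.
apply: contraNneq ab; rewrite -mulrBr mulr_natl cos_mulr2n => ->.
by apply/eqP; ring.
Qed.

Lemma pairwise_flatten_iota (T : Type) (e : rel T) (B : nat -> seq T) n :
  (forall j, (j < n)%N -> pairwise e (B j)) ->
  (forall j k, (j < k < n)%N -> allrel e (B j) (B k)) ->
  pairwise e (flatten [seq B j | j <- iota 0 n]).
Proof.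
move=> h1 h2; suff h m k : (m + k <= n)%N -> pairwise e (flatten [seq B j | j <- iota m k]) by
  exact: h.
elim: k m => [//|k IH] m mk /=; rewrite pairwise_cat h1/=; last by lia.
rewrite IH ?andbT; last by lia.
have : all (fun j => (m < j < n)%N) (iota m.+1 k).
  by apply/allP => j; rewrite mem_iota; lia.
elim: (iota _ _) => [|j s IHs] /=; first by rewrite allrel0r.
by case/andP => mj /IHs; rewrite allrel_catr h2.
Qed.

Lemma pairwise_pt z (f : nat -> R) n (e : rel 'rV[R]_3) :
  (forall i l : 'I_n, l != i -> e (pt z (f i)) (pt z (f l))) ->
  pairwise e [seq pt z (f i) | i <- iota 0 n].
Proof.
move=> h; rewrite pairwise_map; apply/(pairwiseP 0%N) => i l.
rewrite !inE size_iota => i_n l_n il; rewrite !nth_iota//= !add0n.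
apply: (h (Ordinal i_n) (Ordinal l_n)); by apply/eqP => -[]; lia.
Qed.

Lemma RP2_points_diamond N (th : (diamond_M R N).-1.-tuple R) : (121 <= N)%N ->
  RP2_points N (diamond th).
Proof.
move=> N121; rewrite diamond_blocks//; set M := diamond_M R N.
have M7 := @diamond_M_ge7 R N N121; split.
- rewrite size_flatten /shape -map_comp sumnE big_map.
  apply/eqP; rewrite -(eqr_nat R) natr_sum -(@sum_block_n_all R N N121); apply/eqP.
  rewrite /index_iota subn0; apply: eq_bigr => j _.
  by rewrite /= /block size_map size_iota.
- move=> x /flattenP[s /mapP[j]]; rewrite mem_iota add0n => /= jM -> /mapP[i _ ->].
  by apply: dotp_ptt; rewrite ger0_norm ?block_z_ge0 ?block_z_le1.
- apply: pairwise_flatten_iota => [j jM|j k jk]; last first.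
    apply/allrelP => x y /mapP[i _ ->] /mapP[l _ ->].
    by apply: proj_neq_height; [apply: block_z_ge0|apply: block_z_lt]; rewrite -/M; lia.
  apply: pairwise_pt; rewrite /block_n /block_angle.
  have [->|j0] := eqVneq j 0%N; first by move=> i l; rewrite !ord1 eqxx.
  have [jE|jM'] := eqVneq j M.
    rewrite /block_z (negPf j0) jE (@diamond_z_last R N N121) => i l li.
    apply: proj_neq_equator; set r := diamond_r R N M in i l li *.
    have rE : r%:R = 2 * (r %/ 2)%:R :> R.
      by rewrite -[in LHS](odd_double_half r) odd_diamond_r_last// add0n -mul2n natrM divn2.
    have n0 : (r %/ 2)%:R != 0 :> R by rewrite pnatr_eq0; case: (r %/ 2)%N i {rE l li} => [[]|].
    have := @cos_neq1 R _ i l li; congr (cos (_ - _) != 1); rewrite rE; field; exact: n0.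
  move=> i l li; apply: proj_neq_parallel.
    have -> /= : 0 < block_z (R := R) N j.
      apply: (le_lt_trans (@block_z_ge0 R N N121 M (leqnn _))).
      by apply: block_z_lt => //; rewrite -/M; lia.
    by apply: (@lt_le_trans _ _ (block_z N 0)) => //; apply: block_z_lt => //; rewrite -/M; lia.
  rewrite opprD addrACA subrr addr0 -!natr1.
  have := @cos_neq1 R _ i l li; congr (cos _ != 1); ring.
Qed.

(* Below the range of the construction, N points of the equator. *)
Lemma RP2_points_equator N : RP2_points N [seq pt (0 : R) (pi * i%:R / N%:R) | i <- iota 0 N].
Proof.
split; first by rewrite size_map size_iota.
  by move=> x /mapP[i _ ->]; apply: dotp_ptt; rewrite normr0.
apply: pairwise_pt => i l li; apply: proj_neq_equator.
by have := @cos_neq1 R _ i l li; congr (cos (_ - _) != 1); ring.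
Qed.

(** If m <= 2 then 2 N < 239 * 9 + 2 = 2153. *)
Lemma large_of_ge N : (1200 <= N)%N -> large (R := R) N.
Proof.
move=> N12; have N121 : (121 <= N)%N by lia.
rewrite /large N121 /=.
have /andP[_] := @diamond_m_bounds R N N121.
case: (diamond_m R N) => [|[|[|?]]]; lia.
Qed.

(** Since 239 m^2 / 2 <= N, both m <= sqrt N and ln m <= ln N; the isolated summand 1 is at most ln
    N / ln 2. *)
Lemma err_le N : large (R := R) N -> @err R N <= (1 + (ln 2)^-1) * `|Num.sqrt N%:R * ln N%:R|.
Proof.
move=> Nl; have m3 := large_m Nl; have /andP[k _] := N_bounds Nl; have [N121 _] := andP Nl.
rewrite /err; move: m3 k; set m : R := (diamond_m R N)%:R => m3 k.
have N2 : 2 <= N%:R :> R by rewrite (ler_nat R 2); clear -N121; lia.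
have mN : m ^+ 2 <= N%:R.
  by have := sqr_ge0 m; move: k; clear; move: (m ^+ 2) (N%:R : R) => *; lra.
have mm : m <= N%:R by apply: le_trans mN; rewrite expr2 ler_peMr//; lra.
have ln2 : 0 < ln (2 : R) by rewrite ln_gt0//; lra.
have lN : ln 2 <= ln (N%:R : R) by rewrite ler_ln ?posrE//; lra.
have lm : ln m <= ln (N%:R : R) by rewrite ler_ln ?posrE//; lra.
have sm : m <= Num.sqrt N%:R.
  by rewrite -(ler_sqr (x := m)) ?nnegrE ?sqrtr_ge0 ?sqr_sqrtr//; lra.
rewrite ger0_norm; last by rewrite mulr_ge0 ?sqrtr_ge0//; lra.
rewrite mulrCA; apply: ler_pM => //; first by rewrite addr_ge0// ln_ge0//; lra.
rewrite mulrDl mul1r addrC lerD//.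
by rewrite mulrC ler_pdivlMr// mul1r.
Qed.
End final.

Theorem theorem1p3 (R : realType) :
  (exists X : forall N : nat, (diamond_M R N).-1.-tuple R -> seq 'rV[R]_3,
    [/\ forall (N : nat) (theta : (diamond_M R N).-1.-tuple R),
          RP2_points N (X N theta),
        forall N : nat, (121 <= N)%N -> X N = @diamond R N,
        forall N : nat,
          (phase_law R (diamond_M R N).-1).-integrable setT
            (fun theta => (log_energy (X N theta))%:E) &
        (fun N : nat =>
           fine 'E_(phase_law R (diamond_M R N).-1)
                  [fun theta => log_energy (X N theta)]) =
        (fun N : nat =>
           W_log_RP2 R * N%:R ^+ 2 - 1 / 2 * N%:R * ln N%:R
           + (c_diamond R - 1 / 2 * ln 2) * N%:R)
        +O_\oo (fun N : nat => Num.sqrt N%:R * ln N%:R)]) /\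
  (- (49223%:R / 10 ^+ 6) < c_diamond R <= - (49222%:R / 10 ^+ 6) /\
   - (395796%:R / 10 ^+ 6) < c_diamond R - 1 / 2 * ln 2
     <= - (395795%:R / 10 ^+ 6)).
Proof.
split; last exact: c_diamond_bounds.
exists (fun N theta => if (121 <= N)%N then diamond theta
                       else [seq pt 0 (pi * i%:R / N%:R) | i <- iota 0 N]); split.
- move=> N theta; case: ifP => [N121|_]; first exact: RP2_points_diamond.
  exact: RP2_points_equator.
- by move=> N N121; apply/funext => theta; rewrite N121.
- move=> N; have [N121|_] := boolP (121 <= N)%N.
    exact: (has_mean_diamond_closed N121).1.
  (* Below 121 the energy is constant in the phases. *)
  exact: (has_mean_cst _ _).1.
apply/eqaddOP; have [C HC] := @asym_mean R.
exists (`|C| * (1 + (ln 2)^-1)); split; first exact: num_real.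
move=> k Ck; exists 1200%N => //= N /= N12.
have Nl : large (R := R) N by exact: large_of_ge.
have N121 : (121 <= N)%N by lia.
rewrite fctE N121 (integral_has_mean (has_mean_diamond_closed N121)).
apply: le_trans (HC N Nl) _.
have e0 : 0 <= @err R N by apply: le_trans (err_ge Nl); rewrite ler0n.
apply: (@le_trans _ _ (`|C| * @err R N)); first by rewrite ler_wpM2r// ler_norm.
apply: le_trans (ler_wpM2l (normr_ge0 C) (err_le Nl)) _.
by rewrite mulrA ler_wpM2r// ltW.
Qed.
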